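(* Let $p_1, p_2, \alpha_1, \alpha_2$ be non-zero complex constants with $\alpha_1\neq\alpha_2$, let $\beta\in\mathbb{C}$ be any constant, let $a(z)$ be a non-zero polynomial and let $k\geq 0$ be an integer. Suppose that $f$ is a transcendental entire function of finite order and of regular growth, having $0$ as a Picard exceptional value, which is a solution of the differential-difference equation $$f^2(z)+a(z)f^{(k)}(z+\beta)=p_1e^{\alpha_1 z}+p_2e^{\alpha_2 z}.$$ Then $\rho(f)=1$, $a(z)\equiv a$ must be a constant, and one of the following holds: (i) $f(z)=c_1e^{\frac{\alpha_1 z}{2}}$, $\; a c_1\left(\frac{\alpha_1}{2}\right)^k e^{\frac{\alpha_1\beta}{2}}=p_2$, $\;\alpha_1=2\alpha_2$; (ii) $f(z)=c_2e^{\frac{\alpha_2 z}{2}}$, $\; a c_2\left(\frac{\alpha_2}{2}\right)^k e^{\frac{\alpha_2\beta}{2}}=p_1$, $\;\alpha_2=2\alpha_1$; where $c_1, c_2$ are constants satisfying $c_i^2=p_i$, $i=1,2$.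
   Context: $T(r,f)$ is the Nevanlinna characteristic function of $f$. The order is $\rho(f)=\limsup_{r\to\infty}\frac{\log^+ T(r,f)}{\log r}$. An entire function $f$ is of regular growth if its lower order $\liminf_{r\to\infty}\frac{\log^+ T(r,f)}{\log r}$ equals its order $\rho(f)$. The value $0$ is a Picard exceptional value of a transcendental entire function $f$ if $f$ has at most finitely many zeros. $f^{(k)}$ is the $k$-th derivative, $f^{(0)}=f$, and $f^2(z)=(f(z))^2$. *)

(* Defs.v *)
(* Stdlib reals with Coquelicot's complex numbers. *)
From Stdlib Require Import Reals List.
From Coquelicot Require Export Coquelicot.

Open Scope R_scope.

Definition Cexp (z : C) : C :=
  (exp (Re z) * cos (Im z), exp (Re z) * sin (Im z)).

Definition entire (f : C -> C) : Prop :=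
  forall z : C, @ex_derive C_AbsRing C_NormedModule f z.

(* [C_derive] takes the limit of the difference quotient along the horizontal
   direction only; wherever [ex_derive] holds over C, that limit is the complex
   derivative ([C_derive_correct]). *)
Definition C_derive_n (f : C -> C) (k : nat) : C -> C := Nat.iter k C_derive f.

Definition is_polynomial (p : C -> C) : Prop :=
  exists (n : nat) (c : nat -> C),
    forall z : C, p z = sum_n (fun i => (c i * z ^ i)%C) n.

Definition transcendental_entire (f : C -> C) : Prop :=
  entire f /\ ~ is_polynomial f.

Definition finitely_many_zeros (f : C -> C) : Prop :=
  exists l : list C, forall z : C, f z = RtoC 0 -> In z l.

(* [ln x] is 0 for [x <= 0], so [log_plus 0 = 0], as is customary. *)
Definition log_plus (x : R) : R := Rmax (ln x) 0.

(* T(r,f) = m(r,f) + N(r,f), where N(r,f) counts the poles of f.  The definition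
   below is meant for entire f, for which N(r,f) = 0 and T(r,f) is the proximity
   function m(r,f), the mean of log^+ |f| over the circle |z| = r. *)
Definition nevanlinna_T (r : R) (f : C -> C) : R :=
  / (2 * PI) *
  RInt (fun t => log_plus (Cmod (f (r * cos t, r * sin t)))) 0 (2 * PI).

Definition limsup_infty (g : R -> R) : Rbar :=
  Rbar_glb (fun y => exists A : R,
    y = Lub_Rbar (fun x => exists r : R, A < r /\ x = g r)).

Definition liminf_infty (g : R -> R) : Rbar :=
  Rbar_lub (fun y => exists A : R,
    y = Glb_Rbar (fun x => exists r : R, A < r /\ x = g r)).

Definition order (f : C -> C) : Rbar :=
  limsup_infty (fun r => log_plus (nevanlinna_T r f) / ln r).

Definition lower_order (f : C -> C) : Rbar :=
  liminf_infty (fun r => log_plus (nevanlinna_T r f) / ln r).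

Definition finite_order (f : C -> C) : Prop := is_finite (order f).

Definition regular_growth (f : C -> C) : Prop := lower_order f = order f.

(* Main.v *)
Require Import Defs.
From Stdlib Require Import Reals List Lra Lia Psatz Classical ClassicalEpsilon ZArith
  Ranalysis5 FunctionalExtensionality.
From Coquelicot Require Import Coquelicot.

Open Scope R_scope.

(** In the coordinate [w] with [z = exp w], Goursat's theorem on rectangles of
    height [2 pi] shows that the n-th Fourier coefficient of a function
    holomorphic in [z] on the circle of radius [r] is [h n * r ^ n].  Since [f]
    has finitely many zeros, [log f - mu w] is holomorphic and periodic in a half
    plane for a suitable real [mu]; the bound on the mean of [log^+ |f|] given by
    finite order kills [h n] for large [n], so that [log f - mu w] differs from a
    polynomial [Q (z)] by a bounded function (Fejer's kernel controls the negative
    tail).  Hence [f exp(-Q)] is entire of polynomial growth and [f = P exp Q].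
    Inserting this in the equation, [exp (2 Q)] would dominate in some direction
    if [deg Q >= 2]; so [Q] is linear, and exponentials with distinct exponents
    being independent over the polynomials, [{2 gam, gam} = {alpha1, alpha2}]
    and [P ^ 2] is constant. *)

(** * Continuity and complex differentiability *)

(** The only theorem on holomorphic functions behind everything is Goursat's: there are no power
    series and no residues, and a holomorphic function is read solely through its Fourier
    coefficients on circles. The coordinate [w] makes this possible, since an annulus becomes a
    rectangle whose horizontal sides cancel by periodicity. The obstacle is that [log f - mu w]
    lives only outside a disc containing the zeros, so its coefficients of negative index cannot be
    discarded. They decay geometrically away from the boundary circle, and Fejer's kernel turns
    bounds on absolute sums of coefficients into bounds on the values of a merely continuous
    function. The number [mu] is the winding number of [f] on large circles and enters only through
    the growth [|z| ^ mu]. The coefficients [h n] do not depend on the radius, which is why a growth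
    bound at arbitrarily large single radii is enough to kill them. *)

Lemma continuous_C_pair {U : UniformSpace} (f : U -> C) (x : U) :
  continuous (fun t => fst (f t)) x -> continuous (fun t => snd (f t)) x ->
  continuous f x.
Proof.
intros H1 H2 P [e He]. unfold filtermap.
assert (A1 : locally x (fun t => ball (fst (f x)) e (fst (f t)))).
{ exact (H1 _ (locally_ball (fst (f x)) e)). }
assert (A2 : locally x (fun t => ball (snd (f x)) e (snd (f t)))).
{ exact (H2 _ (locally_ball (snd (f x)) e)). }
generalize (filter_and _ _ A1 A2). apply filter_imp.
intros y [B1 B2]. apply He. split; assumption.
Qed.

Lemma continuous_C_fst {U : UniformSpace} (f : U -> C) (x : U) :
  continuous f x -> continuous (fun t => fst (f t)) x.
Proof. intros H. apply (continuous_comp f fst); [exact H | apply continuous_fst]. Qed.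

Lemma continuous_C_snd {U : UniformSpace} (f : U -> C) (x : U) :
  continuous f x -> continuous (fun t => snd (f t)) x.
Proof. intros H. apply (continuous_comp f snd); [exact H | apply continuous_snd]. Qed.

Lemma continuous_Cplus {U : UniformSpace} (f g : U -> C) (x : U) :
  continuous f x -> continuous g x -> continuous (fun t => (f t + g t)%C) x.
Proof.
intros Hf Hg. apply continuous_C_pair; simpl;
apply (@continuous_plus U R_AbsRing R_NormedModule);
  auto using @continuous_C_fst, @continuous_C_snd.
Qed.

Lemma continuous_Copp {U : UniformSpace} (f : U -> C) (x : U) :
  continuous f x -> continuous (fun t => (- f t)%C) x.
Proof.
intros Hf. apply continuous_C_pair; simpl;
apply (@continuous_opp U R_AbsRing R_NormedModule);
  auto using @continuous_C_fst, @continuous_C_snd.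
Qed.

Lemma continuous_Cminus {U : UniformSpace} (f g : U -> C) (x : U) :
  continuous f x -> continuous g x -> continuous (fun t => (f t - g t)%C) x.
Proof.
intros Hf Hg. apply continuous_Cplus; [|apply continuous_Copp]; assumption.
Qed.

Lemma continuous_Rmult {U : UniformSpace} (f g : U -> R) (x : U) :
  continuous f x -> continuous g x -> continuous (fun t => f t * g t) x.
Proof. apply (@continuous_mult U R_AbsRing). Qed.

Lemma continuous_Rplus {U : UniformSpace} (f g : U -> R) (x : U) :
  continuous f x -> continuous g x -> continuous (fun t => f t + g t) x.
Proof. apply (@continuous_plus U R_AbsRing R_NormedModule). Qed.

Lemma continuous_Rminus {U : UniformSpace} (f g : U -> R) (x : U) :
  continuous f x -> continuous g x -> continuous (fun t => f t - g t) x.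
Proof. apply (@continuous_minus U R_AbsRing R_NormedModule). Qed.

Lemma continuous_Cmult {U : UniformSpace} (f g : U -> C) (x : U) :
  continuous f x -> continuous g x -> continuous (fun t => (f t * g t)%C) x.
Proof.
intros Hf Hg. apply continuous_C_pair; simpl;
[apply continuous_Rminus | apply continuous_Rplus]; apply continuous_Rmult;
  auto using @continuous_C_fst, @continuous_C_snd.
Qed.

Lemma continuous_RtoC {U : UniformSpace} (f : U -> R) (x : U) :
  continuous f x -> continuous (fun t => RtoC (f t)) x.
Proof.
intros Hf. apply continuous_C_pair; simpl; [assumption | apply continuous_const].
Qed.

Lemma continuous_Cinv {U : UniformSpace} (f : U -> C) (x : U) :
  f x <> RtoC 0 -> continuous f x -> continuous (fun t => (/ f t)%C) x.
Proof.
intros Hx Hf.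
assert (Hn : fst (f x) ^ 2 + snd (f x) ^ 2 <> 0).
{ intros H0. apply Hx. destruct (f x) as [u v]. simpl in H0.
  unfold RtoC. f_equal; nra. }
assert (Hd : continuous (fun t => / (fst (f t) ^ 2 + snd (f t) ^ 2)) x).
{ apply (continuous_comp (fun t => fst (f t) ^ 2 + snd (f t) ^ 2) Rinv).
  2: now apply continuous_Rinv.
  simpl. apply continuous_Rplus; apply continuous_Rmult;
    auto using @continuous_C_fst, @continuous_C_snd;
    apply continuous_Rmult;
    auto using @continuous_C_fst, @continuous_C_snd, @continuous_const. }
apply continuous_C_pair; unfold Rdiv; simpl; apply continuous_Rmult;
  try exact Hd; auto using @continuous_C_fst.
apply (@continuous_opp U R_AbsRing R_NormedModule). now apply continuous_C_snd.
Qed.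

Lemma continuous_Cmod {U : UniformSpace} (f : U -> C) (x : U) :
  continuous f x -> continuous (fun t => Cmod (f t)) x.
Proof.
intros Hf. unfold Cmod.
apply (continuous_comp (fun t => fst (f t) ^ 2 + snd (f t) ^ 2) sqrt).
2: apply continuous_sqrt.
simpl. apply continuous_Rplus; apply continuous_Rmult;
    auto using @continuous_C_fst, @continuous_C_snd;
    apply continuous_Rmult;
    auto using @continuous_C_fst, @continuous_C_snd, @continuous_const.
Qed.

Lemma Cmod_Ci : Cmod Ci = 1.
Proof.
unfold Cmod, Ci; simpl.
replace (0 * (0 * 1) + 1 * (1 * 1)) with 1 by ring. apply sqrt_1.
Qed.

Lemma im_le_Cmod (c : C) : Rabs (Im c) <= Cmod c.
Proof.
replace (Im c) with (Re (- (c * Ci))%C).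
- eapply Rle_trans; [apply re_le_Cmod|].
  rewrite Cmod_opp, Cmod_mult, Cmod_Ci. lra.
- rewrite re_opp, re_mult_Ci. ring.
Qed.

Lemma Cmod_le_abs (c : C) : Cmod c <= Rabs (Re c) + Rabs (Im c).
Proof.
destruct c as [u v]. simpl.
replace (u, v) with (RtoC u + Ci * RtoC v)%C.
2: { unfold Cplus, Cmult, RtoC, Ci; simpl; f_equal; ring. }
eapply Rle_trans; [apply Cmod_triangle|]. rewrite Cmod_mult, !Cmod_R, Cmod_Ci. lra.
Qed.

(** Neighbourhoods in [C] come from the product structure, whose balls are squares. Squares and
    discs contain one another up to a factor 2, so all later continuity arguments can be run with
    the modulus. *)
Lemma locally_Cmod (z : C) (P : C -> Prop) :
  locally z P <->
  exists d, 0 < d /\ forall w, Cmod (w - z) < d -> P w.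
Proof.
split.
- intros [e He]. exists e. split; [apply cond_pos|]. intros w Hw. apply He.
  split; [change (Rabs (fst w - fst z) < e) | change (Rabs (snd w - snd z) < e)].
  + eapply Rle_lt_trans; [|exact Hw]. apply (re_le_Cmod (w - z)).
  + eapply Rle_lt_trans; [|exact Hw]. apply (im_le_Cmod (w - z)).
- intros [d [Hd H]]. assert (Hd2 : 0 < d / 2) by lra.
  exists (mkposreal _ Hd2). intros w [H1 H2]. apply H.
  change (Rabs (fst w - fst z) < d / 2) in H1.
  change (Rabs (snd w - snd z) < d / 2) in H2.
  eapply Rle_lt_trans; [apply Cmod_le_abs|].
  change (Rabs (fst w - fst z) + Rabs (snd w - snd z) < d). lra.
Qed.

Lemma continuous_C_eps {U : UniformSpace} (f : U -> C) (x : U) :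
  continuous f x <->
  forall e, 0 < e -> locally x (fun y => Cmod (f y - f x) < e).
Proof.
split.
- intros H e He. apply (H (fun w => Cmod (w - f x) < e)).
  apply locally_Cmod. now exists e.
- intros H P HP. unfold filtermap. apply locally_Cmod in HP. destruct HP as [d [Hd HP]].
  generalize (H d Hd). apply filter_imp. intros y Hy. now apply HP.
Qed.

Lemma continuous_CC_eps (f : C -> C) (z : C) :
  continuous f z <->
  forall e, 0 < e -> exists d, 0 < d /\
    forall w, Cmod (w - z) < d -> Cmod (f w - f z) < e.
Proof.
rewrite continuous_C_eps. split; intros H e He.
- apply (proj1 (locally_Cmod _ _)), H, He.
- apply locally_Cmod, H, He.
Qed.

(* Caratheodory's form of the derivative: sums, products and compositions
   reduce to continuity. *)
Definition cderiv (f : C -> C) (z l : C) : Prop :=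
  exists phi : C -> C, continuous phi z /\ phi z = l /\
    forall w, f w = (f z + (w - z) * phi w)%C.

Lemma Cmult_div_cancel (a b : C) : b <> RtoC 0 -> (b * (a / b) = a)%C.
Proof. intros H. field. exact H. Qed.

Lemma cderiv_is_derive (f : C -> C) (z l : C) :
  cderiv f z l <-> @is_derive C_AbsRing C_NormedModule f z l.
Proof.
split.
- intros [phi [Hc [Hl Hf]]]. split; [apply is_linear_scal_l|].
  intros z' Hz'.
  apply (@is_filter_lim_locally_unique C_AbsRing (AbsRing_NormedModule C_AbsRing) z z')
    in Hz'. subst z'. intros e.
  (* [is_derive] over [C] uses the neighbourhoods of the absolute ring; [locally_C] passes between
     these and the product neighbourhoods handled by [locally_Cmod]. *)
  apply (proj1 (locally_C _ _)).
  apply locally_Cmod. apply continuous_CC_eps with (e := e) in Hc;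
    [|apply cond_pos].
  destruct Hc as [d [Hd Hc]]. exists d. split; [exact Hd|]. intros w Hw.
  specialize (Hc w Hw).
  change (Cmod ((f w - f z) - (w - z) * l) <= e * Cmod (w - z)).
  rewrite (Hf w).
  replace ((f z + (w - z) * phi w - f z - (w - z) * l))%C
    with ((phi w - l) * (w - z))%C by ring.
  rewrite Cmod_mult. apply Rmult_le_compat_r; [apply Cmod_ge_0|].
  rewrite <- Hl. lra.
- intros [_ H].
  (* The slope is the difference quotient, completed by the derivative at [z] itself. *)
  exists (fun w => if Ceq_dec w z then l else ((f w - f z) / (w - z))%C).
  split; [|split].
  + apply continuous_CC_eps. intros e He.
    specialize (H z (fun P HP => HP)).
    assert (He2 : 0 < e / 2) by lra.
    specialize (H (mkposreal _ He2)).
    apply (proj2 (locally_C _ _)) in H. apply locally_Cmod in H.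
    destruct H as [d [Hd H]]. exists d. split; [exact Hd|].
    intros w Hw. destruct (Ceq_dec z z) as [_|n]; [|easy].
    destruct (Ceq_dec w z) as [->|Hn].
    * replace (l - l)%C with (RtoC 0) by ring. now rewrite Cmod_0.
    * specialize (H w Hw).
      change (Cmod ((f w - f z) - (w - z) * l) <= e / 2 * Cmod (w - z)) in H.
      assert (Hne : (w - z)%C <> RtoC 0) by now apply Cminus_eq_contra.
      assert (Hp := proj1 (Cmod_gt_0 _) Hne).
      replace ((f w - f z) / (w - z) - l)%C
        with (((f w - f z) - (w - z) * l) / (w - z))%C by (field; exact Hne).
      rewrite Cmod_div by exact Hne.
      apply Rmult_lt_reg_r with (Cmod (w - z)); [exact Hp|].
      unfold Rdiv. rewrite Rmult_assoc, Rinv_l by lra. nra.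
  + destruct (Ceq_dec z z); easy.
  + intros w. destruct (Ceq_dec w z) as [->|Hn]; [ring|].
    rewrite Cmult_div_cancel by now apply Cminus_eq_contra. ring.
Qed.

Lemma cderiv_continuous (f : C -> C) (z l : C) : cderiv f z l -> continuous f z.
Proof.
intros [phi [Hc [Hl Hf]]].
apply (continuous_ext (fun w => f z + (w - z) * phi w)%C).
{ intros w. now rewrite <- Hf. }
apply continuous_Cplus; [apply continuous_const|].
apply continuous_Cmult; [|exact Hc].
apply continuous_Cminus; [apply continuous_id | apply continuous_const].
Qed.

Lemma cderiv_const (c z : C) : cderiv (fun _ => c) z (RtoC 0).
Proof.
exists (fun _ => RtoC 0). split; [apply continuous_const|]. split; [easy|].
intros w. ring.
Qed.

Lemma cderiv_id (z : C) : cderiv (fun w => w) z (RtoC 1).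
Proof.
exists (fun _ => RtoC 1). split; [apply continuous_const|]. split; [easy|].
intros w. ring.
Qed.

Lemma cderiv_plus (f g : C -> C) (z l m : C) :
  cderiv f z l -> cderiv g z m -> cderiv (fun w => f w + g w)%C z (l + m)%C.
Proof.
intros [phi [H1 [H2 H3]]] [psi [K1 [K2 K3]]].
exists (fun w => phi w + psi w)%C. split; [now apply continuous_Cplus|].
split; [now rewrite H2, K2|]. intros w. rewrite H3, K3. ring.
Qed.

Lemma cderiv_mult (f g : C -> C) (z l m : C) :
  cderiv f z l -> cderiv g z m ->
  cderiv (fun w => f w * g w)%C z (l * g z + f z * m)%C.
Proof.
intros Hf Hg. assert (Hgc := cderiv_continuous _ _ _ Hg).
destruct Hf as [phi [H1 [H2 H3]]]. destruct Hg as [psi [K1 [K2 K3]]].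
exists (fun w => phi w * g w + f z * psi w)%C.
split; [apply continuous_Cplus; apply continuous_Cmult; trivial;
  apply continuous_const|].
split; [now rewrite H2, K2|]. intros w. rewrite H3, (K3 w). ring.
Qed.

(** The slopes multiply, so the usual exceptional case [g w = g z] of the chain rule never
    arises. *)
Lemma cderiv_comp (f g : C -> C) (z l m : C) :
  cderiv f (g z) l -> cderiv g z m -> cderiv (fun w => f (g w)) z (l * m)%C.
Proof.
intros Hf Hg. assert (Hgc := cderiv_continuous _ _ _ Hg).
destruct Hf as [phi [H1 [H2 H3]]]. destruct Hg as [psi [K1 [K2 K3]]].
exists (fun w => phi (g w) * psi w)%C.
split; [apply continuous_Cmult; trivial; now apply (continuous_comp g phi)|].
split; [now rewrite H2, K2|]. intros w. rewrite (H3 (g w)).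
replace (g w - g z)%C with ((w - z) * psi w)%C by (rewrite (K3 w); ring). ring.
Qed.

Lemma cderiv_ext (f g : C -> C) (z l : C) :
  (forall w, f w = g w) -> cderiv f z l -> cderiv g z l.
Proof.
intros He [phi [H1 [H2 H3]]]. exists phi. split; [easy|]. split; [easy|].
intros w. rewrite <- !He. apply H3.
Qed.

Lemma cderiv_unique (f : C -> C) (z l : C) : cderiv f z l -> C_derive f z = l.
Proof. intros H. apply is_C_derive_unique, cderiv_is_derive, H. Qed.

(** * The complex exponential *)

Lemma exp_le x y : x <= y -> exp x <= exp y.
Proof.
intros H. destruct (Rle_lt_or_eq_dec x y H) as [K|K].
- now apply Rlt_le, exp_increasing.
- rewrite K. lra.
Qed.

Lemma Cexp_plus (z w : C) : Cexp (z + w) = (Cexp z * Cexp w)%C.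
Proof.
unfold Cexp. rewrite re_plus, im_plus, exp_plus, cos_plus, sin_plus.
unfold Cmult; simpl. f_equal; ring.
Qed.

Lemma Cexp_0 : Cexp (RtoC 0) = RtoC 1.
Proof. unfold Cexp; simpl. rewrite exp_0, cos_0, sin_0. unfold RtoC. f_equal; ring. Qed.

Lemma Cexp_neq_0 (z : C) : Cexp z <> RtoC 0.
Proof.
intros H. assert (K : (Cexp z * Cexp (- z))%C = RtoC 1).
{ rewrite <- Cexp_plus. replace (z + - z)%C with (RtoC 0) by ring. apply Cexp_0. }
rewrite H in K. apply C1_nz. rewrite <- K. ring.
Qed.

Lemma Cexp_opp (z : C) : Cexp (- z) = (/ Cexp z)%C.
Proof.
assert (K : (Cexp z * Cexp (- z))%C = RtoC 1).
{ rewrite <- Cexp_plus. replace (z + - z)%C with (RtoC 0) by ring. apply Cexp_0. }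
assert (H := Cexp_neq_0 z).
replace (Cexp (- z)) with (/ Cexp z * (Cexp z * Cexp (- z)))%C by (field; exact H).
rewrite K. ring.
Qed.

Lemma Cexp_minus (z w : C) : Cexp (z - w) = (Cexp z / Cexp w)%C.
Proof. unfold Cminus. now rewrite Cexp_plus, Cexp_opp. Qed.

Lemma Cmod_Cexp (z : C) : Cmod (Cexp z) = exp (Re z).
Proof.
unfold Cmod, Cexp; simpl.
assert (H := sin2_cos2 (Im z)). unfold Rsqr in H.
replace (_ + _) with (exp (Re z) * exp (Re z)) by nra.
apply sqrt_square, Rlt_le, exp_pos.
Qed.

Lemma Cexp_pow (z : C) (n : nat) : (Cexp z ^ n)%C = Cexp (RtoC (INR n) * z).
Proof.
induction n as [|n IH].
- simpl. replace (RtoC 0 * z)%C with (RtoC 0) by ring. now rewrite Cexp_0.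
- rewrite Cpow_S, IH, <- Cexp_plus, S_INR, RtoC_plus. f_equal. ring.
Qed.

Lemma continuous_Cexp (z : C) : continuous Cexp z.
Proof.
unfold Cexp. apply continuous_C_pair; simpl; apply continuous_Rmult.
- apply (continuous_comp fst exp); [apply continuous_fst | apply continuous_exp].
- apply (continuous_comp snd cos); [apply continuous_snd | apply continuous_cos].
- apply (continuous_comp fst exp); [apply continuous_fst | apply continuous_exp].
- apply (continuous_comp snd sin); [apply continuous_snd | apply continuous_sin].
Qed.

Lemma derivable_error (f : R -> R) (l : R) (e : R) :
  is_derive f 0 l -> 0 < e ->
  exists d, 0 < d /\ forall x, Rabs x < d -> Rabs (f x - f 0 - l * x) <= e * Rabs x.
Proof.
intros [_ H] He. specialize (H 0 (fun P HP => HP) (mkposreal _ He)).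
destruct H as [d H]. exists d. split; [apply cond_pos|]. intros x Hx.
assert (Hb : ball 0 d x).
{ change (Rabs (x - 0) < d). now rewrite Rminus_0_r. }
specialize (H x Hb).
change (Rabs ((f x - f 0) - (x - 0) * l) <= e * Rabs (x - 0)) in H.
rewrite Rminus_0_r in H. now rewrite (Rmult_comm l x).
Qed.

Lemma Cexp_error (e : R) : 0 < e ->
  exists d, 0 < d /\
    forall h, Cmod h < d -> Cmod (Cexp h - 1 - h) <= e * Cmod h.
Proof.
intros He.
(* The real and imaginary parts of the error come out at most [4 * (e' * m)] and [5 * (e' * m)], so
   [e / 16] leaves room. The cap by 1 keeps [1 + x + A] at most 3 in absolute value. *)
assert (He8 : 0 < Rmin (e / 16) 1) by (apply Rmin_pos; lra).
assert (M1 := Rmin_l (e / 16) 1). assert (M2 := Rmin_r (e / 16) 1).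
set (e' := Rmin (e / 16) 1) in *.
destruct (derivable_error exp 1 e') as [d1 [Hd1 H1]]; trivial.
{ auto_derive; trivial. rewrite exp_0. ring. }
destruct (derivable_error cos 0 e') as [d2 [Hd2 H2]]; trivial.
{ auto_derive; trivial. rewrite sin_0. ring. }
destruct (derivable_error sin 1 e') as [d3 [Hd3 H3]]; trivial.
{ auto_derive; trivial. rewrite cos_0. ring. }
exists (Rmin (Rmin d1 d2) (Rmin d3 e')).
split; [repeat apply Rmin_pos; lra|].
intros h Hh.
assert (N1 := Rmin_l (Rmin d1 d2) (Rmin d3 e')).
assert (N2 := Rmin_r (Rmin d1 d2) (Rmin d3 e')).
assert (N3 := Rmin_l d1 d2). assert (N4 := Rmin_r d1 d2).
assert (N5 := Rmin_l d3 e'). assert (N6 := Rmin_r d3 e').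
assert (Lx := re_le_Cmod h). assert (Ly := im_le_Cmod h).
specialize (H1 (Re h) ltac:(lra)). specialize (H2 (Im h) ltac:(lra)).
specialize (H3 (Im h) ltac:(lra)).
rewrite exp_0 in H1. rewrite cos_0 in H2. rewrite sin_0 in H3.
eapply Rle_trans; [apply Cmod_le_abs|].
set (m := Cmod h) in *.
set (x := Re h) in *. set (y := Im h) in *.
replace (Re (Cexp h - 1 - h)) with (exp x * cos y - 1 - x)
  by (unfold Cexp; simpl; fold x y; unfold x, y, Re; ring).
replace (Im (Cexp h - 1 - h)) with (exp x * sin y - y)
  by (unfold Cexp; simpl; fold x y; unfold x, y, Im; ring).
assert (Hm : 0 <= m) by apply Cmod_ge_0.
set (A := exp x - 1 - 1 * x) in *. set (B := cos y - 1 - 0 * y) in *.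
set (S := sin y - 0 - 1 * y) in *.
assert (HA : Rabs A <= e' * m) by (eapply Rle_trans; [exact H1|]; nra).
assert (HB : Rabs B <= e' * m) by (eapply Rle_trans; [exact H2|]; nra).
assert (HS : Rabs S <= e' * m) by (eapply Rle_trans; [exact H3|]; nra).
replace (exp x * cos y - 1 - x) with (A + (1 + x + A) * B) by (unfold A, B; ring).
replace (exp x * sin y - y) with (y * (x + A) + (1 + x + A) * S)
  by (unfold A, S; ring).
assert (Hm1 : m <= e') by lra.
assert (HXA : Rabs (1 + x + A) <= 3).
{ eapply Rle_trans; [apply Rabs_triang|].
  eapply Rle_trans; [apply Rplus_le_compat_r, Rabs_triang|].
  rewrite Rabs_R1. nra. }
assert (HxA : Rabs (x + A) <= 2 * e').
{ eapply Rle_trans; [apply Rabs_triang|]. nra. }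
assert (P1 : Rabs (A + (1 + x + A) * B) <= 4 * (e' * m)).
{ eapply Rle_trans; [apply Rabs_triang|]. rewrite Rabs_mult.
  assert (0 <= Rabs B) by apply Rabs_pos.
  assert (Rabs (1 + x + A) * Rabs B <= 3 * Rabs B) by (apply Rmult_le_compat_r; lra).
  lra. }
assert (P2 : Rabs (y * (x + A) + (1 + x + A) * S) <= 5 * (e' * m)).
{ eapply Rle_trans; [apply Rabs_triang|]. rewrite !Rabs_mult.
  assert (0 <= Rabs S) by apply Rabs_pos.
  assert (0 <= Rabs y) by apply Rabs_pos.
  assert (Rabs (1 + x + A) * Rabs S <= 3 * Rabs S) by (apply Rmult_le_compat_r; lra).
  assert (Rabs y * Rabs (x + A) <= m * (2 * e')) by
    (apply Rmult_le_compat; trivial; apply Rabs_pos).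
  lra. }
nra.
Qed.

(** [cderiv] asks for an identity valid at every [w], whereas a construction often yields it only
    near [z]. Far from [z] the slope can be replaced by the difference quotient at no cost,
    continuity at [z] being a local matter. *)
Lemma cderiv_loc (f phi : C -> C) (z : C) :
  continuous phi z ->
  locally z (fun w => f w = f z + (w - z) * phi w)%C -> cderiv f z (phi z).
Proof.
intros Hc Hl.
exists (fun w => if Ceq_dec w z then phi z else ((f w - f z) / (w - z))%C).
split; [|split].
- apply (continuous_ext_loc _ phi); [|exact Hc].
  revert Hl. apply filter_imp. intros w Hw.
  destruct (Ceq_dec w z) as [->|n]; [easy|].
  change (phi w = (f w - f z) / (w - z))%C. rewrite Hw. field.
  now apply Cminus_eq_contra.
- destruct (Ceq_dec z z); easy.
- intros w. destruct (Ceq_dec w z) as [->|Hn]; [ring|].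
  rewrite Cmult_div_cancel by now apply Cminus_eq_contra. ring.
Qed.

(** By the addition theorem the slope at [z] is [Cexp z] times the translated slope [E] at 0, and
    [Cexp_error] says that [E] is continuous there. *)
Lemma cderiv_Cexp (z : C) : cderiv Cexp z (Cexp z).
Proof.
set (E := fun h => if Ceq_dec h (RtoC 0) then RtoC 1 else ((Cexp h - 1) / h)%C).
assert (E0 : E (RtoC 0) = RtoC 1).
{ unfold E. destruct (Ceq_dec (RtoC 0) (RtoC 0)); easy. }
assert (HE : continuous E (RtoC 0)).
{ apply continuous_CC_eps. intros e He.
  destruct (Cexp_error (e / 2)) as [d [Hd H]]; [lra|].
  exists d. split; [exact Hd|]. intros w Hw. rewrite E0.
  replace (w - RtoC 0)%C with w in Hw by ring.
  unfold E. destruct (Ceq_dec w (RtoC 0)) as [_|Hn].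
  - replace (RtoC 1 - 1)%C with (RtoC 0) by ring. now rewrite Cmod_0.
  - specialize (H w Hw). assert (Hp := proj1 (Cmod_gt_0 _) Hn).
    replace ((Cexp w - 1) / w - 1)%C with ((Cexp w - 1 - w) / w)%C by (field; exact Hn).
    rewrite Cmod_div by exact Hn.
    apply Rmult_lt_reg_r with (Cmod w); [exact Hp|].
    unfold Rdiv. rewrite Rmult_assoc, Rinv_l by lra. nra. }
exists (fun w => Cexp z * E (w - z))%C. split; [|split].
- apply continuous_Cmult; [apply continuous_const|].
  apply (continuous_comp (fun w => (w - z)%C) E).
  + apply continuous_Cminus; [apply continuous_id | apply continuous_const].
  + replace (z - z)%C with (RtoC 0) by ring. exact HE.
- replace (z - z)%C with (RtoC 0) by ring. rewrite E0. ring.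
- intros w. replace (Cexp w) with (Cexp z * Cexp (w - z))%C
    by (rewrite <- Cexp_plus; f_equal; ring).
  unfold E. destruct (Ceq_dec (w - z) (RtoC 0)) as [->|Hn].
  + rewrite Cexp_0. ring.
  + field. exact Hn.
Qed.

(** A logarithm that is merely continuous is differentiable: the slope of [Cexp] at [L z], evaluated
    at [L w], is nonzero for [w] near [z], and dividing the slope of [g] by it gives a slope for
    [L]. *)
Lemma cderiv_log (L g : C -> C) (z l : C) :
  continuous L z -> cderiv g z l -> locally z (fun w => Cexp (L w) = g w) ->
  exists m, cderiv L z m.
Proof.
intros HL [psi [G1 [G2 G3]]] He.
destruct (cderiv_Cexp (L z)) as [phi [P1 [P2 P3]]].
assert (Hc : continuous (fun w => phi (L w)) z) by now apply (continuous_comp L phi).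
assert (Hnz : phi (L z) <> RtoC 0) by (rewrite P2; apply Cexp_neq_0).
exists (psi z / phi (L z))%C.
apply (cderiv_loc L (fun w => psi w / phi (L w))%C).
- apply continuous_Cmult; [exact G1|]. now apply continuous_Cinv.
- assert (Hn : locally z (fun w => phi (L w) <> RtoC 0)).
  { assert (K := proj1 (continuous_C_eps _ _) Hc (Cmod (phi (L z)))
      (proj1 (Cmod_gt_0 _) Hnz)).
    revert K. apply filter_imp. intros w Hw H0. rewrite H0 in Hw.
    replace (0 - phi (L z))%C with (- phi (L z))%C in Hw by ring.
    rewrite Cmod_opp in Hw. lra. }
  assert (Hz := locally_singleton _ _ He). simpl in Hz.
  generalize (filter_and _ _ He Hn). apply filter_imp. intros w [Hw Hnw].
  assert (K : ((L w - L z) * phi (L w))%C = ((w - z) * psi w)%C).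
  { replace ((L w - L z) * phi (L w))%C with (Cexp (L w) - Cexp (L z))%C
      by (rewrite (P3 (L w)); ring).
    rewrite Hw, Hz, (G3 w). ring. }
  replace ((w - z) * (psi w / phi (L w)))%C
    with ((w - z) * psi w / phi (L w))%C by (field; exact Hnw).
  rewrite <- K. field. exact Hnw.
Qed.

(** * Integrals of complex-valued functions of a real variable *)

Definition CInt (f : R -> C) (a b : R) : C :=
  @RInt C_R_CompleteNormedModule f a b.

Definition ccont_on (f : R -> C) (a b : R) : Prop :=
  forall t, a <= t <= b -> continuous f t.

Lemma ccont_on_minus f g a b :
  ccont_on f a b -> ccont_on g a b -> ccont_on (fun t => f t - g t)%C a b.
Proof. intros H K t Ht. apply continuous_Cminus; auto. Qed.

Lemma ccont_on_mult f g a b :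
  ccont_on f a b -> ccont_on g a b -> ccont_on (fun t => f t * g t)%C a b.
Proof. intros H K t Ht. apply continuous_Cmult; auto. Qed.

Lemma ccont_on_const c a b : ccont_on (fun _ => c) a b.
Proof. intros t Ht. apply continuous_const. Qed.

Lemma CInt_ex f a b : a <= b -> ccont_on f a b ->
  @ex_RInt C_R_CompleteNormedModule f a b.
Proof.
intros Hab H. apply @ex_RInt_continuous. intros t Ht.
rewrite Rmin_left, Rmax_right in Ht by lra. now apply H.
Qed.

Lemma is_CInt f a b : a <= b -> ccont_on f a b ->
  @is_RInt C_R_NormedModule f a b (CInt f a b).
Proof. intros. apply (@RInt_correct C_R_CompleteNormedModule). now apply CInt_ex. Qed.

Lemma is_CInt_fst f a b l : @is_RInt C_R_NormedModule f a b l ->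
  is_RInt (fun t => fst (f t)) a b (fst l).
Proof. apply (@is_RInt_fct_extend_fst R_NormedModule R_NormedModule). Qed.

Lemma is_CInt_snd f a b l : @is_RInt C_R_NormedModule f a b l ->
  is_RInt (fun t => snd (f t)) a b (snd l).
Proof. apply (@is_RInt_fct_extend_snd R_NormedModule R_NormedModule). Qed.

Lemma CInt_unique f a b l : @is_RInt C_R_NormedModule f a b l -> CInt f a b = l.
Proof. apply (@is_RInt_unique C_R_CompleteNormedModule). Qed.

Lemma CInt_plus f g a b : a <= b -> ccont_on f a b -> ccont_on g a b ->
  CInt (fun t => f t + g t)%C a b = (CInt f a b + CInt g a b)%C.
Proof.
intros Hab Hf Hg. apply CInt_unique.
apply (@is_RInt_plus C_R_NormedModule); now apply is_CInt.
Qed.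

Lemma is_CInt_Cmult c f a b l : @is_RInt C_R_NormedModule f a b l ->
  @is_RInt C_R_NormedModule (fun t => c * f t)%C a b (c * l)%C.
Proof.
intros H. assert (H1 := is_CInt_fst _ _ _ _ H). assert (H2 := is_CInt_snd _ _ _ _ H).
apply (@is_RInt_fct_extend_pair R_NormedModule R_NormedModule).
- simpl. apply (@is_RInt_minus R_NormedModule); now apply (@is_RInt_scal R_NormedModule).
- simpl. apply (@is_RInt_plus R_NormedModule); now apply (@is_RInt_scal R_NormedModule).
Qed.

Lemma CInt_Cmult c f a b : a <= b -> ccont_on f a b ->
  CInt (fun t => c * f t)%C a b = (c * CInt f a b)%C.
Proof. intros Hab Hf. apply CInt_unique, is_CInt_Cmult. now apply is_CInt. Qed.

Lemma CInt_minus f g a b : a <= b -> ccont_on f a b -> ccont_on g a b ->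
  CInt (fun t => f t - g t)%C a b = (CInt f a b - CInt g a b)%C.
Proof.
intros Hab Hf Hg. apply CInt_unique.
apply (@is_RInt_minus C_R_NormedModule); now apply is_CInt.
Qed.

Lemma CInt_ext f g a b : a <= b -> (forall t, a <= t <= b -> f t = g t) ->
  CInt f a b = CInt g a b.
Proof.
intros Hab H. apply (@RInt_ext C_R_CompleteNormedModule).
intros t Ht. rewrite Rmin_left, Rmax_right in Ht by lra. apply H; lra.
Qed.

Lemma CInt_const c a b : CInt (fun _ => c) a b = (RtoC (b - a) * c)%C.
Proof.
unfold CInt. rewrite RInt_const. apply (scal_R_Cmult (b - a) c).
Qed.

Lemma CInt_Chasles f a b c : a <= b -> b <= c -> ccont_on f a c ->
  CInt f a c = (CInt f a b + CInt f b c)%C.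
Proof.
intros Hab Hbc H. symmetry. apply (@RInt_Chasles C_R_CompleteNormedModule);
  apply CInt_ex; trivial; intros t Ht; apply H; lra.
Qed.

Lemma CInt_bound f a b (M : R) : a <= b -> ccont_on f a b ->
  (forall t, a <= t <= b -> Cmod (f t) <= M) -> Cmod (CInt f a b) <= (b - a) * M.
Proof.
intros Hab Hf HM.
generalize (@norm_RInt_le_const C_R_NormedModule f a b (CInt f a b) M Hab).
intros H. rewrite Cmod_norm. apply H.
- intros t Ht. change (@norm R_AbsRing C_R_NormedModule (f t)) with
    (@norm R_AbsRing (prod_NormedModule R_AbsRing R_NormedModule R_NormedModule) (f t)).
  rewrite <- (Cmod_norm (f t)). now apply HM.
- now apply is_CInt.
Qed.

Lemma CInt_norm_le f (g : R -> R) a b : a <= b -> ccont_on f a b ->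
  (forall t, a <= t <= b -> continuous g t) ->
  (forall t, a <= t <= b -> Cmod (f t) <= g t) -> Cmod (CInt f a b) <= RInt g a b.
Proof.
intros Hab Hf Hg HM.
generalize (@norm_RInt_le C_R_NormedModule f g a b (CInt f a b) (RInt g a b) Hab).
intros H. rewrite Cmod_norm. apply H.
- intros t Ht. change (@norm R_AbsRing C_R_NormedModule (f t)) with
    (@norm R_AbsRing (prod_NormedModule R_AbsRing R_NormedModule R_NormedModule) (f t)).
  rewrite <- (Cmod_norm (f t)). now apply HM.
- now apply is_CInt.
- apply (@RInt_correct R_CompleteNormedModule). apply @ex_RInt_continuous.
  intros t Ht. rewrite Rmin_left, Rmax_right in Ht by lra. now apply Hg.
Qed.

(** * Goursat's theorem on rectangles *)

Lemma nested_point (x w : nat -> R) :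
  (forall n, 0 <= w n) ->
  (forall n, x n <= x (S n) /\ x (S n) + w (S n) <= x n + w n) ->
  exists l, forall n, x n <= l <= x n + w n.
Proof.
intros Hw Hx.
assert (Hm : forall n k, x n <= x (n + k)%nat /\ x (n + k)%nat + w (n + k)%nat <= x n + w n).
{ intros n k. induction k as [|k IH].
  - rewrite Nat.add_0_r. lra.
  - rewrite Nat.add_succ_r. specialize (Hx (n + k)%nat). lra. }
assert (Hub : forall n m, x m <= x n + w n).
{ intros n m. destruct (Compare_dec.le_lt_dec n m) as [H|H].
  - destruct (Hm n (m - n)%nat) as [_ K]. replace (n + (m - n))%nat with m in K by lia.
    specialize (Hw m). lra.
  - destruct (Hm m (n - m)%nat) as [K _]. replace (m + (n - m))%nat with n in K by lia.
    specialize (Hw n). lra. }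
destruct (completeness (fun y => exists n, y = x n)) as [l [Hl1 Hl2]].
- exists (x 0%nat + w 0%nat). intros y [n ->]. apply Hub.
- exists (x 0%nat). now exists 0%nat.
- exists l. intros n. split.
  + apply Hl1. now exists n.
  + apply Hl2. intros y [m ->]. apply Hub.
Qed.

(* Integral of [F] along the boundary of a rectangle, opposite sides being
   paired so that each integrand is a difference. *)
Definition bdry (F : C -> C) (x1 x2 y1 y2 : R) : C :=
  (CInt (fun s => F (s, y1) - F (s, y2)) x1 x2 +
   Ci * CInt (fun s => F (x2, s) - F (x1, s)) y1 y2)%C.

Lemma continuous_hpath (F : C -> C) (x y : R) :
  continuous F (x, y) -> continuous (fun s => F (s, y)) x.
Proof.
intros H. apply (continuous_comp (fun s : R => (s, y) : C) F); [|exact H].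
apply continuous_C_pair; [apply continuous_id | apply continuous_const].
Qed.

Lemma continuous_vpath (F : C -> C) (x y : R) :
  continuous F (x, y) -> continuous (fun s => F (x, s)) y.
Proof.
intros H. apply (continuous_comp (fun s : R => (x, s) : C) F); [|exact H].
apply continuous_C_pair; [apply continuous_const | apply continuous_id].
Qed.

Definition cont_rect (F : C -> C) (x1 x2 y1 y2 : R) : Prop :=
  forall x y, x1 <= x <= x2 -> y1 <= y <= y2 -> continuous F (x, y).

Lemma bdry_split_x F x1 x2 x3 y1 y2 : x1 <= x2 -> x2 <= x3 -> y1 <= y2 ->
  cont_rect F x1 x3 y1 y2 ->
  bdry F x1 x3 y1 y2 = (bdry F x1 x2 y1 y2 + bdry F x2 x3 y1 y2)%C.
Proof.
intros H1 H2 Hy Hc.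
assert (Hh : forall y, y1 <= y <= y2 -> ccont_on (fun s => F (s, y)) x1 x3).
{ intros y K t Ht. apply continuous_hpath, Hc; lra. }
assert (Hv : forall x, x1 <= x <= x3 -> ccont_on (fun s => F (x, s)) y1 y2).
{ intros x K t Ht. apply continuous_vpath, Hc; lra. }
unfold bdry. rewrite (CInt_Chasles _ x1 x2 x3) by
  (try lra; apply ccont_on_minus; apply Hh; lra).
rewrite (CInt_minus (fun s => F (x3, s)) (fun s => F (x1, s))) by (trivial; apply Hv; lra).
rewrite (CInt_minus (fun s => F (x2, s)) (fun s => F (x1, s))) by (trivial; apply Hv; lra).
rewrite (CInt_minus (fun s => F (x3, s)) (fun s => F (x2, s))) by (trivial; apply Hv; lra).
ring.
Qed.

Lemma bdry_split_y F x1 x2 y1 y2 y3 : x1 <= x2 -> y1 <= y2 -> y2 <= y3 ->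
  cont_rect F x1 x2 y1 y3 ->
  bdry F x1 x2 y1 y3 = (bdry F x1 x2 y1 y2 + bdry F x1 x2 y2 y3)%C.
Proof.
intros H1 H2 H3 Hc.
assert (Hh : forall y, y1 <= y <= y3 -> ccont_on (fun s => F (s, y)) x1 x2).
{ intros y K t Ht. apply continuous_hpath, Hc; lra. }
assert (Hv : forall x, x1 <= x <= x2 -> ccont_on (fun s => F (x, s)) y1 y3).
{ intros x K t Ht. apply continuous_vpath, Hc; lra. }
unfold bdry. rewrite (CInt_Chasles _ y1 y2 y3) by
  (try lra; apply ccont_on_minus; apply Hv; lra).
rewrite (CInt_minus (fun s => F (s, y1)) (fun s => F (s, y3))) by (trivial; apply Hh; lra).
rewrite (CInt_minus (fun s => F (s, y1)) (fun s => F (s, y2))) by (trivial; apply Hh; lra).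
rewrite (CInt_minus (fun s => F (s, y2)) (fun s => F (s, y3))) by (trivial; apply Hh; lra).
ring.
Qed.

(** The affine part of [F] at [(x, y)] contributes nothing to the boundary integral. The remainder
    is at most [e] times the distance, hence at most [e * (w + h)], and each integrand pairs two
    sides. *)
Lemma bdry_small F x y l : cderiv F (x, y) l -> forall e, 0 < e ->
  exists d, 0 < d /\ forall x1 y1 w h, 0 <= w -> 0 <= h -> w + h < d ->
    x1 <= x <= x1 + w -> y1 <= y <= y1 + h ->
    cont_rect F x1 (x1 + w) y1 (y1 + h) ->
    Cmod (bdry F x1 (x1 + w) y1 (y1 + h)) <= 2 * e * (w + h) ^ 2.
Proof.
intros [phi [P1 [P2 P3]]] e He.
destruct (proj1 (continuous_CC_eps _ _) P1 e He) as [d [Hd H]].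
exists d. split; [exact Hd|]. intros x1 y1 w h Hw Hh Hwh Hx Hy Hc.
set (p := (x, y) : C) in *.
assert (Hclose : forall u v, x1 <= u <= x1 + w -> y1 <= v <= y1 + h ->
  Cmod (F (u, v) - F p - ((u, v) - p) * l) <= e * (w + h)).
{ intros u v Hu Hv.
  assert (Hm : Cmod ((u, v) - p) <= w + h).
  { eapply Rle_trans; [apply Cmod_le_abs|].
    change (Rabs (u - x) + Rabs (v - y) <= w + h).
    assert (Rabs (u - x) <= w) by (apply Rabs_le; lra).
    assert (Rabs (v - y) <= h) by (apply Rabs_le; lra). lra. }
  rewrite (P3 (u, v)).
  replace (F p + ((u, v) - p) * phi (u, v) - F p - ((u, v) - p) * l)%C
    with ((phi (u, v) - phi p) * ((u, v) - p))%C by (rewrite P2; ring).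
  rewrite Cmod_mult. apply Rmult_le_compat; try apply Cmod_ge_0; [|exact Hm].
  apply Rlt_le, H. lra. }
assert (Hch : forall v, y1 <= v <= y1 + h -> ccont_on (fun s => F (s, v)) x1 (x1 + w)).
{ intros v K t Ht. apply continuous_hpath, Hc; lra. }
assert (Hcv : forall u, x1 <= u <= x1 + w -> ccont_on (fun s => F (u, s)) y1 (y1 + h)).
{ intros v K t Ht. apply continuous_vpath, Hc; lra. }
set (A := fun s => (F (s, y1) - F (s, y1 + h)%R)%C).
set (B := fun s => (F ((x1 + w)%R, s) - F (x1, s))%C).
assert (HA : ccont_on A x1 (x1 + w)) by (apply ccont_on_minus; apply Hch; lra).
assert (HB : ccont_on B y1 (y1 + h)) by (apply ccont_on_minus; apply Hcv; lra).
(* The subtracted constants are the differences of the affine part across opposite sides; their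
   integrals contribute [w * Ci * h * l] and [- Ci * h * w * l], which cancel. *)
assert (E : bdry F x1 (x1 + w) y1 (y1 + h) =
  (CInt (fun s => A s - (- (Ci * RtoC h * l))) x1 (x1 + w) +
   Ci * CInt (fun s => B s - RtoC w * l) y1 (y1 + h))%C).
{ unfold bdry. fold A B.
  rewrite CInt_minus by (try lra; trivial; apply ccont_on_const).
  rewrite CInt_minus by (try lra; trivial; apply ccont_on_const).
  rewrite !CInt_const.
  replace (x1 + w - x1) with w by ring. replace (y1 + h - y1) with h by ring. ring. }
rewrite E.
assert (BA : forall s, x1 <= s <= x1 + w ->
  Cmod (A s - (- (Ci * RtoC h * l))) <= 2 * (e * (w + h))).
{ intros s Hs. unfold A.
  assert (K1 := Hclose s y1 Hs ltac:(lra)).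
  assert (K2 := Hclose s (y1 + h) Hs ltac:(lra)).
  replace (F (s, y1) - F (s, (y1 + h)%R) - - (Ci * RtoC h * l))%C with
   ((F (s, y1) - F p - ((s, y1) - p) * l) -
    (F (s, (y1 + h)%R) - F p - ((s, (y1 + h)%R) - p) * l))%C.
  - eapply Rle_trans; [apply Cmod_triangle|]. rewrite Cmod_opp. lra.
  - replace (((s, (y1 + h)%R) : C)) with ((s, y1) + Ci * RtoC h)%C at 2.
    + ring.
    + unfold Cplus, Cmult, Ci, RtoC; simpl. f_equal; ring. }
assert (BB : forall s, y1 <= s <= y1 + h ->
  Cmod (B s - RtoC w * l) <= 2 * (e * (w + h))).
{ intros s Hs. unfold B.
  assert (K1 := Hclose x1 s ltac:(lra) Hs).
  assert (K2 := Hclose (x1 + w) s ltac:(lra) Hs).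
  replace (F ((x1 + w)%R, s) - F (x1, s) - RtoC w * l)%C with
   ((F ((x1 + w)%R, s) - F p - (((x1 + w)%R, s) - p) * l) -
    (F (x1, s) - F p - ((x1, s) - p) * l))%C.
  - eapply Rle_trans; [apply Cmod_triangle|]. rewrite Cmod_opp. lra.
  - replace ((((x1 + w)%R, s) : C)) with ((x1, s) + RtoC w)%C at 2.
    + ring.
    + unfold Cplus, RtoC; simpl. f_equal; ring. }
eapply Rle_trans; [apply Cmod_triangle|]. rewrite Cmod_mult, Cmod_Ci, Rmult_1_l.
eapply Rle_trans; [apply Rplus_le_compat; apply CInt_bound|].
- lra.
- apply ccont_on_minus; [exact HA | apply ccont_on_const].
- exact BA.
- lra.
- apply ccont_on_minus; [exact HB | apply ccont_on_const].
- exact BB.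
- nra.
Qed.

(** Here [w] and [h] are the sides of a quarter, half those of the rectangle with lower left corner
    [p]. Comparing reals by [Rle_dec] makes the choice of a heavy quarter a function, which can then
    be iterated. *)
Definition quarter (F : C -> C) (w h : R) (p : R * R) : R * R :=
  let x := fst p in let y := snd p in
  let b q := bdry F (fst q) (fst q + w) (snd q) (snd q + h) in
  let m := Cmod (bdry F x (x + 2 * w) y (y + 2 * h)) / 4 in
  if Rle_dec m (Cmod (b (x, y))) then (x, y) else
  if Rle_dec m (Cmod (b (x + w, y))) then (x + w, y) else
  if Rle_dec m (Cmod (b (x, y + h))) then (x, y + h) else (x + w, y + h).

(** The boundary integrals of the four quarters add up to that of the whole, so if the first three
    have modulus below a fourth of the total, the last one cannot. *)
Lemma quarter_spec F w h x y : 0 <= w -> 0 <= h ->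
  cont_rect F x (x + 2 * w) y (y + 2 * h) ->
  let q := quarter F w h (x, y) in
  (fst q = x \/ fst q = x + w) /\ (snd q = y \/ snd q = y + h) /\
  Cmod (bdry F x (x + 2 * w) y (y + 2 * h)) / 4 <=
  Cmod (bdry F (fst q) (fst q + w) (snd q) (snd q + h)).
Proof.
intros Hw Hh Hc.
assert (E : bdry F x (x + 2 * w) y (y + 2 * h) =
  (bdry F x (x + w) y (y + h) + bdry F (x + w) (x + w + w) y (y + h) +
   bdry F x (x + w) (y + h) (y + h + h) +
   bdry F (x + w) (x + w + w) (y + h) (y + h + h))%C).
{ rewrite (bdry_split_x F x (x + w)) by (trivial; lra).
  replace (x + 2 * w) with (x + w + w) in * by ring.
  replace (y + 2 * h) with (y + h + h) in * by ring.
  rewrite (bdry_split_y F x (x + w) y (y + h)); try lra.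
  2: intros u v Hu Hv; apply Hc; lra.
  rewrite (bdry_split_y F (x + w) (x + w + w) y (y + h)); try lra.
  2: intros u v Hu Hv; apply Hc; lra.
  ring. }
unfold quarter. cbv zeta. simpl fst. simpl snd.
repeat (destruct Rle_dec; [simpl; auto|]).
simpl. split; [auto|]. split; [auto|].
apply Rnot_lt_le. intros Hlt.
assert (K : Cmod (bdry F x (x + 2 * w) y (y + 2 * h)) <
  Cmod (bdry F x (x + 2 * w) y (y + 2 * h))); [|lra].
rewrite E at 1.
eapply Rle_lt_trans; [apply Cmod_triangle|].
eapply Rle_lt_trans; [apply Rplus_le_compat_r, Cmod_triangle|].
eapply Rle_lt_trans; [apply Rplus_le_compat_r, Rplus_le_compat_r, Cmod_triangle|].
lra.
Qed.

(** Repeated quartering loses a factor 4 at each step, while [bdry_small] at the common point of the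
    nested rectangles bounds the [n]-th integral by a multiple of [e / 4 ^ n]. The powers of 4
    cancel and [e] is arbitrary. *)
Theorem Goursat (F : C -> C) (x y w h : R) : 0 <= w -> 0 <= h ->
  (forall u v, x <= u <= x + w -> y <= v <= y + h -> exists l, cderiv F (u, v) l) ->
  bdry F x (x + w) y (y + h) = RtoC 0.
Proof.
intros Hw Hh HF.
assert (Hc : cont_rect F x (x + w) y (y + h)).
{ intros u v Hu Hv. destruct (HF u v Hu Hv) as [l Hl]. now apply cderiv_continuous in Hl. }
set (W := fun n : nat => w / 2 ^ n). set (H := fun n : nat => h / 2 ^ n).
set (q := fix q n := match n with O => (x, y)
  | S n => quarter F (W (S n)) (H (S n)) (q n) end).
assert (HW : forall n, W n = 2 * W (S n)).
{ intros n. unfold W. simpl. field. apply pow_nonzero. lra. }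
assert (HH : forall n, H n = 2 * H (S n)).
{ intros n. unfold H. simpl. field. apply pow_nonzero. lra. }
assert (HW0 : forall n, 0 <= W n).
{ intros n. unfold W. apply Rdiv_le_0_compat; [lra|]. apply pow_lt. lra. }
assert (HH0 : forall n, 0 <= H n).
{ intros n. unfold H. apply Rdiv_le_0_compat; [lra|]. apply pow_lt. lra. }
assert (Inv : forall n, x <= fst (q n) /\ fst (q n) + W n <= x + w /\
  y <= snd (q n) /\ snd (q n) + H n <= y + h).
{ assert (W0 : W 0%nat = w) by (unfold W; simpl; field).
  assert (H0 : H 0%nat = h) by (unfold H; simpl; field).
  induction n as [|n IH]; [simpl; lra|].
  change (q (S n)) with (quarter F (W (S n)) (H (S n)) (q n)).
  specialize (HW n). specialize (HH n).
  destruct (q n) as [u v]. simpl in IH.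
  destruct (quarter_spec F (W (S n)) (H (S n)) u v) as [K1 [K2 _]]; auto.
  { intros a b Ha Hb. apply Hc; lra. }
  assert (A1 := HW0 (S n)). assert (A2 := HH0 (S n)). lra. }
assert (Step : forall n,
  (fst (q (S n)) = fst (q n) \/ fst (q (S n)) = fst (q n) + W (S n)) /\
  (snd (q (S n)) = snd (q n) \/ snd (q (S n)) = snd (q n) + H (S n)) /\
  Cmod (bdry F (fst (q n)) (fst (q n) + W n) (snd (q n)) (snd (q n) + H n)) / 4 <=
  Cmod (bdry F (fst (q (S n))) (fst (q (S n)) + W (S n)) (snd (q (S n)))
    (snd (q (S n)) + H (S n)))).
{ intros n. specialize (Inv n).
  change (q (S n)) with (quarter F (W (S n)) (H (S n)) (q n)).
  destruct (q n) as [u v]. simpl in Inv. rewrite (HW n), (HH n) in Inv |- *.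
  apply quarter_spec; auto. intros a b Ha Hb. apply Hc; lra. }
assert (Big : forall n, Cmod (bdry F x (x + w) y (y + h)) / 4 ^ n <=
  Cmod (bdry F (fst (q n)) (fst (q n) + W n) (snd (q n)) (snd (q n) + H n))).
{ induction n as [|n IH].
  - unfold W, H. simpl. replace (w / 1) with w by field.
    replace (h / 1) with h by field. lra.
  - destruct (Step n) as [_ [_ K]]. eapply Rle_trans; [|exact K].
    simpl. replace (Cmod (bdry F x (x + w) y (y + h)) / (4 * 4 ^ n)) with
      (Cmod (bdry F x (x + w) y (y + h)) / 4 ^ n / 4); [lra|].
    field. apply pow_nonzero. lra. }
destruct (nested_point (fun n => fst (q n)) W) as [a Ha]; trivial.
{ intros n. destruct (Step n) as [K _]. specialize (HW n). assert (A1 := HW0 (S n)). lra. }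
destruct (nested_point (fun n => snd (q n)) H) as [b Hb]; trivial.
{ intros n. destruct (Step n) as [_ [K _]]. specialize (HH n). assert (A1 := HH0 (S n)). lra. }
destruct (HF a b) as [l Hl].
{ specialize (Ha 0%nat). specialize (Inv 0%nat). simpl in *. lra. }
{ specialize (Hb 0%nat). specialize (Inv 0%nat). simpl in *. lra. }
apply Cmod_eq_0. apply Rle_antisym; [|apply Cmod_ge_0].
apply Rnot_lt_le. intros Hpos.
set (B := Cmod (bdry F x (x + w) y (y + h))) in *.
set (D := (w + h + 1)).
assert (HD : 0 < D) by (unfold D; lra).
(* With this tolerance the final estimate [2 * e * (w + h) ^ 2] is at most [B / 2]. The summand 1 in
   [D] keeps it positive for a degenerate rectangle. *)
assert (He : 0 < B / (4 * D ^ 2)).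
{ apply Rdiv_lt_0_compat; [exact Hpos|]. apply Rmult_lt_0_compat; [lra|]. now apply pow_lt. }
destruct (bdry_small F a b l Hl _ He) as [d [Hd K]].
assert (Hn : exists n : nat, (w + h) / 2 ^ n < d).
{ assert (Hlt : 0 < d / D) by now apply Rdiv_lt_0_compat.
  destruct (pow_lt_1_zero (/ 2) ltac:(rewrite Rabs_pos_eq; lra) _ Hlt) as [n Hn].
  exists n. specialize (Hn n (le_n n)).
  rewrite pow_inv in Hn. rewrite Rabs_pos_eq in Hn.
  - assert (P : 0 < / 2 ^ n) by (apply Rinv_0_lt_compat, pow_lt; lra).
    apply Rle_lt_trans with (D * / 2 ^ n).
    + unfold Rdiv. apply Rmult_le_compat_r; unfold D; lra.
    + apply Rmult_lt_reg_l with (/ D); [now apply Rinv_0_lt_compat|].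
      rewrite <- Rmult_assoc, Rinv_l, Rmult_1_l by lra. unfold Rdiv in Hn. lra.
  - apply Rlt_le, Rinv_0_lt_compat, pow_lt; lra. }
destruct Hn as [n Hn].
assert (HWH : W n + H n = (w + h) / 2 ^ n).
{ unfold W, H. field. apply pow_nonzero; lra. }
specialize (K (fst (q n)) (snd (q n)) (W n) (H n) (HW0 n) (HH0 n)).
specialize (K ltac:(lra) (Ha n) (Hb n)).
specialize (Inv n). specialize (Big n).
assert (K' := K ltac:(intros u v Hu Hv; apply Hc; lra)). clear K.
rewrite HWH in K'.
assert (P4 : 0 < 4 ^ n) by (apply pow_lt; lra).
assert (E4 : ((w + h) / 2 ^ n) ^ 2 = (w + h) ^ 2 / 4 ^ n).
{ replace 4 with (2 * 2) by ring. rewrite Rpow_mult_distr. field. apply pow_nonzero; lra. }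
rewrite E4 in K'.
assert (K : B / 4 ^ n <= 2 * (B / (4 * D ^ 2)) * ((w + h) ^ 2 / 4 ^ n)) by lra.
assert (K2 : B <= 2 * (B / (4 * D ^ 2)) * (w + h) ^ 2).
{ apply Rmult_le_reg_r with (/ 4 ^ n); [now apply Rinv_0_lt_compat|].
  unfold Rdiv in K |- *. lra. }
assert (P5 : 0 < D ^ 2) by now apply pow_lt.
assert (K3 : 2 * (B / (4 * D ^ 2)) * (w + h) ^ 2 <= B / 2).
{ replace (2 * (B / (4 * D ^ 2)) * (w + h) ^ 2) with (B / 2 * ((w + h) ^ 2 / D ^ 2))
    by (field; lra).
  rewrite <- (Rmult_1_r (B / 2)) at 2. apply Rmult_le_compat_l; [lra|].
  apply Rmult_le_reg_r with (D ^ 2); [exact P5|].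
  unfold Rdiv. rewrite Rmult_assoc, Rinv_l by lra. unfold D. nra. }
lra.
Qed.

(** * Fourier coefficients on circles *)

Lemma csum_O (f : nat -> C) : sum_n f 0 = f 0%nat :> C.
Proof. exact (@sum_O C_AbelianMonoid f). Qed.

Lemma csum_S (f : nat -> C) (n : nat) : (sum_n f (S n) = sum_n f n + f (S n) :> C)%C.
Proof. exact (@sum_Sn C_AbelianMonoid f n). Qed.

Lemma rsum_O (f : nat -> R) : sum_n f 0 = f 0%nat.
Proof. exact (sum_O f). Qed.

Lemma rsum_S (f : nat -> R) (n : nat) : sum_n f (S n) = sum_n f n + f (S n).
Proof. exact (sum_Sn f n). Qed.

Lemma csum_ext (f g : nat -> C) n : (forall k, (k <= n)%nat -> f k = g k) ->
  sum_n f n = sum_n g n :> C.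
Proof. intros H. now apply sum_n_ext_loc. Qed.

Lemma csum_mult (c : C) (f : nat -> C) n :
  sum_n (fun k => c * f k)%C n = (c * sum_n f n)%C :> C.
Proof.
induction n as [|n IH]; [now rewrite !csum_O|]. rewrite !csum_S, IH. ring.
Qed.

Lemma csum_zero (f : nat -> C) n : (forall k, (k <= n)%nat -> f k = RtoC 0) ->
  sum_n f n = RtoC 0 :> C.
Proof.
intros H. induction n as [|n IH]; [rewrite csum_O; apply H; lia|].
rewrite csum_S, IH, H by (intros; try apply H; lia). ring.
Qed.

Lemma csum_single (f : nat -> C) n m : (m <= n)%nat ->
  (forall k, (k <= n)%nat -> k <> m -> f k = RtoC 0) -> sum_n f n = f m :> C.
Proof.
revert m. induction n as [|n IH]; intros m Hm H.
- rewrite csum_O. now replace m with 0%nat by lia.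
- rewrite csum_S. destruct (Nat.eq_dec m (S n)) as [->|Hn].
  + rewrite csum_zero by (intros; apply H; lia). ring.
  + rewrite (H (S n)) by lia. rewrite (IH m) by (try lia; intros; apply H; lia). ring.
Qed.

Lemma Cmod_csum (f : nat -> C) n : Cmod (sum_n f n) <= sum_n (fun k => Cmod (f k)) n.
Proof.
induction n as [|n IH]; [rewrite csum_O, rsum_O; lra|].
rewrite csum_S, rsum_S. eapply Rle_trans; [apply Cmod_triangle|]. lra.
Qed.

Lemma rsum_const_le (f : nat -> R) n B :
  (forall k, (k <= n)%nat -> f k <= B) -> sum_n f n <= INR (S n) * B.
Proof.
intros H. induction n as [|n IH].
- rewrite rsum_O. simpl. specialize (H 0%nat (le_n _)). lra.
- rewrite rsum_S. rewrite S_INR.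
  assert (sum_n f n <= INR (S n) * B) by (apply IH; intros; apply H; lia).
  specialize (H (S n) (le_n _)). nra.
Qed.

Lemma ccont_on_csum (f : nat -> R -> C) n a b :
  (forall k, (k <= n)%nat -> ccont_on (f k) a b) ->
  ccont_on (fun t => sum_n (fun k => f k t) n) a b.
Proof.
intros H. induction n as [|n IH].
- intros t Ht. apply (continuous_ext (f 0%nat)).
  { intros s. now rewrite csum_O. } now apply H.
- intros t Ht. apply (continuous_ext (fun t => sum_n (fun k => f k t) n + f (S n) t)%C).
  { intros s. now rewrite csum_S. }
  apply continuous_Cplus; [apply IH|apply H]; auto.
Qed.

Lemma CInt_csum (f : nat -> R -> C) n a b : a <= b ->
  (forall k, (k <= n)%nat -> ccont_on (f k) a b) ->
  CInt (fun t => sum_n (fun k => f k t) n) a b = sum_n (fun k => CInt (f k) a b) n :> C.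
Proof.
intros Hab H. induction n as [|n IH].
- rewrite csum_O. apply CInt_ext; trivial. intros t Ht. now rewrite csum_O.
- rewrite csum_S, <- IH by (intros; apply H; lia).
  rewrite <- CInt_plus; auto.
  + apply CInt_ext; trivial. intros t Ht. now rewrite csum_S.
  + apply ccont_on_csum. auto.
Qed.

Definition cis (n : Z) (t : R) : C := Cexp (0, IZR n * t).

Lemma cis_plus n m t : cis (n + m) t = (cis n t * cis m t)%C.
Proof.
unfold cis. rewrite <- Cexp_plus. f_equal. rewrite plus_IZR.
unfold Cplus; simpl. f_equal; ring.
Qed.

Lemma cis_tplus n t s : cis n (t + s) = (cis n t * cis n s)%C.
Proof.
unfold cis. rewrite <- Cexp_plus. f_equal. unfold Cplus; simpl. f_equal; ring.
Qed.

Lemma cis_opp_t n t : cis n (- t) = cis (- n) t.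
Proof. unfold cis. rewrite opp_IZR. do 2 f_equal. ring. Qed.

Lemma Cmod_cis n t : Cmod (cis n t) = 1.
Proof. unfold cis. rewrite Cmod_Cexp. apply exp_0. Qed.

Lemma cis_0 t : cis 0 t = RtoC 1.
Proof.
unfold cis. rewrite Rmult_0_l. apply Cexp_0.
Qed.

Lemma cis_conj n t : Cconj (cis n t) = cis (- n) t.
Proof.
unfold cis, Cexp, Cconj; simpl. rewrite opp_IZR.
replace (- IZR n * t) with (- (IZR n * t)) by ring.
rewrite cos_neg, sin_neg. f_equal. ring.
Qed.

Lemma cis_2PI n : cis n (2 * PI) = RtoC 1.
Proof.
assert (H : forall k : nat, cis (Z.of_nat k) (2 * PI) = RtoC 1).
{ intros k. unfold cis, Cexp; simpl. rewrite <- INR_IZR_INZ.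
  assert (E : INR k * (2 * PI) = 0 + 2 * INR k * PI) by ring.
  rewrite E, cos_period, sin_period, exp_0, cos_0, sin_0. unfold RtoC; f_equal; ring. }
destruct (Z_le_gt_dec 0 n) as [Hn|Hn].
- rewrite <- (Z2Nat.id n) by lia. apply H.
- replace n with (- Z.of_nat (Z.to_nat (- n)))%Z by (rewrite Z2Nat.id; lia).
  rewrite <- cis_conj, H. unfold Cconj, RtoC; simpl. f_equal; ring.
Qed.

Lemma continuous_cis n t : continuous (cis n) t.
Proof.
unfold cis. apply (continuous_comp (fun t : R => (0, IZR n * t) : C) Cexp).
- apply continuous_C_pair; simpl; [apply continuous_const|].
  apply continuous_Rmult; [apply continuous_const|apply continuous_id].
- apply continuous_Cexp.
Qed.

Definition fcoef (phi : R -> C) (n : Z) : C :=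
  (RtoC (/ (2 * PI)) * CInt (fun t => phi t * cis (- n) t) 0 (2 * PI))%C.

Definition holo_on (s : R) (F : C -> C) : Prop :=
  forall z, s <= Re z -> exists l, cderiv F z l.

Definition periodic_on (s : R) (F : C -> C) : Prop :=
  forall x y, s <= x -> F (x, y + 2 * PI) = F (x, y).

Lemma holo_on_continuous s F x y : holo_on s F -> s <= x -> continuous F (x, y).
Proof. intros H Hx. destruct (H (x, y) Hx) as [l Hl]. now apply cderiv_continuous in Hl. Qed.

Lemma two_PI_pos : 0 < 2 * PI.
Proof. assert (H := PI_RGT_0). lra. Qed.

Lemma cderiv_scal (c z : C) : cderiv (fun w => c * w)%C z c.
Proof.
exists (fun _ => c). split; [apply continuous_const|]. split; [easy|]. intros w. ring.
Qed.

(** Goursat is applied to [G w * exp (- n w)] on the rectangle between the abscissas [x1] and [x2]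
    of height [2 * PI]. Both factors are periodic, [n] being an integer, so the horizontal sides
    cancel; the vertical ones are the two Fourier integrals with their weights. *)
Lemma fcoef_holo_eq s G n x1 x2 : holo_on s G -> periodic_on s G ->
  s <= x1 -> x1 <= x2 ->
  (RtoC (exp (- IZR n * x2)) * fcoef (fun t => G (x2, t)) n =
   RtoC (exp (- IZR n * x1)) * fcoef (fun t => G (x1, t)) n)%C.
Proof.
intros HG Hp H1 H2. assert (P2 := two_PI_pos).
set (F := fun z => (G z * Cexp (RtoC (- IZR n) * z))%C).
assert (EF : forall x t, F (x, t) = (RtoC (exp (- IZR n * x)) * (G (x, t) * cis (- n) t))%C).
{ intros x t. unfold F, cis. rewrite opp_IZR.
  replace (RtoC (- IZR n) * (x, t))%C with (((- IZR n * x)%R, 0) + (0, (- IZR n * t)%R))%C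
    by (unfold Cmult, Cplus, RtoC; simpl; f_equal; ring).
  rewrite Cexp_plus.
  replace (Cexp (- IZR n * x, 0)) with (RtoC (exp (- IZR n * x))); [ring|].
  unfold Cexp, RtoC; simpl. rewrite cos_0, sin_0. f_equal; ring. }
assert (HF : holo_on s F).
{ intros z Hz. destruct (HG z Hz) as [l Hl]. eexists. apply cderiv_mult; [exact Hl|].
  apply (cderiv_comp Cexp); [apply cderiv_Cexp | apply cderiv_scal]. }
assert (K := Goursat F x1 0 (x2 - x1) (2 * PI) ltac:(lra) ltac:(lra)
  ltac:(intros u v Hu Hv; apply HF; simpl; lra)).
replace (x1 + (x2 - x1)) with x2 in K by ring. rewrite Rplus_0_l in K.
assert (Hv : forall x, s <= x -> ccont_on (fun t => G (x, t) * cis (- n) t)%C 0 (2 * PI)).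
{ intros x Hx t Ht. apply continuous_Cmult; [|apply continuous_cis].
  apply continuous_vpath. now apply (holo_on_continuous s). }
assert (Hv2 : forall x, s <= x -> ccont_on (fun t => F (x, t)) 0 (2 * PI)).
{ intros x Hx t Ht. apply continuous_vpath. now apply (holo_on_continuous s). }
unfold bdry in K.
rewrite (CInt_ext _ (fun _ => RtoC 0)) in K; [|exact H2|].
2: { intros t Ht. rewrite !EF. assert (E := Hp t 0 ltac:(lra)).
  rewrite Rplus_0_l in E. rewrite E, cis_2PI.
  replace (cis (- n) 0) with (RtoC 1).
  2: { rewrite <- (cis_0 (IZR (-n))). unfold cis. do 2 f_equal. ring. }
  ring. }
rewrite CInt_const in K.
rewrite CInt_minus in K by (try lra; apply Hv2; lra).
assert (E2 : forall x, s <= x -> CInt (fun t => F (x, t)) 0 (2 * PI) =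
  (RtoC (exp (- IZR n * x)) * CInt (fun t => G (x, t) * cis (- n) t) 0 (2 * PI))%C).
{ intros x Hx. rewrite <- CInt_Cmult by (try lra; auto).
  apply CInt_ext; [lra|]. intros t _. apply EF. }
rewrite !E2 in K by lra.
unfold fcoef.
set (A := CInt (fun t => G (x2, t) * cis (- n) t)%C 0 (2 * PI)) in *.
set (B := CInt (fun t => G (x1, t) * cis (- n) t)%C 0 (2 * PI)) in *.
set (a := RtoC (exp (- IZR n * x2))) in *. set (b := RtoC (exp (- IZR n * x1))) in *.
assert (K' : (a * A - b * B)%C = RtoC 0).
{ assert (Q : ((/ Ci) * (RtoC (x2 - x1) * RtoC 0 + Ci * (a * A - b * B)))%C = RtoC 0)
    by (rewrite K; ring).
  rewrite <- Q. field. apply Ci_nz. }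
apply (proj2 (Ceq_minus _ _)) in K'.
replace (a * (RtoC (/ (2 * PI)) * A))%C with (RtoC (/ (2 * PI)) * (a * A))%C by ring.
rewrite K'. ring.
Qed.

(** [h n] is the Laurent coefficient of [G] regarded as a function of [exp w] outside a disc. *)
Lemma laurent_coefs s G : holo_on s G -> periodic_on s G ->
  exists h : Z -> C, forall n x, s <= x ->
    fcoef (fun t => G (x, t)) n = (RtoC (exp (IZR n * x)) * h n)%C.
Proof.
intros HG Hp. exists (fun n => RtoC (exp (- IZR n * s)) * fcoef (fun t => G (s, t)) n)%C.
intros n x Hx. rewrite <- (fcoef_holo_eq s G n s x) by (trivial; lra).
rewrite Cmult_assoc, <- RtoC_mult, <- exp_plus.
replace (IZR n * x + - IZR n * x) with 0 by ring. rewrite exp_0. ring.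
Qed.

Lemma fcoef_ext phi psi n : (forall t, phi t = psi t) -> fcoef phi n = fcoef psi n.
Proof.
intros H. unfold fcoef. f_equal. apply CInt_ext; [apply Rlt_le, two_PI_pos|].
intros t _. now rewrite H.
Qed.

Lemma fcoef_minus phi psi n : ccont_on phi 0 (2 * PI) -> ccont_on psi 0 (2 * PI) ->
  fcoef (fun t => phi t - psi t)%C n = (fcoef phi n - fcoef psi n)%C.
Proof.
intros H K. unfold fcoef. assert (P2 := two_PI_pos).
assert (Hc : ccont_on (cis (- n)) 0 (2 * PI)) by (intros t _; apply continuous_cis).
rewrite (CInt_ext _ (fun t => phi t * cis (- n) t - psi t * cis (- n) t)%C)
  by (try lra; intros; ring).
rewrite CInt_minus by (try lra; now apply ccont_on_mult). ring.
Qed.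

Lemma fcoef_csum (f : nat -> R -> C) N n :
  (forall k, (k <= N)%nat -> ccont_on (f k) 0 (2 * PI)) ->
  fcoef (fun t => sum_n (fun k => f k t) N) n = sum_n (fun k => fcoef (f k) n) N.
Proof.
intros H. unfold fcoef. rewrite csum_mult. f_equal. assert (P2 := two_PI_pos).
rewrite <- CInt_csum; [|lra|].
- apply CInt_ext; [lra|]. intros t _. 
  rewrite Cmult_comm, <- csum_mult. apply csum_ext. intros k _. ring.
- intros k Hk. apply ccont_on_mult; auto. intros t _. apply continuous_cis.
Qed.

Lemma fcoef_bound phi n M : ccont_on phi 0 (2 * PI) ->
  (forall t, 0 <= t <= 2 * PI -> Cmod (phi t) <= M) -> Cmod (fcoef phi n) <= M.
Proof.
intros Hc H. unfold fcoef. assert (P2 := two_PI_pos).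
assert (P3 : 0 < / (2 * PI)) by now apply Rinv_0_lt_compat.
rewrite Cmod_mult, Cmod_R, Rabs_pos_eq by lra.
assert (K : Cmod (CInt (fun t => phi t * cis (- n) t)%C 0 (2 * PI)) <= (2 * PI - 0) * M).
{ apply CInt_bound; [lra| |].
  - apply ccont_on_mult; trivial. intros t _. apply continuous_cis.
  - intros t Ht. rewrite Cmod_mult, Cmod_cis. rewrite Rmult_1_r. auto. }
apply Rmult_le_reg_l with (2 * PI); [lra|].
rewrite <- Rmult_assoc, Rinv_r by lra. lra.
Qed.

Lemma CInt_cis n : CInt (cis n) 0 (2 * PI) = if Z.eq_dec n 0 then RtoC (2 * PI) else RtoC 0.
Proof.
assert (P2 := two_PI_pos).
destruct (Z.eq_dec n 0) as [->|Hn].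
- rewrite (CInt_ext _ (fun _ => RtoC 1)) by (try lra; intros; apply cis_0).
  rewrite CInt_const, Rminus_0_r. ring.
- assert (Hn' : IZR n <> 0) by now apply not_0_IZR.
  apply CInt_unique.
  replace (RtoC 0) with 
   ((/ IZR n * sin (IZR n * (2 * PI)) - / IZR n * sin (IZR n * 0),
     - / IZR n * cos (IZR n * (2 * PI)) - - / IZR n * cos (IZR n * 0)) : C).
  2: { assert (E := cis_2PI n). unfold cis, Cexp in E; simpl in E.
    rewrite exp_0, !Rmult_1_l in E. injection E as E1 E2.
    rewrite E1, E2, (Rmult_0_r (IZR n)), sin_0, cos_0. unfold RtoC. f_equal; ring. }
  apply (@is_RInt_fct_extend_pair R_NormedModule R_NormedModule); simpl.
  + apply (@is_RInt_derive R_CompleteNormedModule (fun t => / IZR n * sin (IZR n * t))).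
    * intros t _. simpl. auto_derive; trivial. rewrite exp_0. field. exact Hn'.
    * intros t _. apply continuous_Rmult; [apply continuous_const|].
      apply (continuous_comp (fun t => IZR n * t) cos); [|apply continuous_cos].
      apply continuous_Rmult; [apply continuous_const|apply continuous_id].
  + apply (@is_RInt_derive R_CompleteNormedModule (fun t => - / IZR n * cos (IZR n * t))).
    * intros t _. simpl. auto_derive; trivial. rewrite exp_0. field. exact Hn'.
    * intros t _. apply continuous_Rmult; [apply continuous_const|].
      apply (continuous_comp (fun t => IZR n * t) sin); [|apply continuous_sin].
      apply continuous_Rmult; [apply continuous_const|apply continuous_id].
Qed.

Lemma fcoef_cis c m n :
  fcoef (fun t => c * cis m t)%C n = if Z.eq_dec m n then c else RtoC 0.
Proof.
unfold fcoef. assert (P2 := two_PI_pos).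
rewrite (CInt_ext _ (fun t => c * cis (m - n) t)%C).
- rewrite CInt_Cmult, CInt_cis by (try lra; intros t _; apply continuous_cis).
  destruct (Z.eq_dec (m - n) 0); destruct (Z.eq_dec m n); try lia; [|ring].
  rewrite RtoC_inv by lra. field. intros H. apply RtoC_inj in H. lra.
- lra.
- intros t _. unfold Zminus. rewrite cis_plus. ring.
Qed.

(** * Fejer kernel *)

Lemma csum_conj (f : nat -> C) n : Cconj (sum_n f n) = sum_n (fun k => Cconj (f k)) n.
Proof.
induction n as [|n IH]; [now rewrite !csum_O|].
rewrite !csum_S, <- IH. apply Cplus_conj.
Qed.

(** This is one-sided, unlike the symmetric Dirichlet kernel: its squared modulus divided by the
    number of terms is the classical Fejer kernel, whose positivity is then visible. *)
Definition dirichlet (N : nat) (s : R) : C := sum_n (fun j => cis (Z.of_nat j) s) N.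

Definition fejer (N : nat) (s : R) : R := Cmod (dirichlet N s) ^ 2 / INR (S N).

Lemma dirichlet_sqr N s : RtoC (Cmod (dirichlet N s) ^ 2) =
  sum_n (fun k => sum_n (fun j => cis (Z.of_nat j - Z.of_nat k) s) N) N.
Proof.
rewrite Cmod2_conj. unfold dirichlet at 2. rewrite csum_conj, <- csum_mult.
apply csum_ext. intros k _. unfold dirichlet. rewrite Cmult_comm, <- csum_mult.
apply csum_ext. intros j _. rewrite cis_conj. unfold Zminus. rewrite cis_plus. ring.
Qed.

Lemma fejer_ge_0 N s : 0 <= fejer N s.
Proof.
unfold fejer. apply Rdiv_le_0_compat; [apply pow2_ge_0|]. apply lt_0_INR. lia.
Qed.

Lemma continuous_fejer N s : continuous (fejer N) s.
Proof.
unfold fejer, Rdiv. apply continuous_Rmult; [|apply continuous_const]. simpl.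
assert (H : continuous (fun x => Cmod (dirichlet N x)) s).
{ apply continuous_Cmod. apply (ccont_on_csum (fun j => cis (Z.of_nat j)) N s s); [|lra].
  intros k _ t _. apply continuous_cis. }
apply continuous_Rmult; [exact H|]. apply continuous_Rmult; [exact H|apply continuous_const].
Qed.

(** The squared modulus is expanded as a double sum instead of collecting equal frequencies with
    triangular weights. The mean thus becomes an average over [k] of rows of coefficients, which
    [fourier_bound_PI] bounds one row at a time. *)
Lemma fejer_mean phi N : ccont_on phi 0 (2 * PI) ->
  CInt (fun t => phi t * RtoC (fejer N (PI - t)))%C 0 (2 * PI) =
  (RtoC (2 * PI / INR (S N)) *
   sum_n (fun k => sum_n (fun j => cis (Z.of_nat j - Z.of_nat k) PI *
     fcoef phi (Z.of_nat j - Z.of_nat k)) N) N)%C.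
Proof.
intros Hc. assert (P2 := two_PI_pos).
assert (HN : 0 < INR (S N)) by (apply lt_0_INR; lia).
assert (Hcc : forall c m, ccont_on (fun t => c * (phi t * cis m t))%C 0 (2 * PI)).
{ intros c m. apply ccont_on_mult; [apply ccont_on_const|]. apply ccont_on_mult; trivial.
  intros t _. apply continuous_cis. }
set (c := fun j k : nat => (RtoC (/ INR (S N)) * cis (Z.of_nat j - Z.of_nat k) PI)%C).
rewrite (CInt_ext _ (fun t => sum_n (fun k => sum_n (fun j =>
  c j k * (phi t * cis (- (Z.of_nat j - Z.of_nat k)) t))%C N) N)); [|lra|].
- rewrite (CInt_csum (fun k t => sum_n (fun j =>
    c j k * (phi t * cis (- (Z.of_nat j - Z.of_nat k)) t))%C N)); [|lra|].
  + rewrite <- csum_mult. apply csum_ext. intros k _.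
    rewrite (CInt_csum (fun j t =>
      c j k * (phi t * cis (- (Z.of_nat j - Z.of_nat k)) t))%C); [|lra|auto].
    rewrite <- csum_mult. apply csum_ext. intros j _.
    rewrite CInt_Cmult; [|lra|].
    * unfold fcoef, c. unfold Rdiv. rewrite !RtoC_mult, !RtoC_inv, RtoC_mult by lra.
      field. split; intros H; apply RtoC_inj in H; lra.
    * apply ccont_on_mult; trivial. intros t _. apply continuous_cis.
  + intros k _. apply ccont_on_csum. auto.
- intros t _. unfold fejer, Rdiv. rewrite RtoC_mult, dirichlet_sqr.
  rewrite (Cmult_comm _ (RtoC (/ INR (S N)))), Cmult_assoc, <- csum_mult.
  apply csum_ext. intros k _. rewrite <- csum_mult. apply csum_ext. intros j _.
  unfold c, Rminus. rewrite cis_tplus, cis_opp_t. 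
  match goal with |- ?a = ?b => change (@eq C a b) end. ring.
Qed.

Lemma fejer_mean_1 N : CInt (fun t => RtoC (fejer N (PI - t))) 0 (2 * PI) = RtoC (2 * PI).
Proof.
assert (P2 := two_PI_pos). assert (HN : 0 < INR (S N)) by (apply lt_0_INR; lia).
rewrite (CInt_ext _ (fun t => RtoC 1 * RtoC (fejer N (PI - t)))%C) by (try lra; intros; ring).
rewrite (fejer_mean (fun _ => RtoC 1)) by apply ccont_on_const.
assert (E : forall n, fcoef (fun _ => RtoC 1) n = if Z.eq_dec 0 n then RtoC 1 else RtoC 0).
{ intros n. rewrite <- (fcoef_cis (RtoC 1) 0 n). apply fcoef_ext.
  intros t. rewrite cis_0. ring. }
rewrite (csum_ext _ (fun _ => RtoC 1)).
- assert (S1 : forall m, sum_n (fun _ : nat => RtoC 1) m = RtoC (INR (S m))).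
  { induction m as [|m IH]; [now rewrite csum_O|].
    rewrite csum_S, IH, (S_INR (S m)), RtoC_plus. reflexivity. }
  rewrite S1, <- RtoC_mult. f_equal. field. lra.
- intros k Hk. rewrite (csum_single _ N k); trivial.
  + rewrite E. destruct (Z.eq_dec 0 (Z.of_nat k - Z.of_nat k)); [|lia].
    rewrite Z.sub_diag, cis_0. ring.
  + intros j _ Hj. rewrite E. destruct (Z.eq_dec 0 (Z.of_nat j - Z.of_nat k)); [lia|]. ring.
Qed.

(** Multiplied by [cis 1 s - 1], the geometric sum telescopes. The product form avoids dividing by a
    factor that vanishes at [s = 0]. *)
Lemma dirichlet_bound N s : Cmod (dirichlet N s) * Cmod (cis 1 s - 1) <= 2.
Proof.
rewrite <- Cmod_mult.
assert (E : (dirichlet N s * (cis 1 s - 1) = cis (Z.of_nat (S N)) s - 1)%C).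
{ unfold dirichlet. induction N as [|N IH].
  - rewrite csum_O. simpl Z.of_nat. rewrite cis_0. ring.
  - rewrite csum_S, Cmult_plus_distr_r, IH.
    replace (Z.of_nat (S (S N))) with (Z.of_nat (S N) + 1)%Z by lia. 
    rewrite (cis_plus (Z.of_nat (S N)) 1). ring. }
rewrite E. eapply Rle_trans; [apply Cmod_triangle|].
rewrite Cmod_opp, Cmod_cis, Cmod_1. lra.
Qed.

(** Away from 0 the factor [cis 1 s - 1] has modulus at least [1 - cos d], so the kernel decays like
    [1 / N] there. *)
Lemma fejer_away N s d : 0 < d -> d <= Rabs s <= PI ->
  fejer N s * ((1 - cos d) ^ 2 * INR (S N)) <= 4.
Proof.
intros Hd Hs. unfold fejer. assert (HN : 0 < INR (S N)) by (apply lt_0_INR; lia).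
assert (H := dirichlet_bound N s).
assert (Hc : 1 - cos d <= Cmod (cis 1 s - 1)).
{ assert (K : cos s <= cos d).
  { replace (cos s) with (cos (Rabs s)).
    - apply cos_decr_1; lra.
    - unfold Rabs. destruct Rcase_abs; trivial. apply cos_neg. }
  assert (L := re_le_Cmod (cis 1 s - 1)).
  assert (E : Re (cis 1 s - 1) = cos s - 1).
  { unfold cis, Cexp; simpl. rewrite exp_0, !Rmult_1_l. reflexivity. }
  rewrite E in L. assert (B := COS_bound s). rewrite Rabs_left1 in L by lra. lra. }
assert (B := COS_bound d). assert (P1 := Cmod_ge_0 (dirichlet N s)).
replace (Cmod (dirichlet N s) ^ 2 / INR (S N) * ((1 - cos d) ^ 2 * INR (S N)))
  with ((Cmod (dirichlet N s) * (1 - cos d)) ^ 2) by (field; lra).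
assert (K : 0 <= Cmod (dirichlet N s) * (1 - cos d) <= 2).
{ split; [apply Rmult_le_pos; lra|]. eapply Rle_trans; [|exact H].
  apply Rmult_le_compat_l; lra. }
replace 4 with (2 ^ 2) by ring. now apply pow_incr.
Qed.

Lemma ccont_on_bounded phi a b : a <= b -> ccont_on phi a b ->
  exists M, forall t, a <= t <= b -> Cmod (phi t) <= M.
Proof.
intros Hab H.
destruct (continuity_ab_maj (fun t => Cmod (phi t)) a b Hab) as [m [Hm _]].
- intros t Ht. apply continuity_pt_filterlim. apply continuous_Cmod. now apply H.
- exists (Cmod (phi m)). exact Hm.
Qed.

(** The Fejer mean is an average of [N + 1] rows each bounded by [B], and it tends to the value of
    [phi]. Centring the kernel at [PI] keeps [PI - t] within [[- PI, PI]] over the interval of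
    integration, so that [fejer_away] applies directly. *)
Lemma fourier_bound_PI phi B : ccont_on phi 0 (2 * PI) ->
  (forall N k, (k <= N)%nat ->
    sum_n (fun j => Cmod (fcoef phi (Z.of_nat j - Z.of_nat k))) N <= B) ->
  Cmod (phi PI) <= B.
Proof.
intros Hc HB. assert (P2 := two_PI_pos). assert (P1 := PI_RGT_0).
destruct (ccont_on_bounded phi 0 (2 * PI) ltac:(lra) Hc) as [M HM].
assert (HM0 : 0 <= M) by (eapply Rle_trans; [apply Cmod_ge_0|apply (HM 0); lra]).
apply le_epsilon. intros e He.
destruct (proj1 (continuous_C_eps _ _) (Hc PI ltac:(lra)) (e / 2) ltac:(lra)) as [d Hd].
set (d' := Rmin d PI).
assert (Hd' : 0 < d' <= PI).
{ unfold d'. split; [apply Rmin_pos; trivial; apply cond_pos | apply Rmin_r]. }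
set (c := (1 - cos d') ^ 2).
assert (Hcpos : 0 < c).
{ unfold c. apply pow_lt. assert (K := cos_decreasing_1 0 d').
  rewrite cos_0 in K. specialize (K ltac:(lra) ltac:(lra) ltac:(lra) ltac:(lra) ltac:(lra)). lra. }
(* Far from [PI] the integrand is at most [2 * M * 4 / (c * (N + 1))]; this choice makes it at most
   [e / 2]. The bound is enlarged to [M + 1] so that the quotient makes sense when [M = 0]. *)
destruct (archimed_cor1 (e * c / (16 * (M + 1)))) as [N [HN1 HN2]].
{ apply Rdiv_lt_0_compat; nra. }
destruct N as [|N]; [lia|]. clear HN2.
assert (HN : 0 < INR (S N)) by (apply lt_0_INR; lia).
set (F := fun t => RtoC (fejer N (PI - t))).
assert (HF : ccont_on F 0 (2 * PI)).
{ intros t _. apply continuous_RtoC. apply (continuous_comp (fun t => PI - t) (fejer N)).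
  - apply continuous_Rminus; [apply continuous_const|apply continuous_id].
  - apply continuous_fejer. }
assert (E : (RtoC (2 * PI) * phi PI - CInt (fun t => phi t * F t)%C 0 (2 * PI) =
  CInt (fun t => (phi PI - phi t) * F t)%C 0 (2 * PI))%C).
{ unfold F at 1. rewrite <- (fejer_mean_1 N). fold F.
  rewrite Cmult_comm, <- CInt_Cmult by (trivial; lra).
  rewrite <- CInt_minus; [|lra| |].
  - apply CInt_ext; [lra|]. intros t _. unfold F. ring.
  - apply ccont_on_mult; trivial. apply ccont_on_const.
  - now apply ccont_on_mult. }
assert (B1 : Cmod (CInt (fun t => phi t * F t)%C 0 (2 * PI)) <= 2 * PI * B).
{ unfold F. rewrite fejer_mean by exact Hc. rewrite Cmod_mult, Cmod_R.
  rewrite Rabs_pos_eq by (apply Rdiv_le_0_compat; lra).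
  assert (K : Cmod (sum_n (fun k => sum_n (fun j => cis (Z.of_nat j - Z.of_nat k) PI *
     fcoef phi (Z.of_nat j - Z.of_nat k))%C N) N) <= INR (S N) * B).
  { eapply Rle_trans; [apply Cmod_csum|]. apply rsum_const_le. intros k Hk.
    eapply Rle_trans; [apply Cmod_csum|]. eapply Rle_trans; [|apply (HB N k Hk)].
    apply Req_le. apply sum_n_ext. intros j. now rewrite Cmod_mult, Cmod_cis, Rmult_1_l. }
  apply Rle_trans with (2 * PI / INR (S N) * (INR (S N) * B)).
  - apply Rmult_le_compat_l; [apply Rdiv_le_0_compat; lra | exact K].
  - apply Req_le. field. lra. }
assert (B2 : Cmod (CInt (fun t => (phi PI - phi t) * F t)%C 0 (2 * PI)) <= 2 * PI * e).
{ assert (Hre : RInt (fun t => fejer N (PI - t)) 0 (2 * PI) = 2 * PI).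
  { assert (K := fejer_mean_1 N). fold F in K.
    assert (K2 := is_CInt F 0 (2 * PI) ltac:(lra) HF). rewrite K in K2.
    apply is_CInt_fst in K2. simpl in K2. exact (@is_RInt_unique R_CompleteNormedModule _ _ _ _ K2). }
  assert (Hfc : forall t, continuous (fun t => fejer N (PI - t)) t).
  { intros t. apply (continuous_comp (fun t => PI - t) (fejer N)).
    - apply continuous_Rminus; [apply continuous_const|apply continuous_id].
    - apply continuous_fejer. }
  eapply Rle_trans.
  (* The first summand dominates near [PI], by continuity of [phi], and the constant dominates
     elsewhere; each integrates to [PI * e]. *)
  - apply (CInt_norm_le _ (fun t => e / 2 * fejer N (PI - t) + e / 2)).
    + lra.
    + apply ccont_on_mult; trivial. apply ccont_on_minus; trivial. apply ccont_on_const.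
    + intros t _. apply continuous_Rplus; [|apply continuous_const].
      apply continuous_Rmult; [apply continuous_const|apply Hfc].
    + intros t Ht. rewrite Cmod_mult. unfold F. rewrite Cmod_R.
      assert (Q := fejer_ge_0 N (PI - t)). rewrite Rabs_pos_eq by exact Q.
      destruct (Rlt_le_dec (Rabs (PI - t)) d') as [Hl|Hl].
      * assert (K : Cmod (phi t - phi PI) < e / 2).
        { apply Hd. change (Rabs (t - PI) < d). rewrite Rabs_minus_sym.
          eapply Rlt_le_trans; [exact Hl|]. apply Rmin_l. }
        replace (phi PI - phi t)%C with (- (phi t - phi PI))%C by ring.
        rewrite Cmod_opp.
        assert (Cmod (phi t - phi PI) * fejer N (PI - t) <= e / 2 * fejer N (PI - t)) by
          (apply Rmult_le_compat_r; lra). lra.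
      * assert (K : fejer N (PI - t) * (c * INR (S N)) <= 4).
        { apply fejer_away; [lra|]. split; [exact Hl|]. apply Rabs_le. lra. }
        assert (K2 : Cmod (phi PI - phi t) <= 2 * M).
        { eapply Rle_trans; [apply Cmod_triangle|]. rewrite Cmod_opp.
          assert (A1 := HM PI ltac:(lra)). assert (A2 := HM t Ht). lra. }
        assert (K3 : Cmod (phi PI - phi t) * fejer N (PI - t) <= 2 * M * fejer N (PI - t))
          by (apply Rmult_le_compat_r; lra).
        assert (K4 : 2 * M * fejer N (PI - t) <= e / 2).
        { assert (R1 : 1 < e * c / (16 * (M + 1)) * INR (S N)).
          { apply Rmult_lt_reg_l with (/ INR (S N)); [now apply Rinv_0_lt_compat|].
            rewrite Rmult_1_r. eapply Rlt_le_trans; [exact HN1|]. apply Req_le. field. lra. }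
          assert (R2 : 16 * (M + 1) < e * (c * INR (S N))).
          { apply Rmult_lt_reg_l with (/ (16 * (M + 1))).
            - apply Rinv_0_lt_compat. lra.
            - rewrite Rinv_l by lra. eapply Rlt_le_trans; [exact R1|]. apply Req_le. field. lra. }
          set (X := c * INR (S N)) in *. assert (HX : 0 < X) by (apply Rmult_lt_0_compat; lra).
          apply Rmult_le_reg_r with X; [exact HX|]. nra. }
        nra.
  - assert (Hie : ex_RInt (fun t => fejer N (PI - t)) 0 (2 * PI))
      by (apply (@ex_RInt_continuous R_CompleteNormedModule); intros; apply Hfc).
    rewrite (RInt_plus (V := R_CompleteNormedModule)).
    + change (plus (RInt (fun x => e / 2 * fejer N (PI - x)) 0 (2 * PI))
        (RInt (fun _ => e / 2) 0 (2 * PI))) with 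
        (RInt (fun x => e / 2 * fejer N (PI - x)) 0 (2 * PI) +
        RInt (fun _ => e / 2) 0 (2 * PI)).
      rewrite (RInt_scal (V := R_CompleteNormedModule)) by exact Hie.
      rewrite Hre, RInt_const. 
      change (e / 2 * (2 * PI) + (2 * PI - 0) * (e / 2) <= 2 * PI * e). lra.
    + now apply (ex_RInt_scal (V := R_CompleteNormedModule)).
    + apply ex_RInt_const. }
assert (K : Cmod (RtoC (2 * PI) * phi PI) <= 2 * PI * B + 2 * PI * e).
{ replace (RtoC (2 * PI) * phi PI)%C with
   ((RtoC (2 * PI) * phi PI - CInt (fun t => phi t * F t)%C 0 (2 * PI)) +
    CInt (fun t => phi t * F t)%C 0 (2 * PI))%C by ring.
  eapply Rle_trans; [apply Cmod_triangle|]. rewrite E. lra. }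
rewrite Cmod_mult, Cmod_R, Rabs_pos_eq in K by lra.
apply Rmult_le_reg_l with (2 * PI); lra.
Qed.

Lemma CInt_comp_shift (f : R -> C) v : (forall t, continuous f t) ->
  CInt (fun t => f (t + v)) 0 (2 * PI) = CInt f v (2 * PI + v).
Proof.
intros Hc. apply CInt_unique. assert (P2 := two_PI_pos).
assert (H := is_CInt f (1 * 0 + v) (1 * (2 * PI) + v) ltac:(lra) ltac:(intros t _; apply Hc)).
replace (CInt f v (2 * PI + v)) with (CInt f (1 * 0 + v) (1 * (2 * PI) + v))
  by (f_equal; ring).
apply (@is_RInt_comp_lin C_R_NormedModule) in H.
apply (@is_RInt_ext C_R_NormedModule _ (fun t => f (t + v))) in H; [exact H|].
intros t _. rewrite (scal_one (K := R_AbsRing)). f_equal. ring.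
Qed.

Lemma CInt_periodic_shift (f : R -> C) v : (forall t, continuous f t) ->
  (forall t, f (t + 2 * PI) = f t) -> 0 <= v <= 2 * PI ->
  CInt (fun t => f (t + v)) 0 (2 * PI) = CInt f 0 (2 * PI).
Proof.
intros Hc Hp Hv. rewrite CInt_comp_shift by exact Hc. assert (P2 := two_PI_pos).
assert (Hcc : forall a b, ccont_on f a b) by (intros a b t _; apply Hc).
rewrite (CInt_Chasles f v (2 * PI) (2 * PI + v)) by (trivial; lra).
rewrite (CInt_Chasles f 0 v (2 * PI)) by (trivial; lra).
rewrite Cplus_comm. f_equal. 
assert (H := is_CInt f (1 * 0 + 2 * PI) (1 * v + 2 * PI) ltac:(lra) ltac:(apply Hcc)).
replace (CInt f (2 * PI) (2 * PI + v)) with (CInt f (1 * 0 + 2 * PI) (1 * v + 2 * PI))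
  by (f_equal; ring).
apply (@is_RInt_comp_lin C_R_NormedModule) in H. symmetry. apply CInt_unique.
apply (@is_RInt_ext C_R_NormedModule _ f) in H; [exact H|].
intros t _. rewrite (scal_one (K := R_AbsRing)), Rmult_1_l. apply Hp.
Qed.

(** A translation moves any point to [PI] and multiplies each Fourier coefficient by a number of
    modulus 1, so the hypothesis on the sums is unaffected. *)
Lemma fourier_bound (phi : R -> C) B : (forall t, continuous phi t) ->
  (forall t, phi (t + 2 * PI) = phi t) ->
  (forall N k, (k <= N)%nat ->
    sum_n (fun j => Cmod (fcoef phi (Z.of_nat j - Z.of_nat k))) N <= B) ->
  forall t, 0 <= t <= 2 * PI -> Cmod (phi t) <= B.
Proof.
intros Hc Hp HB.
assert (Hlow : forall v, 0 <= v <= 2 * PI -> Cmod (phi (PI + v)) <= B).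
{ intros v Hv. apply (fourier_bound_PI (fun t => phi (t + v))).
  - intros t _. apply (continuous_comp (fun t => t + v) phi); [|apply Hc].
    apply continuous_Rplus; [apply continuous_id|apply continuous_const].
  - intros N k Hk. eapply Rle_trans; [|apply (HB N k Hk)]. apply Req_le.
    apply sum_n_ext. intros j. set (n := (Z.of_nat j - Z.of_nat k)%Z).
    unfold fcoef. rewrite !Cmod_mult. f_equal.
    assert (P2 := two_PI_pos).
    rewrite <- (CInt_periodic_shift (fun t => phi t * cis (- n) t)%C v); trivial.
    + rewrite (CInt_ext _ (fun t => cis (- n) (- v) * 
        (phi (t + v)%R * cis (- n) (t + v)%R))%C); [|lra|].
      * rewrite CInt_Cmult, Cmod_mult, Cmod_cis, Rmult_1_l; trivial; [lra|].
        intros t _. apply (continuous_comp (fun t => t + v) (fun t => phi t * cis (- n) t)%C).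
        -- apply continuous_Rplus; [apply continuous_id|apply continuous_const].
        -- apply continuous_Cmult; [apply Hc|apply continuous_cis].
      * intros t _. replace (cis (- n) t) with (cis (- n) (- v + (t + v)))
          by (f_equal; ring). rewrite cis_tplus. ring.
    + intros t. apply continuous_Cmult; [apply Hc|apply continuous_cis].
    + intros t. rewrite cis_tplus, cis_2PI, Hp. ring. }
intros t Ht. destruct (Rle_lt_dec PI t) as [H|H].
- replace t with (PI + (t - PI)) by ring. apply Hlow. lra.
- rewrite <- Hp. replace (t + 2 * PI) with (PI + (t + PI)) by ring. apply Hlow. lra.
Qed.

(** * Continuous logarithms *)

(** The principal branch for the right half plane only: there [atan] of the slope is the argument,
    with no case distinction. In the left half plane the second component is not an argument of
    [z]. *)
Definition Clog (z : C) : C := (ln (Cmod z), atan (Im z / Re z)).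

Lemma Cexp_Clog (z : C) : 0 < Re z -> Cexp (Clog z) = z.
Proof.
intros H. destruct z as [x y]. simpl in H.
assert (Hm : 0 < Cmod (x, y)).
{ apply Cmod_gt_0. intros E. injection E as E1 _. lra. }
unfold Cexp, Clog; simpl. rewrite exp_ln by exact Hm.
rewrite cos_atan, sin_atan.
assert (E : sqrt (1 + (y / x)²) = Cmod (x, y) / x).
{ apply sqrt_lem_1.
  - assert (Q := Rle_0_sqr (y / x)). lra.
  - apply Rdiv_le_0_compat; lra.
  - replace (Cmod (x, y) / x * (Cmod (x, y) / x)) with (Cmod (x, y) ^ 2 / x ^ 2) by (field; lra).
    rewrite Cmod2_alt. simpl. unfold Rsqr. field. lra. }
rewrite E. f_equal; field; lra.
Qed.

Lemma continuous_Clog {U : UniformSpace} (f : U -> C) (x : U) :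
  0 < Re (f x) -> continuous f x -> continuous (fun t => Clog (f t)) x.
Proof.
intros H Hc. unfold Clog. apply continuous_C_pair; simpl.
- apply (continuous_comp (fun t => Cmod (f t)) ln); [now apply continuous_Cmod|].
  apply continuity_pt_filterlim, derivable_continuous_pt.
  exists (/ Cmod (f x)). apply derivable_pt_lim_ln.
  apply Cmod_gt_0. intros E. rewrite E in H. simpl in H. lra.
- apply (continuous_comp (fun t => Im (f t) / Re (f t)) atan); [|apply continuous_atan].
  unfold Rdiv. apply continuous_Rmult; [now apply continuous_C_snd|].
  apply (continuous_comp (fun t => Re (f t)) Rinv); [now apply continuous_C_fst|].
  apply continuous_Rinv. lra.
Qed.

Lemma Cexp_polar x t : Cexp (x, t) = (RtoC (exp x) * cis 1 t)%C.
Proof.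
unfold cis. replace (RtoC (exp x)) with (Cexp (x, 0)).
- rewrite <- Cexp_plus. f_equal. unfold Cplus; simpl. f_equal; ring.
- unfold Cexp, RtoC; simpl. rewrite cos_0, sin_0. f_equal; ring.
Qed.

Lemma Cexp_period x t : Cexp (x, t + 2 * PI) = Cexp (x, t).
Proof. rewrite !Cexp_polar, cis_tplus, cis_2PI. ring. Qed.

(** One of the rotations by [- PI / 2], 0, [PI / 2], [PI] brings [c] into the right half plane,
    where [Clog] applies. The resulting argument lies between [- PI] and [3 * PI / 2], and one
    period is added when it is negative. *)
Lemma Cexp_surj_2PI (c : C) : c <> RtoC 0 ->
  exists x t, Cexp (x, t) = c /\ 0 <= t <= 2 * PI.
Proof.
intros Hc. assert (P1 := PI_RGT_0).
assert (Hu : forall v, - (PI / 2) <= v <= PI -> 0 < Re (c / Cexp (0, v)) ->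
  exists x t, Cexp (x, t) = c /\ 0 <= t <= 2 * PI).
{ intros v Hv Hu. set (l := Clog (c / Cexp (0, v))).
  assert (E : Cexp (Re l, Im l + v) = c).
  { replace (Re l, Im l + v) with (l + (0, v))%C
      by (unfold Cplus, Re, Im; simpl; f_equal; ring).
    rewrite Cexp_plus. unfold l. rewrite Cexp_Clog by exact Hu. field. apply Cexp_neq_0. }
  assert (B : - PI < Im l + v < 3 * PI / 2).
  { unfold l, Clog. cbn [snd Im]. assert (A := atan_bound (Im (c / Cexp (0, v)) / Re (c / Cexp (0, v)))).
    lra. }
  destruct (Rle_lt_dec 0 (Im l + v)) as [H|H].
  - exists (Re l), (Im l + v). split; trivial. lra.
  - exists (Re l), (Im l + v + 2 * PI). split; [|lra]. rewrite <- E. apply Cexp_period. }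
assert (K : forall t, Re (c / Cexp (0, t)) = Re c * cos t + Im c * sin t).
{ intros t. unfold Cdiv. rewrite <- Cexp_opp. unfold Cexp. simpl.
  rewrite Ropp_0, exp_0, cos_neg, sin_neg. unfold Re, Im. ring. }
destruct (Rtotal_order (Re c) 0) as [H|[H|H]].
- apply (Hu PI); [lra|]. rewrite K, cos_PI, sin_PI. lra.
- destruct (Rtotal_order (Im c) 0) as [H'|[H'|H']].
  + apply (Hu (- (PI / 2))); [lra|]. rewrite K, cos_neg, sin_neg, cos_PI2, sin_PI2. lra.
  + exfalso. apply Hc. destruct c as [x y]. simpl in *. now subst.
  + apply (Hu (PI / 2)); [lra|]. rewrite K, cos_PI2, sin_PI2. lra.
- apply (Hu 0); [lra|]. rewrite K, cos_0, sin_0. lra.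
Qed.

Lemma Cexp_surj (c : C) : c <> RtoC 0 -> exists l, Cexp l = c.
Proof.
intros H. destruct (Cexp_surj_2PI c H) as [x [t [E _]]]. now exists (x, t).
Qed.

Lemma Cexp_eq_1 (z : C) : Cexp z = RtoC 1 -> Re z = 0 /\ cos (Im z) = 1 /\ sin (Im z) = 0.
Proof.
intros H. assert (M := Cmod_Cexp z). rewrite H, Cmod_1 in M.
assert (R0 : Re z = 0) by (apply exp_inv; rewrite exp_0; lra).
split; [exact R0|]. unfold Cexp in H. rewrite R0, exp_0, !Rmult_1_l in H.
injection H. auto.
Qed.

(** At both ends the imaginary part is a zero of the sine where the cosine is 1. A rise by less than
    [PI] is excluded by the sine; a rise by [PI] or more passes through the exact value [PI], where
    the cosine would be -1. *)
Lemma lift_unique_le (d : R -> C) : ccont_on d 0 1 ->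
  (forall t, 0 <= t <= 1 -> Cexp (d t) = RtoC 1) -> snd (d 1) <= snd (d 0).
Proof.
intros Hc H. apply Rnot_lt_le. intros Hlt.
destruct (Cexp_eq_1 _ (H 0 ltac:(lra))) as [_ [C0 S0]].
destruct (Cexp_eq_1 _ (H 1 ltac:(lra))) as [_ [C1 S1]].
unfold Im in *. assert (P1 := PI_RGT_0).
destruct (Rlt_le_dec (snd (d 1)) (snd (d 0) + PI)) as [H1|H1].
- assert (K : 0 < sin (snd (d 1) - snd (d 0))) by (apply sin_gt_0; lra).
  rewrite sin_minus, S0, S1 in K. lra.
- destruct (Req_dec (snd (d 1)) (snd (d 0) + PI)) as [H2|H2].
  + rewrite H2, neg_cos in C1. lra.
  + destruct (IVT_interv (fun t => snd (d t) - (snd (d 0) + PI)) 0 1) as [t [Ht Ht2]]; try lra.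
    * intros t Ht. apply continuity_pt_filterlim.
      apply (continuous_Rminus (fun t => snd (d t)) (fun _ => snd (d 0) + PI));
        [|apply continuous_const].
      apply continuous_C_snd. now apply Hc.
    * destruct (Cexp_eq_1 _ (H t Ht)) as [_ [Ct _]]. unfold Im in Ct.
      replace (snd (d t)) with (snd (d 0) + PI) in Ct by lra.
      rewrite neg_cos in Ct. lra.
Qed.

Lemma lift_unique (d : R -> C) : ccont_on d 0 1 ->
  (forall t, 0 <= t <= 1 -> Cexp (d t) = RtoC 1) -> d 1 = d 0.
Proof.
intros Hc H.
assert (E1 := lift_unique_le d Hc H).
assert (E2 : snd (- d 1)%C <= snd (- d 0)%C).
{ apply (lift_unique_le (fun t => - d t)%C).
  - intros t Ht. apply continuous_Copp. now apply Hc.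
  - intros t Ht. rewrite Cexp_opp, H by exact Ht. field. }
simpl in E2.
destruct (Cexp_eq_1 _ (H 0 ltac:(lra))) as [R0 _].
destruct (Cexp_eq_1 _ (H 1 ltac:(lra))) as [R1 _].
destruct (d 0) as [x0 y0]. destruct (d 1) as [x1 y1]. simpl in *. f_equal; lra.
Qed.

Definition seg (w0 w : C) (t : R) : C := (w0 + RtoC t * (w - w0))%C.

Lemma seg_coord w0 w t : seg w0 w t =
  (fst w0 + t * (fst w - fst w0), snd w0 + t * (snd w - snd w0)).
Proof. unfold seg, Cplus, Cmult, RtoC; simpl. f_equal; ring. Qed.

Lemma seg_0 w0 w : seg w0 w 0 = w0.
Proof. unfold seg. ring. Qed.

Lemma seg_1 w0 w : seg w0 w 1 = w.
Proof. unfold seg. ring. Qed.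

Lemma continuous_seg_t w0 w t : continuous (seg w0 w) t.
Proof.
apply continuous_Cplus; [apply continuous_const|].
apply continuous_Cmult; [|apply continuous_const].
apply continuous_RtoC, continuous_id.
Qed.

Lemma continuous_seg_w w0 w t : continuous (fun w => seg w0 w t) w.
Proof.
apply continuous_Cplus; [apply continuous_const|].
apply continuous_Cmult; [apply continuous_const|].
apply continuous_Cminus; [apply continuous_id|apply continuous_const].
Qed.

(** Two logarithms of the same function differ by a constant along a segment. This serves to glue
    local logarithms, and to see that translation by a period changes a logarithm by a constant. *)
Lemma lift_unique_seg (L1 L2 : C -> C) (w0 w : C) :
  (forall t, 0 <= t <= 1 -> continuous L1 (seg w0 w t) /\ continuous L2 (seg w0 w t) /\
    Cexp (L1 (seg w0 w t)) = Cexp (L2 (seg w0 w t))) ->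
  (L1 w - L2 w = L1 w0 - L2 w0)%C.
Proof.
intros H.
assert (K := lift_unique (fun t => L1 (seg w0 w t) - L2 (seg w0 w t))%C).
cbv beta in K. rewrite seg_0, seg_1 in K. apply K.
- intros t Ht. destruct (H t Ht) as [H1 [H2 _]]. apply continuous_Cminus.
  + now apply (continuous_comp (seg w0 w) L1); [apply continuous_seg_t|].
  + now apply (continuous_comp (seg w0 w) L2); [apply continuous_seg_t|].
- intros t Ht. destruct (H t Ht) as [_ [_ H3]]. rewrite Cexp_minus, H3.
  field. apply Cexp_neq_0.
Qed.

Definition in_rect (a b c e : R) (w : C) : Prop := a <= fst w <= b /\ c <= snd w <= e.

Lemma in_rect_seg a b c e w0 w t : in_rect a b c e w0 -> in_rect a b c e w ->
  0 <= t <= 1 -> in_rect a b c e (seg w0 w t).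
Proof. rewrite seg_coord. unfold in_rect; simpl. intros. nra. Qed.

(** Here [u] has modulus above three fourths of that of [c], while [v - u] has modulus below one
    half of it, so the ratio lies in the disc of radius 1 about 1. *)
Lemma ratio_Re_pos (u v c : C) : Cmod (u - c) < Cmod c / 4 -> Cmod (v - c) < Cmod c / 4 ->
  0 < Re (v / u).
Proof.
intros Hu Hv.
assert (Hc : Cmod c <= Cmod u + Cmod (u - c)).
{ replace c with (u + - (u - c))%C at 1 by ring. eapply Rle_trans; [apply Cmod_triangle|].
  rewrite Cmod_opp. lra. }
assert (Hun : u <> RtoC 0).
{ apply Cmod_gt_0. assert (0 <= Cmod c) by apply Cmod_ge_0. lra. }
assert (Hup := proj1 (Cmod_gt_0 _) Hun).
assert (Hd : Cmod (v - u) < Cmod u).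
{ replace (v - u)%C with ((v - c) + - (u - c))%C by ring.
  eapply Rle_lt_trans; [apply Cmod_triangle|]. rewrite Cmod_opp.
  assert (0 <= Cmod c) by apply Cmod_ge_0. lra. }
assert (Hq : Cmod (v / u - 1) < 1).
{ replace (v / u - 1)%C with ((v - u) / u)%C by (field; exact Hun).
  rewrite Cmod_div by exact Hun. apply Rmult_lt_reg_r with (Cmod u); [exact Hup|].
  unfold Rdiv. rewrite Rmult_assoc, Rinv_l by lra. lra. }
assert (L := re_le_Cmod (v / u - 1)).
replace (Re (v / u - 1)) with (Re (v / u) - 1) in L by (unfold Cminus; rewrite re_plus; reflexivity).
apply Rabs_le_between in L. lra.
Qed.

(** Compactness of the rectangle makes one [eta] serve everywhere. The gauge is set with [2 * delta]
    so that both [w], within [delta] of the centre, and [w'], within [eta <= delta] of [w], remain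
    in its range. *)
Lemma uniform_ratio (g : C -> C) a b c e :
  (forall w, in_rect a b c e w -> continuous g w /\ g w <> RtoC 0) ->
  exists eta, 0 < eta /\ forall w w', in_rect a b c e w -> in_rect a b c e w' ->
    Rabs (fst w' - fst w) < eta -> Rabs (snd w' - snd w) < eta -> 0 < Re (g w' / g w).
Proof.
intros H.
assert (HD : forall u v, exists d : posreal, in_rect a b c e (u, v) ->
  forall w : C, Rabs (fst w - u) < 2 * d -> Rabs (snd w - v) < 2 * d ->
  Cmod (g w - g (u, v)) < Cmod (g (u, v)) / 4).
{ intros u v. destruct (classic (in_rect a b c e (u, v))) as [Hr|Hr].
  - destruct (H _ Hr) as [Hc Hn]. assert (Hp := proj1 (Cmod_gt_0 _) Hn).
    destruct (proj1 (continuous_CC_eps _ _) Hc (Cmod (g (u, v)) / 4) ltac:(lra)) as [d [Hd K]].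
    assert (Hd4 : 0 < d / 4) by lra.
    exists (mkposreal _ Hd4). simpl. intros _ w H1 H2. apply K.
    eapply Rle_lt_trans; [apply Cmod_le_abs|].
    change (Rabs (fst w - u) + Rabs (snd w - v) < d). lra.
  - exists (mkposreal 1 Rlt_0_1). easy. }
set (delta := fun u v => proj1_sig (constructive_indefinite_description _ (HD u v))).
assert (Hdelta : forall u v, in_rect a b c e (u, v) ->
  forall w : C, Rabs (fst w - u) < 2 * delta u v -> Rabs (snd w - v) < 2 * delta u v ->
  Cmod (g w - g (u, v)) < Cmod (g (u, v)) / 4).
{ intros u v. exact (proj2_sig (constructive_indefinite_description _ (HD u v))). }
destruct (compactness_value_2d a b c e delta) as [d Hd].
exists d. split; [apply cond_pos|]. intros w w' Hw Hw' H1 H2.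
destruct (NNPP _ (Hd (fst w) (snd w) (proj1 Hw) (proj2 Hw))) as [u [v [Hu [Hv [K1 [K2 K3]]]]]].
assert (P := cond_pos (delta u v)).
apply ratio_Re_pos with (g (u, v)); (apply Hdelta; [split; simpl; trivial| |]); try lra.
- replace (fst w' - u) with ((fst w' - fst w) + (fst w - u)) by ring.
  eapply Rle_lt_trans; [apply Rabs_triang|]. lra.
- replace (snd w' - v) with ((snd w' - snd w) + (snd w - v)) by ring.
  eapply Rle_lt_trans; [apply Rabs_triang|]. lra.
Qed.

(* [L w] sums principal logarithms of ratios of [g] at consecutive points of a
   subdivision of the segment from [w0] to [w], fine enough that every ratio has
   positive real part. *)
Lemma rect_lift (g : C -> C) a b c e w0 l0 : in_rect a b c e w0 -> Cexp l0 = g w0 ->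
  (forall w, in_rect a b c e w -> continuous g w /\ g w <> RtoC 0) ->
  exists L : C -> C, L w0 = l0 /\
    forall w, in_rect a b c e w -> continuous L w /\ Cexp (L w) = g w.
Proof.
intros Hw0 Hl0 Hg.
destruct (uniform_ratio g a b c e Hg) as [eta [Heta Hr]].
set (D := Rabs (b - a) + Rabs (e - c) + 1).
assert (HD : 0 < D).
{ assert (A1 := Rabs_pos (b - a)). assert (A2 := Rabs_pos (e - c)). unfold D. lra. }
(* [D] exceeds both sides of the rectangle, so more than [D / eta] pieces put consecutive points of
   any segment within [eta] in each coordinate. *)
destruct (archimed_cor1 (eta / D)) as [N [HN1 HN2]]; [now apply Rdiv_lt_0_compat|].
destruct N as [|M]; [lia|]. clear HN2. set (n := INR (S M)) in *.
assert (Hn : 0 < n) by (apply lt_0_INR; lia).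
set (q := fun (j : nat) w => (g (seg w0 w (INR (S j) / n)) / g (seg w0 w (INR j / n)))%C).
set (T := fun m w => sum_n (fun j => Clog (q j w)) m).
assert (Hj : forall j, (j <= S M)%nat -> 0 <= INR j / n <= 1).
{ intros j Hj. split; [apply Rdiv_le_0_compat; trivial; apply pos_INR|].
  apply Rmult_le_reg_r with n; [exact Hn|]. unfold Rdiv. rewrite Rmult_assoc, Rinv_l by lra.
  assert (K := le_INR _ _ Hj). unfold n. lra. }
assert (Hin : forall j w, (j <= S M)%nat -> in_rect a b c e w ->
  in_rect a b c e (seg w0 w (INR j / n))).
{ intros j w H1 H2. apply in_rect_seg; auto. }
assert (Hq : forall j w, (j <= M)%nat -> in_rect a b c e w -> 0 < Re (q j w)).
{ intros j w H1 H2. apply Hr; try (apply Hin; trivial; lia).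
  - rewrite !seg_coord, (S_INR j). cbn [fst snd].
    match goal with |- Rabs ?x < _ =>
      replace x with (/ n * (fst w - fst w0)) by (field; lra) end.
    rewrite Rabs_mult, Rabs_pos_eq by (apply Rlt_le, Rinv_0_lt_compat; lra).
    assert (K : Rabs (fst w - fst w0) <= D).
    { unfold D. assert (A1 := Rabs_pos (b - a)). assert (A2 := Rabs_pos (e - c)).
      assert (A3 := Rle_abs (b - a)). destruct H2, Hw0. apply Rabs_le. lra. }
    apply Rle_lt_trans with (/ n * D).
    + apply Rmult_le_compat_l; trivial. apply Rlt_le, Rinv_0_lt_compat; lra.
    + apply Rmult_lt_reg_r with (/ D); [now apply Rinv_0_lt_compat|].
      rewrite Rmult_assoc, Rinv_r by lra. unfold Rdiv in HN1. lra.
  - rewrite !seg_coord, (S_INR j). cbn [fst snd].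
    match goal with |- Rabs ?x < _ =>
      replace x with (/ n * (snd w - snd w0)) by (field; lra) end.
    rewrite Rabs_mult, Rabs_pos_eq by (apply Rlt_le, Rinv_0_lt_compat; lra).
    assert (K : Rabs (snd w - snd w0) <= D).
    { unfold D. assert (A1 := Rabs_pos (b - a)). assert (A2 := Rabs_pos (e - c)).
      assert (A3 := Rle_abs (e - c)). destruct H2, Hw0. apply Rabs_le. lra. }
    apply Rle_lt_trans with (/ n * D).
    + apply Rmult_le_compat_l; trivial. apply Rlt_le, Rinv_0_lt_compat; lra.
    + apply Rmult_lt_reg_r with (/ D); [now apply Rinv_0_lt_compat|].
      rewrite Rmult_assoc, Rinv_r by lra. unfold Rdiv in HN1. lra. }
assert (Hgc : forall j w, (j <= S M)%nat -> in_rect a b c e w ->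
  continuous (fun w => g (seg w0 w (INR j / n))) w).
{ intros j w H1 H2. apply (continuous_comp (fun w => seg w0 w (INR j / n)) g).
  - apply continuous_seg_w.
  - apply Hg, Hin; trivial. }
assert (HTc : forall m w, (m <= M)%nat -> in_rect a b c e w -> continuous (T m) w).
{ assert (H1 : forall j w, (j <= M)%nat -> in_rect a b c e w ->
    continuous (fun w => Clog (q j w)) w).
  { intros j w H1 H2. apply continuous_Clog; [now apply Hq|].
    apply continuous_Cmult; [apply Hgc; trivial; lia|].
    apply continuous_Cinv; [apply Hg, Hin; trivial; lia|]. apply Hgc; trivial; lia. }
  intros m w Hm Hw. unfold T. induction m as [|m IH].
  - apply (continuous_ext (fun w => Clog (q 0%nat w))); [|apply H1; trivial; lia].
    intros z. now rewrite csum_O.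
  - apply (continuous_ext (fun w => sum_n (fun j => Clog (q j w)) m + Clog (q (S m) w))%C).
    { intros z. now rewrite csum_S. }
    apply continuous_Cplus; [apply IH; lia|apply H1; trivial; lia]. }
assert (HTe : forall m w, (m <= M)%nat -> in_rect a b c e w ->
  Cexp (T m w) = (g (seg w0 w (INR (S m) / n)) / g w0)%C).
{ intros m w Hm Hw. unfold T. induction m as [|m IH].
  - rewrite csum_O, Cexp_Clog by (apply Hq; trivial; lia). unfold q.
    replace (INR 0 / n) with 0 by (simpl; field; lra). now rewrite seg_0.
  - rewrite csum_S, Cexp_plus, IH by lia.
    rewrite Cexp_Clog by (apply Hq; trivial; lia). unfold q. field.
    split; [apply Hg; trivial|apply Hg, Hin; trivial; lia]. }
assert (H1n : INR (S M) / n = 1) by (unfold n; field; unfold n in Hn; lra).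
(* Subtracting the value at [w0] gives the prescribed value [l0] there by pure algebra. The
   exponential is not disturbed, because [HTe] at [w0] reads 1. *)
exists (fun w => T M w - T M w0 + l0)%C. split; [ring|].
intros w Hw. split.
- apply continuous_Cplus; [|apply continuous_const].
  apply continuous_Cminus; [apply HTc; trivial|apply continuous_const].
- rewrite Cexp_plus, Cexp_minus, !HTe, Hl0, H1n, !seg_1 by trivial.
  field. apply Hg; trivial.
Qed.

(** Rectangles exhausting the half plane share the point [w0], at which all their logarithms take
    the value [l0]; uniqueness along segments makes them agree on overlaps. The inequality is strict
    in the conclusion because continuity needs a full neighbourhood inside the half plane. *)
Lemma half_plane_lift (g : C -> C) s :
  (forall w, s <= Re w -> continuous g w /\ g w <> RtoC 0) ->
  exists L : C -> C, forall w, s < Re w -> continuous L w /\ Cexp (L w) = g w.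
Proof.
intros Hg. set (w0 := (s, 0) : C).
destruct (Cexp_surj (g w0)) as [l0 Hl0]; [apply Hg; simpl; lra|].
set (rect := fun n : nat => in_rect s (s + INR n) (- INR n) (INR n)).
assert (Hw0 : forall n, rect n w0).
{ intros n. unfold rect, in_rect, w0; simpl. assert (K := pos_INR n). lra. }
assert (Hex : forall n, exists L : C -> C, L w0 = l0 /\
    forall w, rect n w -> continuous L w /\ Cexp (L w) = g w).
{ intros n. apply rect_lift; trivial; [apply Hw0|].
  intros w [Hw _]. apply Hg. apply Hw. }
set (Ln := fun n => proj1_sig (constructive_indefinite_description _ (Hex n))).
assert (HLn : forall n, Ln n w0 = l0 /\
    forall w, rect n w -> continuous (Ln n) w /\ Cexp (Ln n w) = g w).
{ intros n. exact (proj2_sig (constructive_indefinite_description _ (Hex n))). }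
assert (Hag : forall n m w, rect n w -> rect m w -> Ln n w = Ln m w).
{ intros n m w H1 H2. destruct (HLn n) as [A1 A2]. destruct (HLn m) as [B1 B2].
  assert (K := lift_unique_seg (Ln n) (Ln m) w0 w).
  rewrite A1, B1 in K. apply Ceq_minus. rewrite K; [ring|].
  intros t Ht.
  assert (R1 : rect n (seg w0 w t)) by (apply in_rect_seg; trivial; apply Hw0).
  assert (R2 : rect m (seg w0 w t)) by (apply in_rect_seg; trivial; apply Hw0).
  destruct (A2 _ R1) as [C1 E1]. destruct (B2 _ R2) as [C2 E2].
  split; [|split]; trivial. now rewrite E1, E2. }
assert (Hcov : forall w, s <= Re w -> exists n, rect n w).
{ intros w Hw. destruct (INR_unbounded (Cmod w + Rabs s)) as [n Hn].
  exists n. unfold rect, in_rect. assert (A1 := re_le_Cmod w). assert (A2 := im_le_Cmod w).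
  assert (A3 := Rabs_pos s). assert (A4 := Rle_abs (- s)). rewrite Rabs_Ropp in A4.
  unfold Re, Im in *. apply Rabs_le_between in A1. apply Rabs_le_between in A2. lra. }
set (L := fun w => Ln (epsilon (inhabits 0%nat) (fun n => rect n w)) w).
assert (HL : forall n w, rect n w -> L w = Ln n w).
{ intros n w Hn. unfold L. apply Hag; trivial.
  apply (epsilon_spec (inhabits 0%nat) (fun n => rect n w)). now exists n. }
exists L. intros w Hw. destruct (Hcov w (Rlt_le _ _ Hw)) as [n Hn].
(* The next rectangle contains every point within distance 1 of [w] that stays to the right of [s],
   so [L] coincides with [Ln (S n)] near [w]. *)
assert (Hn1 : rect (S n) w).
{ unfold rect, in_rect in *. rewrite S_INR. lra. }
destruct (HLn (S n)) as [_ A2]. destruct (A2 w Hn1) as [C1 E1].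
split.
- apply (continuous_ext_loc _ (Ln (S n))); [|exact C1].
  apply locally_Cmod. exists (Rmin 1 (Re w - s)). split; [apply Rmin_pos; lra|].
  intros z Hz. symmetry. apply HL.
  assert (M1 := Rmin_l 1 (Re w - s)). assert (M2 := Rmin_r 1 (Re w - s)).
  assert (B1 := re_le_Cmod (z - w)). assert (B2 := im_le_Cmod (z - w)).
  apply Rabs_le_between in B1. apply Rabs_le_between in B2.
  change (Re (z - w)) with (fst z - fst w) in B1. change (Im (z - w)) with (snd z - snd w) in B2.
  unfold rect, in_rect in *. rewrite S_INR. unfold Re in *. lra.
- now rewrite (HL (S n)).
Qed.

(** * Polynomials *)

Definition cpoly (c : nat -> C) (n : nat) (z : C) : C := sum_n (fun i => c i * z ^ i)%C n.

Lemma cpoly_S c n z : cpoly c (S n) z = (cpoly c n z + c (S n) * z ^ S n)%C.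
Proof. apply csum_S. Qed.

Lemma cpoly_0 c z : cpoly c 0 z = c 0%nat.
Proof. unfold cpoly. rewrite csum_O. apply Cmult_1_r. Qed.

Lemma cpoly_split c n z :
  cpoly c (S n) z = (c 0%nat + z * cpoly (fun i => c (S i)) n z)%C.
Proof.
induction n as [|n IH].
- rewrite cpoly_S, !cpoly_0. simpl. ring.
- rewrite cpoly_S, IH, (cpoly_S (fun i => c (S i))). rewrite (Cpow_S z (S n)). ring.
Qed.

Lemma cpoly_pad c n N z : (n <= N)%nat -> (forall i, (n < i)%nat -> c i = RtoC 0) ->
  cpoly c N z = cpoly c n z.
Proof.
intros Hn Hc. induction N as [|N IH]; [now replace n with 0%nat by lia|].
destruct (Nat.eq_dec n (S N)) as [->|H]; [easy|].
rewrite cpoly_S, IH, Hc by lia. ring.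
Qed.

Lemma is_polynomial_poly c n : is_polynomial (cpoly c n).
Proof. exists n, c. easy. Qed.

Lemma is_polynomial_ext p q : (forall z, p z = q z) -> is_polynomial p -> is_polynomial q.
Proof. intros H [n [c Hp]]. exists n, c. intros z. now rewrite <- H. Qed.

(** [is_polynomial] says nothing about coefficients beyond [n]; setting them to 0 lets two
    polynomials be padded to the same length. *)
Lemma is_polynomial_normal p : is_polynomial p -> exists n c,
  (forall i, (n < i)%nat -> c i = RtoC 0) /\ forall z, p z = cpoly c n z.
Proof.
intros [n [c Hp]].
exists n, (fun i => if Compare_dec.le_dec i n then c i else RtoC 0). split.
- intros i Hi. destruct Compare_dec.le_dec; [lia|easy].
- intros z. rewrite Hp. apply csum_ext. intros k Hk.
  destruct Compare_dec.le_dec; [easy|lia].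
Qed.

Lemma is_polynomial_const a : is_polynomial (fun _ => a).
Proof. exists 0%nat, (fun _ => a). intros z. rewrite csum_O. simpl. ring. Qed.

Lemma cpoly_plus c d n z : cpoly (fun i => c i + d i)%C n z = (cpoly c n z + cpoly d n z)%C.
Proof.
induction n as [|n IH]; [now rewrite !cpoly_0|]. rewrite !cpoly_S, IH. ring.
Qed.

Lemma is_polynomial_plus p q : is_polynomial p -> is_polynomial q ->
  is_polynomial (fun z => p z + q z)%C.
Proof.
intros Hp Hq. destruct (is_polynomial_normal p Hp) as [n [c [Hc Ec]]].
destruct (is_polynomial_normal q Hq) as [m [d [Hd Ed]]].
exists (Nat.max n m), (fun i => c i + d i)%C. intros z.
rewrite Ec, Ed, <- (cpoly_pad c n (Nat.max n m)), <- (cpoly_pad d m (Nat.max n m)) by (trivial; lia).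
symmetry. apply cpoly_plus.
Qed.

Lemma is_polynomial_horner a p : is_polynomial p -> is_polynomial (fun z => a + z * p z)%C.
Proof.
intros [n [c Hp]].
exists (S n), (fun i => match i with O => a | S i => c i end). intros z.
rewrite Hp. symmetry. apply (cpoly_split (fun i => match i with O => a | S i => c i end)).
Qed.

(** Induction along Horner's scheme: closure properties only need to be checked on [a + z * p z].
    The first premise makes the property insensitive to the way the function is written. *)
Lemma is_polynomial_ind (Pr : (C -> C) -> Prop) :
  (forall p q, (forall z, p z = q z) -> Pr p -> Pr q) ->
  (forall a, Pr (fun _ => a)) ->
  (forall a p, is_polynomial p -> Pr p -> Pr (fun z => a + z * p z)%C) ->
  forall p, is_polynomial p -> Pr p.
Proof.
intros He Ha Hs p [n [c Hp]]. revert p c Hp. induction n as [|n IH]; intros p c Hp.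
- apply (He (fun _ => c 0%nat)); [|apply Ha]. intros z. rewrite Hp. symmetry. apply cpoly_0.
- apply (He (fun z => c 0%nat + z * cpoly (fun i => c (S i)) n z)%C).
  + intros z. rewrite Hp. symmetry. apply cpoly_split.
  + apply Hs; [apply is_polynomial_poly|]. now apply (IH _ (fun i => c (S i))).
Qed.

Lemma is_polynomial_scal a p : is_polynomial p -> is_polynomial (fun z => a * p z)%C.
Proof.
revert p. apply is_polynomial_ind.
- intros p q H. apply is_polynomial_ext. intros z. now rewrite H.
- intros b. apply is_polynomial_const.
- intros b p _ H. apply is_polynomial_ext with (fun z => a * b + z * (a * p z))%C.
  + intros z. ring.
  + now apply is_polynomial_horner.
Qed.

Lemma is_polynomial_mult p q : is_polynomial p -> is_polynomial q ->
  is_polynomial (fun z => p z * q z)%C.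
Proof.
intros Hp Hq. revert p Hp. apply is_polynomial_ind.
- intros p p' H. apply is_polynomial_ext. intros z. now rewrite H.
- intros b. now apply is_polynomial_scal.
- intros b p _ H.
  apply is_polynomial_ext with (fun z => b * q z + (RtoC 0 + z * (p z * q z)))%C.
  + intros z. ring.
  + apply is_polynomial_plus; [now apply is_polynomial_scal|].
    now apply (is_polynomial_horner (RtoC 0) (fun z => p z * q z)%C).
Qed.

Lemma is_polynomial_minus p q : is_polynomial p -> is_polynomial q ->
  is_polynomial (fun z => p z - q z)%C.
Proof.
intros Hp Hq. apply is_polynomial_ext with (fun z => p z + (- RtoC 1) * q z)%C.
- intros z. ring.
- apply is_polynomial_plus; trivial. now apply is_polynomial_scal.
Qed.

Lemma is_polynomial_shift b p : is_polynomial p -> is_polynomial (fun z => p (z + b)%C).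
Proof.
revert p. apply is_polynomial_ind.
- intros p q H. apply is_polynomial_ext. intros z. now rewrite H.
- intros a. apply is_polynomial_const.
- intros a p _ H. apply is_polynomial_ext with
    (fun z => (a + z * p (z + b)) + b * p (z + b))%C.
  + intros z. ring.
  + apply is_polynomial_plus; [now apply is_polynomial_horner|now apply is_polynomial_scal].
Qed.

Lemma is_polynomial_deriv p : is_polynomial p ->
  exists q, is_polynomial q /\ forall z, cderiv p z (q z).
Proof.
revert p. apply is_polynomial_ind.
- intros p p' H [q [Hq Hd]]. exists q. split; trivial.
  intros z. now apply cderiv_ext with p.
- intros a. exists (fun _ => RtoC 0). split; [apply is_polynomial_const|].
  intros z. apply cderiv_const.
- intros a p Hp [q [Hq Hd]]. exists (fun z => p z + (RtoC 0 + z * q z))%C. split.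
  + apply is_polynomial_plus; trivial. now apply is_polynomial_horner.
  + intros z.
    replace (p z + (RtoC 0 + z * q z))%C with (RtoC 0 + (RtoC 1 * p z + z * q z))%C by ring.
    apply cderiv_plus; [apply cderiv_const|].
    apply cderiv_mult; [apply cderiv_id|apply Hd].
Qed.

Lemma cpoly_growth c n : exists K, 0 <= K /\ forall z, 1 <= Cmod z ->
  Cmod (cpoly c n z) <= K * Cmod z ^ n.
Proof.
induction n as [|n [K [HK H]]].
- exists (Cmod (c 0%nat)). split; [apply Cmod_ge_0|]. intros z _. rewrite cpoly_0. simpl. lra.
- exists (K + Cmod (c (S n))). assert (A1 := Cmod_ge_0 (c (S n))). split; [lra|].
  intros z Hz. rewrite cpoly_S. eapply Rle_trans; [apply Cmod_triangle|].
  rewrite Cmod_mult, Cmod_pow, Rmult_plus_distr_r. apply Rplus_le_compat_r.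
  eapply Rle_trans; [now apply H|]. apply Rmult_le_compat_l; trivial.
  apply Rle_pow; trivial. lia.
Qed.

(* The factor [r] shifts the exponent by one, so that [m = 0] expresses decay
   to 0 along the ray and kills all coefficients. *)
Lemma cpoly_ray_coefs (c : nat -> C) (n m : nat) (v : C) (K : R) : v <> RtoC 0 ->
  (forall A, exists r, A < r /\ r * Cmod (cpoly c n (RtoC r * v)) <= K * r ^ m) ->
  forall i, (m <= i <= n)%nat -> c i = RtoC 0.
Proof.
intros Hv H. assert (Hvp := proj1 (Cmod_gt_0 _) Hv).
induction n as [|n IH].
- intros i Hi. replace i with 0%nat by lia.
  apply Cmod_eq_0, Rle_antisym; [|apply Cmod_ge_0]. apply Rnot_lt_le. intros Hpos.
  destruct (H (Rmax 1 (K / Cmod (c 0%nat)))) as [r [Hr Hle]].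
  replace m with 0%nat in Hle by lia. rewrite cpoly_0 in Hle. simpl in Hle.
  assert (A1 := Rmax_r 1 (K / Cmod (c 0%nat))).
  assert (A2 : K / Cmod (c 0%nat) < r) by lra.
  apply (Rmult_lt_compat_r (Cmod (c 0%nat))) in A2; trivial.
  unfold Rdiv in A2. rewrite Rmult_assoc, Rinv_l in A2 by lra. lra.
- assert (HS : (m <= S n)%nat -> c (S n) = RtoC 0).
  { intros Hm. apply Cmod_eq_0, Rle_antisym; [|apply Cmod_ge_0]. apply Rnot_lt_le. intros Hpos.
    destruct (cpoly_growth c n) as [K1 [HK1 Hg]].
    set (a := Cmod (c (S n)) * Cmod v ^ S n).
    assert (Ha : 0 < a) by (apply Rmult_lt_0_compat; trivial; now apply pow_lt).
    set (K2 := Rabs K + K1 * Cmod v ^ n).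
    destruct (H (Rmax (Rmax 1 (/ Cmod v)) (K2 / a))) as [r [Hr Hle]].
    assert (A1 := Rmax_r (Rmax 1 (/ Cmod v)) (K2 / a)).
    assert (A2 := Rmax_l (Rmax 1 (/ Cmod v)) (K2 / a)).
    assert (A3 := Rmax_l 1 (/ Cmod v)). assert (A4 := Rmax_r 1 (/ Cmod v)).
    assert (Hr1 : 1 < r) by lra.
    assert (Hmod : Cmod (RtoC r * v) = r * Cmod v).
    { rewrite Cmod_mult, Cmod_R, Rabs_pos_eq; lra. }
    assert (Hz : 1 <= Cmod (RtoC r * v)).
    { rewrite Hmod. apply Rmult_le_reg_r with (/ Cmod v); [now apply Rinv_0_lt_compat|].
      rewrite Rmult_assoc, Rinv_r by lra. lra. }
    specialize (Hg _ Hz). rewrite Hmod, Rpow_mult_distr in Hg.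
    assert (E : (c (S n) * (RtoC r * v) ^ S n =
      cpoly c (S n) (RtoC r * v) - cpoly c n (RtoC r * v))%C) by (rewrite cpoly_S; ring).
    assert (E2 : a * r ^ S n <= Cmod (cpoly c (S n) (RtoC r * v)) + K1 * (r ^ n * Cmod v ^ n)).
    { replace (a * r ^ S n) with (Cmod (c (S n) * (RtoC r * v) ^ S n)).
      - rewrite E. eapply Rle_trans; [apply Cmod_triangle|]. rewrite Cmod_opp. lra.
      - rewrite Cmod_mult, Cmod_pow, Hmod, Rpow_mult_distr. unfold a. ring. }
    assert (Hrn : 0 < r ^ n) by (apply pow_lt; lra).
    assert (E3 : K * r ^ m <= Rabs K * (r * r ^ n)).
    { change (r * r ^ n) with (r ^ S n). apply Rle_trans with (Rabs K * r ^ m).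
      - apply Rmult_le_compat_r; [apply pow_le; lra|apply Rle_abs].
      - apply Rmult_le_compat_l; [apply Rabs_pos|]. apply Rle_pow; trivial. lra. }
    assert (E4 : r * (a * r ^ S n) <= r * (K2 * r ^ n)).
    { apply Rle_trans with (r * (Cmod (cpoly c (S n) (RtoC r * v)) + K1 * (r ^ n * Cmod v ^ n))).
      - apply Rmult_le_compat_l; lra.
      - unfold K2. nra. }
    apply Rmult_le_reg_l in E4; [|lra]. simpl in E4.
    assert (E5 : a * r <= K2).
    { apply Rmult_le_reg_r with (r ^ n); lra. }
    assert (E6 : K2 / a < r) by lra.
    apply (Rmult_lt_compat_r a) in E6; trivial.
    unfold Rdiv in E6. rewrite Rmult_assoc, Rinv_l in E6 by lra. lra. }
  intros i Hi. destruct (Nat.eq_dec i (S n)) as [->|Hn]; [apply HS; lia|].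
  apply IH; [|lia]. intros A. destruct (H A) as [r [Hr Hle]]. exists r. split; trivial.
  rewrite cpoly_S, HS in Hle by lia.
  replace (cpoly c n (RtoC r * v)) with (cpoly c n (RtoC r * v) + RtoC 0 * (RtoC r * v) ^ S n)%C
    by ring. exact Hle.
Qed.

Lemma cpoly_zero_coefs c n z : (forall i, (i <= n)%nat -> c i = RtoC 0) -> cpoly c n z = RtoC 0.
Proof. intros H. apply csum_zero. intros k Hk. rewrite H by exact Hk. ring. Qed.

Lemma is_polynomial_ray_zero p v K : is_polynomial p -> v <> RtoC 0 ->
  (forall A, exists r, A < r /\ r * Cmod (p (RtoC r * v)%C) <= K) ->
  forall z, p z = RtoC 0.
Proof.
intros [n [c Hp]] Hv H z. rewrite Hp. apply cpoly_zero_coefs.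
intros i Hi. apply (cpoly_ray_coefs c n 0 v K Hv); [|lia].
intros A. destruct (H A) as [r [Hr Hle]]. exists r. split; trivial. rewrite Hp in Hle.
simpl. rewrite Rmult_1_r. exact Hle.
Qed.

Lemma is_polynomial_bounded p K : is_polynomial p -> (forall z, Cmod (p z) <= K) ->
  forall z, p z = p (RtoC 0).
Proof.
intros [n [c Hp]] H.
assert (Hz : forall i, (1 <= i <= n)%nat -> c i = RtoC 0).
{ apply (cpoly_ray_coefs c n 1 (RtoC 1) K C1_nz). intros A. exists (Rmax A 0 + 1).
  assert (A1 := Rmax_l A 0). assert (A2 := Rmax_r A 0). split; [lra|].
  rewrite pow_1, Rmult_comm. apply Rmult_le_compat_r; [lra|].
  specialize (H (RtoC (Rmax A 0 + 1) * RtoC 1)%C). now rewrite Hp in H. }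
assert (E : forall z, p z = c 0%nat).
{ intros z. rewrite Hp. rewrite (csum_single _ n 0); try lia.
  - simpl. ring.
  - intros k Hk1 Hk2. rewrite Hz by lia. ring. }
intros z. now rewrite !E.
Qed.

(** * Entire functions of polynomial growth *)

Lemma cis_pow (n : nat) t : (cis 1 t ^ n)%C = cis (Z.of_nat n) t.
Proof.
induction n as [|n IH]; [simpl; now rewrite cis_0|].
rewrite Cpow_S, IH, <- cis_plus. f_equal. lia.
Qed.

Lemma exp_INR_mult (n : nat) x : exp (INR n * x) = exp x ^ n.
Proof.
induction n as [|n IH]; [simpl; rewrite Rmult_0_l; apply exp_0|].
rewrite S_INR, Rmult_plus_distr_r, exp_plus, IH, Rmult_1_l. simpl. ring.
Qed.

Lemma Cexp_polar_pow x t (n : nat) :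
  (Cexp (x, t) ^ n)%C = (RtoC (exp (INR n * x)) * cis (Z.of_nat n) t)%C.
Proof. now rewrite Cexp_polar, Cpow_mult_l, cis_pow, exp_INR_mult, RtoC_pow. Qed.

Lemma fcoef_poly_circle (h : Z -> C) (N : nat) x n :
  fcoef (fun t => cpoly (fun i => h (Z.of_nat i)) N (Cexp (x, t))) n =
  if Z_le_gt_dec 0 n then
    if Z_le_gt_dec n (Z.of_nat N) then (RtoC (exp (IZR n * x)) * h n)%C else RtoC 0
  else RtoC 0.
Proof.
rewrite (fcoef_ext _ (fun t => sum_n (fun i => (h (Z.of_nat i) * RtoC (exp (INR i * x))) *
  cis (Z.of_nat i) t)%C N)).
2: { intros t. apply csum_ext. intros i _. rewrite Cexp_polar_pow. ring. }
rewrite (fcoef_csum (fun i t => (h (Z.of_nat i) * RtoC (exp (INR i * x))) *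
  cis (Z.of_nat i) t)%C).
2: { intros i _. apply ccont_on_mult; [apply ccont_on_const|]. intros t _. apply continuous_cis. }
destruct (Z_le_gt_dec 0 n) as [H0|H0]; [destruct (Z_le_gt_dec n (Z.of_nat N)) as [H1|H1]|].
- rewrite (csum_single _ N (Z.to_nat n)); [|lia|].
  + rewrite (fcoef_cis (h (Z.of_nat (Z.to_nat n)) * RtoC (exp (INR (Z.to_nat n) * x)))%C).
    rewrite Z2Nat.id by lia. destruct (Z.eq_dec n n); [|easy].
    rewrite INR_IZR_INZ, Z2Nat.id by lia. ring.
  + intros k _ Hk. rewrite (fcoef_cis (h (Z.of_nat k) * RtoC (exp (INR k * x)))%C).
    destruct (Z.eq_dec (Z.of_nat k) n); [lia|easy].
- apply csum_zero. intros k Hk. rewrite (fcoef_cis (h (Z.of_nat k) * RtoC (exp (INR k * x)))%C).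
  destruct (Z.eq_dec (Z.of_nat k) n); [lia|easy].
- apply csum_zero. intros k Hk. rewrite (fcoef_cis (h (Z.of_nat k) * RtoC (exp (INR k * x)))%C).
  destruct (Z.eq_dec (Z.of_nat k) n); [lia|easy].
Qed.

Definition holo (F : C -> C) : Prop := forall z, exists l, cderiv F z l.

Lemma holo_continuous F z : holo F -> continuous F z.
Proof. intros H. destruct (H z) as [l Hl]. now apply cderiv_continuous in Hl. Qed.

Lemma holo_poly p : is_polynomial p -> holo p.
Proof. intros H z. destruct (is_polynomial_deriv p H) as [q [_ Hq]]. now exists (q z). Qed.

Lemma holo_mult F G : holo F -> holo G -> holo (fun z => F z * G z)%C.
Proof.
intros HF HG z. destruct (HF z) as [l Hl]. destruct (HG z) as [m Hm].
eexists. now apply cderiv_mult; [exact Hl|exact Hm].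
Qed.

Lemma holo_comp F G : holo F -> holo G -> holo (fun z => F (G z)).
Proof.
intros HF HG z. destruct (HF (G z)) as [l Hl]. destruct (HG z) as [m Hm].
eexists. now apply cderiv_comp; [exact Hl|exact Hm].
Qed.

Lemma holo_Cexp : holo Cexp.
Proof. intros z. eexists. apply cderiv_Cexp. Qed.

Lemma continuous_circle (F : C -> C) x t : holo F -> continuous (fun t => F (Cexp (x, t))) t.
Proof.
intros H. apply (continuous_comp (fun t => Cexp (x, t)) F); [|now apply holo_continuous].
apply continuous_vpath, continuous_Cexp.
Qed.

(** [F] is bounded near 0, that is for [x] tending to minus infinity, whereas [exp (n * x)] blows up
    there when [n] is negative; hence the principal part vanishes. *)
Lemma entire_coefs F : holo F ->
  exists h : Z -> C, (forall n, (n < 0)%Z -> h n = RtoC 0) /\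
  forall n x, fcoef (fun t => F (Cexp (x, t))) n = (RtoC (exp (IZR n * x)) * h n)%C.
Proof.
intros HF. set (G := fun w => F (Cexp w)).
assert (HG : forall s, holo_on s G).
{ intros s z _. exact (holo_comp F Cexp HF holo_Cexp z). }
assert (Hp : forall s, periodic_on s G).
{ intros s x y _. unfold G. now rewrite Cexp_period. }
set (c := fun x n => fcoef (fun t => F (Cexp (x, t))) n).
assert (Hc : forall x1 x2 n, (RtoC (exp (- IZR n * x2)) * c x2 n =
   RtoC (exp (- IZR n * x1)) * c x1 n)%C).
{ assert (Hle : forall x1 x2 n, x1 <= x2 -> (RtoC (exp (- IZR n * x2)) * c x2 n =
   RtoC (exp (- IZR n * x1)) * c x1 n)%C).
  { intros x1 x2 n H. now apply (fcoef_holo_eq x1 G n x1 x2); trivial; lra. }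
  intros x1 x2 n. destruct (Rle_lt_dec x1 x2) as [H|H]; [now apply Hle|].
  symmetry. apply Hle. lra. }
assert (Hx : forall n x, c x n = (RtoC (exp (IZR n * x)) * c 0 n)%C).
{ intros n x. specialize (Hc x 0 n). rewrite Rmult_0_r, exp_0, Cmult_1_l in Hc.
  rewrite Hc, Cmult_assoc, <- RtoC_mult, <- exp_plus.
  replace (IZR n * x + - IZR n * x) with 0 by ring. rewrite exp_0. ring. }
exists (c 0). split; [|exact Hx].
intros n Hn. apply Cmod_eq_0, Rle_antisym; [|apply Cmod_ge_0].
apply Rnot_lt_le. intros Hpos.
destruct (proj1 (continuous_CC_eps _ _) (holo_continuous F (RtoC 0) HF) 1 Rlt_0_1) as [d [Hd H]].
set (M := Cmod (F (RtoC 0)) + 1). assert (HM : 0 < M).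
{ unfold M. assert (K := Cmod_ge_0 (F (RtoC 0))). lra. }
(* The first term puts the circle inside the disc where [F] is bounded by [M]. The second, through
   [n * x >= - x], makes [exp (n * x)] exceed [M / |c 0 n|]. *)
set (x := Rmin (ln (d / 2)) (- (M / Cmod (c 0 n)))).
assert (Hb : Cmod (c x n) <= M).
{ apply fcoef_bound.
  - intros t _. now apply continuous_circle.
  - intros t _. assert (K : Cmod (Cexp (x, t) - RtoC 0) < d).
    { replace (Cexp (x, t) - RtoC 0)%C with (Cexp (x, t)) by ring.
      rewrite Cmod_Cexp. simpl. apply Rle_lt_trans with (exp (ln (d / 2))).
      - apply exp_le, Rmin_l.
      - rewrite exp_ln; lra. }
    apply H in K. replace (F (Cexp (x, t))) with ((F (Cexp (x, t)) - F (RtoC 0)) + F (RtoC 0))%C by ring.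
    eapply Rle_trans; [apply Cmod_triangle|]. unfold M. lra. }
rewrite Hx, Cmod_mult, Cmod_R, Rabs_pos_eq in Hb by apply Rlt_le, exp_pos.
assert (Hnx : - x <= IZR n * x).
{ assert (IZR n <= -1) by (apply IZR_le; lia).
  assert (x <= 0).
  { unfold x. eapply Rle_trans; [apply Rmin_r|].
    assert (0 < M / Cmod (c 0 n)) by now apply Rdiv_lt_0_compat. lra. }
  nra. }
assert (Hex : M / Cmod (c 0 n) < exp (IZR n * x)).
{ assert (A := Rmin_r (ln (d / 2)) (- (M / Cmod (c 0 n)))). fold x in A.
  assert (0 < M / Cmod (c 0 n)) by now apply Rdiv_lt_0_compat.
  assert (B := exp_ineq1 (IZR n * x) ltac:(lra)). lra. }
apply (Rmult_lt_compat_r (Cmod (c 0 n))) in Hex; trivial.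
unfold Rdiv in Hex. rewrite Rmult_assoc, Rinv_l in Hex by lra. lra.
Qed.

(** [fourier_bound] with bound 0 gives vanishing on every circle about 0; the centre follows by
    continuity. *)
Lemma fcoef_zero_circle F : holo F ->
  (forall n x, fcoef (fun t => F (Cexp (x, t))) n = RtoC 0) -> forall z, F z = RtoC 0.
Proof.
intros HF H.
assert (Hn : forall z, z <> RtoC 0 -> F z = RtoC 0).
{ intros z Hz. destruct (Cexp_surj_2PI z Hz) as [x [t [E Ht]]].
  apply Cmod_eq_0, Rle_antisym; [|apply Cmod_ge_0]. rewrite <- E.
  apply (fourier_bound (fun t => F (Cexp (x, t)))); trivial.
  - intros u. now apply continuous_circle.
  - intros u. now rewrite Cexp_period.
  - intros N k _. eapply Rle_trans; [apply (rsum_const_le _ N 0)|lra].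
    intros j _. rewrite H, Cmod_0. lra. }
intros z. destruct (Ceq_dec z (RtoC 0)) as [->|Hz]; [|now apply Hn].
apply Cmod_eq_0, Rle_antisym; [|apply Cmod_ge_0]. apply Rnot_lt_le. intros Hpos.
destruct (proj1 (continuous_CC_eps _ _) (holo_continuous F (RtoC 0) HF) _ Hpos) as [d [Hd K]].
specialize (K (RtoC (d / 2))). rewrite Hn in K.
- replace (RtoC 0 - F (RtoC 0))%C with (- F (RtoC 0))%C in K by ring. rewrite Cmod_opp in K.
  replace (RtoC (d / 2) - RtoC 0)%C with (RtoC (d / 2)) in K by ring.
  rewrite Cmod_R, Rabs_pos_eq in K; lra.
- intros E. apply RtoC_inj in E. lra.
Qed.

(** Cauchy's estimate on large circles kills the coefficients beyond [d]. Subtracting the polynomial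
    formed from the others leaves an entire function with no Fourier coefficient on any circle. *)
Lemma entire_poly_growth F K R d : holo F ->
  (forall z, R <= Cmod z -> Cmod (F z) <= K * Cmod z ^ d) -> is_polynomial F.
Proof.
intros HF HK. destruct (entire_coefs F HF) as [h [Hneg Hh]].
assert (Hbig : forall n, (Z.of_nat d < n)%Z -> h n = RtoC 0).
{ intros n Hn. apply Cmod_eq_0, Rle_antisym; [|apply Cmod_ge_0].
  apply Rnot_lt_le. intros Hpos.
  set (x := Rmax (Rabs R) (Rabs K / Cmod (h n))).
  assert (Hx0 : 0 <= x) by (eapply Rle_trans; [apply Rabs_pos|apply Rmax_l]).
  assert (HxR : R <= exp x).
  { assert (A1 := Rle_abs R). assert (A2 := Rmax_l (Rabs R) (Rabs K / Cmod (h n))).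
    fold x in A2. assert (A3 := exp_ineq1_le x). lra. }
  assert (Hb : Cmod (fcoef (fun t => F (Cexp (x, t))) n) <= K * exp x ^ d).
  { apply fcoef_bound.
    - intros t _. now apply continuous_circle.
    - intros t _. assert (E := Cmod_Cexp (x, t)). simpl in E.
      rewrite <- E. apply HK. rewrite E. exact HxR. }
  rewrite Hh, Cmod_mult, Cmod_R, Rabs_pos_eq in Hb by apply Rlt_le, exp_pos.
  assert (Hnd : exp (INR d * x) * exp x <= exp (IZR n * x)).
  { rewrite <- exp_plus.
    assert (L : INR d + 1 <= IZR n).
    { rewrite INR_IZR_INZ, <- plus_IZR. apply IZR_le. lia. }
    apply exp_le. nra. }
  rewrite exp_INR_mult in Hnd.
  assert (Pd : 0 < exp x ^ d) by apply pow_lt, exp_pos.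
  assert (HKx : exp x * Cmod (h n) <= Rabs K).
  { apply Rmult_le_reg_l with (exp x ^ d); trivial.
    assert (K * exp x ^ d <= Rabs K * exp x ^ d) by
      (apply Rmult_le_compat_r; [lra|apply Rle_abs]). nra. }
  assert (A2 := Rmax_r (Rabs R) (Rabs K / Cmod (h n))). fold x in A2.
  assert (A3 := exp_ineq1_le x).
  assert (A4 : Rabs K / Cmod (h n) < exp x) by lra.
  apply (Rmult_lt_compat_r (Cmod (h n))) in A4; trivial.
  unfold Rdiv in A4. rewrite Rmult_assoc, Rinv_l in A4 by lra. lra. }
set (P := cpoly (fun i => h (Z.of_nat i)) d).
assert (HP : is_polynomial P) by apply is_polynomial_poly.
apply is_polynomial_ext with P; [|exact HP].
intros z. symmetry. apply Ceq_minus.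
revert z. apply (fcoef_zero_circle (fun z => F z - P z)%C).
- intros z. destruct (HF z) as [l Hl]. destruct (holo_poly P HP z) as [m Hm].
  exists (l + ((RtoC 0) * P z + - RtoC 1 * m))%C.
  apply cderiv_ext with (fun z => F z + - RtoC 1 * P z)%C; [intros w; ring|].
  apply cderiv_plus; trivial. apply (cderiv_mult (fun _ => - RtoC 1)%C); trivial.
  apply cderiv_const.
- intros n x. rewrite fcoef_minus.
  + rewrite Hh. unfold P. rewrite fcoef_poly_circle.
    destruct (Z_le_gt_dec 0 n) as [H0|H0]; [destruct (Z_le_gt_dec n (Z.of_nat d)) as [H1|H1]|].
    * ring.
    * rewrite Hbig by lia. ring.
    * rewrite Hneg by lia. ring.
  + intros t _. now apply continuous_circle.
  + intros t _. apply continuous_circle. now apply holo_poly.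
Qed.

(** * Entire functions of finite order with finitely many zeros *)

Lemma zeros_bounded f : finitely_many_zeros f ->
  exists R0, 0 <= R0 /\ forall z, f z = RtoC 0 -> Cmod z <= R0.
Proof.
intros [l Hl].
assert (K : forall l : list C, exists R0, 0 <= R0 /\ forall z, In z l -> Cmod z <= R0).
{ clear. induction l as [|a l [R0 [H0 H]]].
  - exists 0. split; [lra|]. intros z [].
  - exists (Rmax (Cmod a) R0). split; [eapply Rle_trans; [exact H0|apply Rmax_r]|].
    intros z [->|Hz]; [apply Rmax_l|]. eapply Rle_trans; [now apply H|apply Rmax_r]. }
destruct (K l) as [R0 [H0 H]]. exists R0. split; trivial. intros z Hz. now apply H, Hl.
Qed.

Lemma CInt_conj f a b : a <= b -> ccont_on f a b ->
  CInt (fun t => Cconj (f t)) a b = Cconj (CInt f a b).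
Proof.
intros Hab Hf. apply CInt_unique. assert (H := is_CInt f a b Hab Hf).
apply (@is_RInt_fct_extend_pair R_NormedModule R_NormedModule).
- simpl. now apply is_CInt_fst in H.
- simpl. apply is_CInt_snd in H. now apply (@is_RInt_opp R_NormedModule).
Qed.

Lemma fcoef_conj phi n : ccont_on phi 0 (2 * PI) ->
  fcoef (fun t => Cconj (phi t)) n = Cconj (fcoef phi (- n)).
Proof.
intros H. unfold fcoef. rewrite Cmult_conj, <- CInt_conj.
- f_equal.
  + unfold Cconj, RtoC; simpl. f_equal. ring.
  + apply CInt_ext; [apply Rlt_le, two_PI_pos|]. intros t _.
    rewrite Cmult_conj, cis_conj, Z.opp_involutive. reflexivity.
- apply Rlt_le, two_PI_pos.
- apply ccont_on_mult; trivial. intros t _. apply continuous_cis.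
Qed.

Lemma fcoef_plus phi psi n : ccont_on phi 0 (2 * PI) -> ccont_on psi 0 (2 * PI) ->
  fcoef (fun t => phi t + psi t)%C n = (fcoef phi n + fcoef psi n)%C.
Proof.
intros H K. unfold fcoef. assert (P2 := two_PI_pos).
assert (Hc : ccont_on (cis (- n)) 0 (2 * PI)) by (intros t _; apply continuous_cis).
rewrite (CInt_ext _ (fun t => phi t * cis (- n) t + psi t * cis (- n) t)%C)
  by (try lra; intros; ring).
rewrite CInt_plus by (try lra; now apply ccont_on_mult). ring.
Qed.

Lemma continuous_Rmax {U : UniformSpace} (f g : U -> R) (x : U) :
  continuous f x -> continuous g x -> continuous (fun t => Rmax (f t) (g t)) x.
Proof.
intros Hf Hg.
apply (continuous_ext (fun t => / 2 * (f t + g t + Rabs (f t - g t)))).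
- intros t. unfold Rmax, Rabs. destruct Rle_dec; destruct Rcase_abs; lra.
- apply continuous_Rmult; [apply continuous_const|].
  apply continuous_Rplus; [now apply continuous_Rplus|].
  apply (continuous_comp (fun t => f t - g t) Rabs); [now apply continuous_Rminus|].
  apply continuous_Rabs.
Qed.

Lemma ex_RInt_cont (g : R -> R) a b : a <= b ->
  (forall t, a <= t <= b -> continuous g t) -> ex_RInt g a b.
Proof.
intros Hab Hg. apply (@ex_RInt_continuous R_CompleteNormedModule).
intros t Ht. rewrite Rmin_left, Rmax_right in Ht by lra. now apply Hg.
Qed.

(* [Re H = log |f| - mu x] has mean [Re (h 0)], so the mean of its absolute value
   is controlled by that of [log^+ |f|] alone, and it bounds every Fourier
   coefficient of [Re H]. *)
Lemma nevanlinna_coef_bound f H s mu h x n : holo f -> holo_on s H ->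
  (forall y t, s <= y -> Re (H (y, t)) = ln (Cmod (f (Cexp (y, t)))) - mu * y) ->
  (forall y t, s <= y -> f (Cexp (y, t)) <> RtoC 0) ->
  (forall n y, s <= y -> fcoef (fun t => H (y, t)) n = (RtoC (exp (IZR n * y)) * h n)%C) ->
  s <= x -> 0 <= x ->
  Cmod (h n) * exp (IZR n * x) <= 4 * nevanlinna_T (exp x) f + 2 * Cmod (h 0%Z) +
    4 * Rabs mu * x + Cmod (h (- n)%Z) * exp (- IZR n * x).
Proof.
intros Hf HH HRe Hnz Hh Hx Hx0. assert (P2 := two_PI_pos).
set (v := fun t => Re (H (x, t))).
set (w := fun t => log_plus (Cmod (f (Cexp (x, t))))).
set (T := nevanlinna_T (exp x) f).
assert (HHc : ccont_on (fun t => H (x, t)) 0 (2 * PI)).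
{ intros t _. apply continuous_vpath. now apply (holo_on_continuous s). }
assert (Hvc : forall t, 0 <= t <= 2 * PI -> continuous v t).
{ intros t Ht. apply (continuous_C_fst (fun t => H (x, t))). now apply HHc. }
assert (Hwc : forall t, continuous w t).
{ intros t. unfold w, log_plus. apply continuous_Rmax; [|apply continuous_const].
  apply (continuous_comp (fun t => Cmod (f (Cexp (x, t)))) ln).
  - apply continuous_Cmod. now apply continuous_circle.
  - apply continuity_pt_filterlim, derivable_continuous_pt.
    exists (/ Cmod (f (Cexp (x, t)))). apply derivable_pt_lim_ln. apply Cmod_gt_0. now apply Hnz. }
assert (HT : RInt w 0 (2 * PI) = 2 * PI * T :> R).
{ assert (K : forall X : R, X = 2 * PI * (/ (2 * PI) * X)) by (intros X; field; apply PI_neq0).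
  apply K. }
assert (Hv0 : RInt v 0 (2 * PI) = 2 * PI * Re (h 0%Z) :> R).
{ assert (K := is_CInt _ _ _ (Rlt_le _ _ P2) HHc). apply is_CInt_fst in K.
  apply (@is_RInt_unique R_CompleteNormedModule) in K.
  change (RInt v 0 (2 * PI)) with (RInt (fun t => fst (H (x, t))) 0 (2 * PI)).
  rewrite K. assert (E := Hh 0%Z x Hx). rewrite Rmult_0_l, exp_0, Cmult_1_l in E.
  rewrite <- E. unfold fcoef.
  rewrite (CInt_ext (fun t => H (x, t) * cis (- 0) t)%C (fun t => H (x, t)));
    [|lra|intros; change (- 0)%Z with 0%Z; rewrite cis_0; ring].
  rewrite re_scal_l. unfold Re. field. lra. }
(* This is [2 Re H = H + conj H]; conjugation exchanges the indices [n] and [- n], which is where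
   the coefficient [h (- n)] in the conclusion comes from. *)
assert (Hvn : (fcoef (fun t => RtoC (v t)) n * RtoC 2 =
  RtoC (exp (IZR n * x)) * h n + RtoC (exp (- IZR n * x)) * Cconj (h (- n)%Z))%C).
{ rewrite <- Hh by exact Hx.
  replace (RtoC (exp (- IZR n * x)) * Cconj (h (- n)%Z))%C with
    (fcoef (fun t => Cconj (H (x, t))) n).
  2: { rewrite fcoef_conj by exact HHc. rewrite Hh by exact Hx. rewrite Cmult_conj, opp_IZR.
    f_equal. unfold Cconj, RtoC; simpl. f_equal. ring. }
  rewrite <- fcoef_plus; trivial.
  2: { intros t Ht. apply continuous_C_pair; simpl.
    - apply (continuous_C_fst (fun t => H (x, t))). now apply HHc.
    - apply (@continuous_opp R_UniformSpace R_AbsRing R_NormedModule).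
      apply (continuous_C_snd (fun t => H (x, t))). now apply HHc. }
  unfold fcoef. rewrite <- Cmult_assoc. f_equal. rewrite Cmult_comm, <- CInt_Cmult.
  - apply CInt_ext; [lra|]. intros t _. rewrite Cmult_assoc. f_equal.
    unfold v. destruct (H (x, t)) as [p q]. unfold Cplus, Cmult, Cconj, RtoC; simpl.
    f_equal; ring.
  - lra.
  - apply ccont_on_mult; [|intros t _; apply continuous_cis].
    intros t Ht. apply continuous_RtoC. now apply Hvc. }
assert (Hb : Cmod (fcoef (fun t => RtoC (v t)) n) <= 2 * T + Cmod (h 0%Z) + 2 * Rabs mu * x).
{ unfold fcoef. rewrite Cmod_mult, Cmod_R, Rabs_pos_eq
    by (apply Rlt_le, Rinv_0_lt_compat; lra).
  (* The absolute value of [v] is twice its positive part minus [v], and that positive part is at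
     most [w + |mu| x]; [c] is twice the correction. *)
  set (c := 2 * Rabs mu * x).
  assert (K : Cmod (CInt (fun t => RtoC (v t) * cis (- n) t)%C 0 (2 * PI)) <=
    RInt (fun t => (2 * w t - v t) + c) 0 (2 * PI)).
  { apply CInt_norm_le.
    - lra.
    - apply ccont_on_mult; [|intros t _; apply continuous_cis].
      intros t Ht. apply continuous_RtoC. now apply Hvc.
    - intros t Ht. apply continuous_Rplus; [|apply continuous_const].
      apply continuous_Rminus; [|now apply Hvc].
      apply continuous_Rmult; [apply continuous_const|apply Hwc].
    - intros t Ht. rewrite Cmod_mult, Cmod_cis, Cmod_R, Rmult_1_r.
      assert (E : v t = ln (Cmod (f (Cexp (x, t)))) - mu * x) by now apply HRe.
      unfold w, log_plus. set (u := ln (Cmod (f (Cexp (x, t))))) in *.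
      assert (A1 := Rmax_l u 0). assert (A2 := Rmax_r u 0).
      assert (A3 : - mu * x <= Rabs mu * x).
      { apply Rmult_le_compat_r; trivial. rewrite <- Rabs_Ropp. apply Rle_abs. }
      assert (A4 : 0 <= Rabs mu * x) by (apply Rmult_le_pos; [apply Rabs_pos|trivial]).
      unfold c. unfold Rabs at 1. destruct Rcase_abs; lra. }
  assert (E1 : ex_RInt w 0 (2 * PI)) by (apply ex_RInt_cont; [lra|intros; apply Hwc]).
  assert (E2 : ex_RInt v 0 (2 * PI)) by (apply ex_RInt_cont; [lra|exact Hvc]).
  assert (EI : is_RInt (fun t => (2 * w t - v t) + c) 0 (2 * PI)
    ((2 * (2 * PI * T) - 2 * PI * Re (h 0%Z)) + (2 * PI - 0) * c)).
  { apply (@is_RInt_plus R_NormedModule).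
    - apply (@is_RInt_minus R_NormedModule).
      + apply (@is_RInt_scal R_NormedModule). rewrite <- HT.
        now apply (@RInt_correct R_CompleteNormedModule).
      + rewrite <- Hv0. now apply (@RInt_correct R_CompleteNormedModule).
    - apply (@is_RInt_const R_NormedModule). }
  apply (@is_RInt_unique R_CompleteNormedModule) in EI.
  change (@RInt R_CompleteNormedModule (fun t => (2 * w t - v t) + c) 0 (2 * PI)) with
    (RInt (fun t => (2 * w t - v t) + c) 0 (2 * PI)) in EI. rewrite EI in K.
  assert (L := re_le_Cmod (h 0%Z)). apply Rabs_le_between in L.
  apply Rmult_le_reg_l with (2 * PI); [lra|].
  rewrite <- Rmult_assoc, Rinv_r by lra. rewrite Rmult_1_l.
  eapply Rle_trans; [exact K|]. unfold c.
  assert (2 * PI * (- Re (h 0%Z)) <= 2 * PI * Cmod (h 0%Z)) by (apply Rmult_le_compat_l; lra).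
  lra. }
assert (HA : (RtoC (exp (IZR n * x)) * h n = fcoef (fun t => RtoC (v t)) n * RtoC 2
  - RtoC (exp (- IZR n * x)) * Cconj (h (- n)%Z))%C) by (rewrite Hvn; ring).
assert (HM : Cmod (RtoC (exp (IZR n * x)) * h n) <=
  Cmod (fcoef (fun t => RtoC (v t)) n) * 2 + exp (- IZR n * x) * Cmod (h (- n)%Z)).
{ rewrite HA. eapply Rle_trans; [apply Cmod_triangle|].
  rewrite Cmod_opp, !Cmod_mult, !Cmod_R, Cmod_conj.
  rewrite (Rabs_pos_eq 2), (Rabs_pos_eq (exp _)) by (try lra; apply Rlt_le, exp_pos). lra. }
rewrite Cmod_mult, Cmod_R, Rabs_pos_eq in HM by apply Rlt_le, exp_pos. fold T. lra.
Qed.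

(** In row [k] of Fejer's double sum only [j < k] yields a negative frequency [j - k], and the
    weights [(1 / 2) ^ (k - j)] add up to less than 1 whatever [N] and [k] are. The induction needs
    the sharper partial bound [Hlt]. *)
Lemma geometric_tail_sum (a : nat -> R) (B : R) (k : nat) : 0 <= B ->
  (forall j, (j < k)%nat -> a j <= B * (/ 2) ^ (k - j)) ->
  (forall j, (k <= j)%nat -> a j <= 0) ->
  forall N, sum_n a N <= B.
Proof.
intros HB H1 H2.
assert (Hlt : forall N, (N < k)%nat -> sum_n a N <= B * (2 * (/ 2) ^ (k - N))).
{ induction N as [|N IH]; intros HN.
  - rewrite rsum_O. eapply Rle_trans; [now apply H1|].
    assert (0 <= (/ 2) ^ (k - 0)) by (apply pow_le; lra). nra.
  - rewrite rsum_S. assert (K := H1 (S N) HN). assert (L := IH ltac:(lia)).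
    replace (k - N)%nat with (S (k - S N)) in L by lia. simpl pow in L.
    lra. }
induction N as [|N IH].
- destruct (Nat.eq_dec k 0) as [->|Hk].
  + rewrite rsum_O. specialize (H2 0%nat (le_n _)). lra.
  + eapply Rle_trans; [apply Hlt; lia|].
    replace (k - 0)%nat with (S (k - 1)) by lia. simpl pow.
    assert ((/ 2) ^ (k - 1) <= 1) by (rewrite <- (pow1 (k - 1)); apply pow_incr; lra). nra.
- destruct (Compare_dec.le_lt_dec k (S N)) as [Hk|Hk].
  + rewrite rsum_S. specialize (H2 (S N) Hk). lra.
  + eapply Rle_trans; [now apply Hlt|].
    replace (k - S N)%nat with (S (k - S N - 1)) by lia. simpl pow.
    assert ((/ 2) ^ (k - S N - 1) <= 1) by
      (rewrite <- (pow1 (k - S N - 1)); apply pow_incr; lra). nra.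
Qed.

(** A continuous logarithm [L] of [f (exp w)] changes over one period by a constant [c0] with
    exponential 1, hence purely imaginary; [mu] is the winding number [Im c0 / (2 PI)], and
    subtracting [mu * w] restores periodicity. The last factor of the formula has modulus 1 and
    drops out of every estimate. The shift to [s + 1] leaves room for the discs on which
    [cderiv_log] is applied. *)
Lemma periodic_log f s : holo f ->
  (forall w, s <= Re w -> f (Cexp w) <> RtoC 0) ->
  exists (H : C -> C) (mu : R), holo_on (s + 1) H /\ periodic_on (s + 1) H /\
    forall y t, s + 1 <= y ->
      Cexp (H (y, t)) = (f (Cexp (y, t)) * RtoC (exp (- mu * y)) * cis 1 (- mu * t))%C.
Proof.
intros Hf Hnz. set (g := fun w => f (Cexp w)).
assert (Hg : holo g) by (intros z; exact (holo_comp f Cexp Hf holo_Cexp z)).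
destruct (half_plane_lift g s) as [L HL].
{ intros w Hw. split; [now apply holo_continuous|now apply Hnz]. }
assert (HLd : holo_on (s + 1) L).
{ intros z Hz. destruct (Hg z) as [l Hl]. apply (cderiv_log L g z l); trivial.
  - apply HL. lra.
  - apply locally_Cmod. exists 1. split; [lra|]. intros w Hw. apply HL.
    assert (B := re_le_Cmod (w - z)). apply Rabs_le_between in B.
    change (Re (w - z)) with (Re w - Re z) in B. lra. }
assert (Hper : forall x t, s + 1 <= x ->
  (L (x, t + 2 * PI)%R - L (x, t) = L (s + 1, 0 + 2 * PI)%R - L (s + 1, 0)%R)%C).
{ intros x t Hx.
  assert (Eadd : forall u v, ((u, v) + (0, 2 * PI)%R)%C = (u, (v + 2 * PI)%R)).
  { intros u v. unfold Cplus; simpl. f_equal; ring. }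
  assert (K := lift_unique_seg (fun w => L (w + (0, (2 * PI)%R))%C) L ((s + 1)%R, 0) (x, t)).
  cbv beta in K. rewrite !Eadd in K. apply K.
  intros u Hu. rewrite seg_coord. cbn [fst snd]. rewrite Eadd.
  assert (Hre : s < s + 1 + u * (x - (s + 1))) by nra.
  set (q := 0 + u * (t - 0)).
  destruct (HL ((s + 1 + u * (x - (s + 1)))%R, q) Hre) as [C1 E1].
  destruct (HL ((s + 1 + u * (x - (s + 1)))%R, q + 2 * PI) Hre) as [C2 E2].
  split; [|split]; trivial.
  - apply (continuous_comp (fun w => w + (0, (2 * PI)%R))%C L).
    + apply continuous_Cplus; [apply continuous_id|apply continuous_const].
    + rewrite Eadd. exact C2.
  - rewrite E1, E2. unfold g. now rewrite Cexp_period. }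
set (c0 := (L (s + 1, 0 + 2 * PI)%R - L (s + 1, 0)%R)%C) in *.
assert (Hc0 : Re c0 = 0).
{ apply Cexp_eq_1. unfold c0. rewrite Cexp_minus.
  rewrite (proj2 (HL (s + 1, 0 + 2 * PI) ltac:(simpl; lra))).
  rewrite (proj2 (HL (s + 1, 0) ltac:(simpl; lra))).
  unfold g. rewrite Cexp_period. field. apply Hnz. simpl. lra. }
set (mu := Im c0 / (2 * PI)). assert (P2 := two_PI_pos).
assert (Ec0 : c0 = (RtoC mu * (0, (2 * PI)%R))%C).
{ destruct c0 as [p q] eqn:E. simpl in Hc0. unfold mu, Cmult, RtoC; simpl.
  rewrite Hc0. f_equal; field; apply Rgt_not_eq, PI_RGT_0. }
exists (fun w => L w - RtoC mu * w)%C, mu. split; [|split].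
- intros z Hz. destruct (HLd z Hz) as [l Hl].
  exists (l + (- RtoC mu))%C. apply cderiv_ext with (fun w => L w + (- RtoC mu) * w)%C.
  + intros w. ring.
  + apply cderiv_plus; trivial. apply cderiv_scal.
- intros x t Hx. specialize (Hper x t Hx).
  replace (L (x, (t + 2 * PI)%R)) with (L (x, t) + c0)%C by (rewrite <- Hper; ring).
  rewrite Ec0. replace ((x, (t + 2 * PI)%R) : C) with ((x, t) + (0, (2 * PI)%R))%C
    by (unfold Cplus; simpl; f_equal; ring). ring.
- intros y t Hy. rewrite Cexp_minus, (proj2 (HL (y, t) ltac:(simpl; lra))).
  unfold Cdiv. rewrite <- Cexp_opp, <- Cmult_assoc. unfold g. f_equal.
  replace (- (RtoC mu * (y, t)))%C with ((- mu * y)%R, (- mu * t)%R)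
    by (unfold Copp, Cmult, RtoC; simpl; f_equal; ring).
  apply Cexp_polar.
Qed.

(** The logarithm splits into a polynomial [Q], a bounded remainder and the term [mu w]. The factor
    [f exp (- Q)] therefore grows no faster than [|z| ^ mu], while being entire because [Q] is. *)
Theorem finite_order_factorization f (M : nat) : holo f -> finitely_many_zeros f ->
  (forall A, exists r, A < r /\ nevanlinna_T r f <= r ^ M) ->
  exists P Q, is_polynomial P /\ is_polynomial Q /\ forall z, f z = (P z * Cexp (Q z))%C.
Proof.
intros Hf Hz HT.
destruct (zeros_bounded f Hz) as [R0 [HR0 Hzb]].
assert (Hnz : forall w, R0 <= Re w -> f (Cexp w) <> RtoC 0).
{ intros w Hw E. apply Hzb in E. rewrite Cmod_Cexp in E.
  assert (K := exp_ineq1_le (Re w)). lra. }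
destruct (periodic_log f R0 Hf Hnz) as [H [mu [HH [Hp He]]]].
set (s := R0 + 1) in *.
destruct (laurent_coefs s H HH Hp) as [h Hh].
assert (Hnz' : forall y t, s <= y -> f (Cexp (y, t)) <> RtoC 0).
{ intros y t Hy. apply Hnz. simpl. unfold s in Hy. lra. }
assert (HRe : forall y t, s <= y -> Re (H (y, t)) = ln (Cmod (f (Cexp (y, t)))) - mu * y).
{ intros y t Hy. assert (K := He y t Hy). apply (f_equal Cmod) in K.
  rewrite Cmod_Cexp, !Cmod_mult, Cmod_cis, Cmod_R, Rmult_1_r in K.
  rewrite Rabs_pos_eq in K by apply Rlt_le, exp_pos.
  apply (f_equal ln) in K. rewrite ln_exp, ln_mult, ln_exp in K.
  - lra.
  - apply Cmod_gt_0. now apply Hnz'.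
  - apply exp_pos. }
(* One more than [M], so that [r ^ D] also dominates the term [|mu| ln r] of the coefficient bound
   when [M = 0]. *)
set (D := S M).
assert (Hbig : forall n, (Z.of_nat D < n)%Z -> h n = RtoC 0).
{ intros n Hn. apply Cmod_eq_0, Rle_antisym; [|apply Cmod_ge_0].
  apply Rnot_lt_le. intros Hpos.
  set (K := 4 + 2 * Cmod (h 0%Z) + 4 * Rabs mu + Cmod (h (- n)%Z)).
  destruct (HT (Rmax (exp s) (K / Cmod (h n)))) as [r [Hr HTr]].
  assert (A1 := Rmax_l (exp s) (K / Cmod (h n))). assert (A2 := Rmax_r (exp s) (K / Cmod (h n))).
  assert (A3 := exp_pos s). set (x := ln r).
  assert (Ex : exp x = r) by (unfold x; apply exp_ln; lra).
  assert (Hxs : s <= x).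
  { apply Rlt_le, exp_lt_inv. rewrite Ex. lra. }
  assert (Hx0 : 0 <= x) by (unfold s in Hxs; lra).
  assert (B := nevanlinna_coef_bound f H s mu h x n Hf HH HRe Hnz' Hh Hxs Hx0).
  rewrite Ex in B.
  assert (Hr1 : 1 <= r).
  { rewrite <- Ex, <- exp_0. now apply exp_le. }
  assert (Hxr : x <= r ^ D).
  { apply Rle_trans with r.
    - assert (Q := exp_ineq1_le x). lra.
    - rewrite <- (pow_1 r) at 1. apply Rle_pow; trivial. unfold D. lia. }
  assert (HTr' : nevanlinna_T r f <= r ^ D).
  { eapply Rle_trans; [exact HTr|]. apply Rle_pow; trivial. unfold D. lia. }
  assert (HrD : 1 <= r ^ D) by (apply pow_R1_Rle; trivial).
  assert (Hneg : exp (- IZR n * x) <= r ^ D).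
  { eapply Rle_trans; [|exact HrD]. rewrite <- exp_0.
    assert (0 < IZR n) by (apply IZR_lt; lia).
    apply exp_le. nra. }
  assert (Hn1 : r ^ D * r <= exp (IZR n * x)).
  { rewrite <- Ex at 1 2. rewrite <- exp_INR_mult, <- exp_plus.
    assert (L : INR D + 1 <= IZR n).
    { rewrite INR_IZR_INZ, <- plus_IZR. apply IZR_le. lia. }
    apply exp_le. nra. }
  assert (Q1 : Cmod (h n) * (r ^ D * r) <= K * r ^ D).
  { apply Rle_trans with (Cmod (h n) * exp (IZR n * x)).
    - apply Rmult_le_compat_l; lra.
    - eapply Rle_trans; [exact B|]. unfold K.
      assert (C1 := Cmod_ge_0 (h 0%Z)). assert (C2 := Cmod_ge_0 (h (- n)%Z)).
      assert (C3 := Rabs_pos mu).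
      assert (Cmod (h (- n)%Z) * exp (- IZR n * x) <= Cmod (h (- n)%Z) * r ^ D)
        by (apply Rmult_le_compat_l; lra).
      assert (Rabs mu * x <= Rabs mu * r ^ D) by (apply Rmult_le_compat_l; lra).
      assert (Cmod (h 0%Z) * 1 <= Cmod (h 0%Z) * r ^ D) by (apply Rmult_le_compat_l; lra).
      lra. }
  assert (Q2 : Cmod (h n) * r <= K) by (apply Rmult_le_reg_r with (r ^ D); lra).
  assert (A4 : K / Cmod (h n) < r) by lra.
  apply (Rmult_lt_compat_r (Cmod (h n))) in A4; trivial.
  unfold Rdiv in A4. rewrite Rmult_assoc, Rinv_l in A4 by lra. lra. }
set (Q := cpoly (fun i => h (Z.of_nat i)) D).
assert (HQ : is_polynomial Q) by apply is_polynomial_poly.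
assert (HQh : holo Q) by now apply holo_poly.
assert (Hcoef : forall n y, s <= y ->
  fcoef (fun t => H (y, t) - Q (Cexp (y, t)))%C n =
  if Z_le_gt_dec 0 n then RtoC 0 else (RtoC (exp (IZR n * y)) * h n)%C).
{ intros n y Hy. rewrite fcoef_minus.
  - rewrite Hh by exact Hy. unfold Q. rewrite fcoef_poly_circle.
    destruct (Z_le_gt_dec 0 n) as [H0|H0]; [destruct (Z_le_gt_dec n (Z.of_nat D)) as [H1|H1]|].
    + ring.
    + rewrite Hbig by lia. ring.
    + ring.
  - intros t _. apply continuous_vpath. now apply (holo_on_continuous s).
  - intros t _. now apply continuous_circle. }
(* Cauchy's estimate on the boundary circle. One unit further right, [exp (n * (y - s))] is at most
   [(1 / 2) ^ (- n)] for negative [n], since [e >= 2]; this gives the weights of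
   [geometric_tail_sum]. *)
assert (HB1 : exists B1, 0 <= B1 /\ forall n, Cmod (h n) * exp (IZR n * s) <= B1).
{ assert (Hc : ccont_on (fun t => H (s, t)) 0 (2 * PI)).
  { intros t _. apply continuous_vpath. apply (holo_on_continuous s); trivial. lra. }
  destruct (ccont_on_bounded _ 0 (2 * PI) (Rlt_le _ _ two_PI_pos) Hc) as [B1 HB1].
  exists B1. split.
  - eapply Rle_trans; [apply Cmod_ge_0|]. apply (HB1 0). assert (K := two_PI_pos). lra.
  - intros n. assert (K := fcoef_bound _ n B1 Hc HB1). rewrite Hh in K by lra.
    rewrite Cmod_mult, Cmod_R, Rabs_pos_eq in K by apply Rlt_le, exp_pos. lra. }
destruct HB1 as [B1 [HB10 HB1]].
assert (HE : forall y t, s + 1 <= y -> 0 <= t <= 2 * PI ->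
  Cmod (H (y, t) - Q (Cexp (y, t))) <= B1).
{ intros y t Hy Ht.
  apply (fourier_bound (fun t => H (y, t) - Q (Cexp (y, t)))%C); trivial.
  - intros u. apply continuous_Cminus.
    + apply continuous_vpath. apply (holo_on_continuous s); trivial. lra.
    + now apply continuous_circle.
  - intros u. rewrite Hp, Cexp_period by lra. reflexivity.
  - intros N k _. apply (geometric_tail_sum _ B1 k HB10).
    + intros j Hj. rewrite Hcoef by lra. destruct Z_le_gt_dec as [H0|H0]; [lia|].
      set (n := (Z.of_nat j - Z.of_nat k)%Z) in *.
      rewrite Cmod_mult, Cmod_R, Rabs_pos_eq by apply Rlt_le, exp_pos.
      replace (IZR n * y) with (IZR n * s + IZR n * (y - s)) by ring. rewrite exp_plus.
      assert (Hpw : exp (IZR n * (y - s)) <= (/ 2) ^ (k - j)).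
      { replace (IZR n * (y - s)) with (INR (k - j) * (- (y - s))).
        - rewrite exp_INR_mult. apply pow_incr. split; [apply Rlt_le, exp_pos|].
          rewrite exp_Ropp. apply Rinv_le_contravar; [lra|].
          assert (K := exp_ineq1_le (y - s)). lra.
        - rewrite minus_INR by lia. unfold n. rewrite minus_IZR, <- !INR_IZR_INZ. ring. }
      specialize (HB1 n). assert (C1 := Cmod_ge_0 (h n)). assert (C2 := exp_pos (IZR n * s)).
      assert (C3 := exp_pos (IZR n * (y - s))).
      replace (exp (IZR n * s) * exp (IZR n * (y - s)) * Cmod (h n))
        with ((Cmod (h n) * exp (IZR n * s)) * exp (IZR n * (y - s))) by ring.
      apply Rmult_le_compat; trivial; [|lra]. apply Rmult_le_pos; lra.
    + intros j Hj. rewrite Hcoef by lra. destruct Z_le_gt_dec as [H0|H0]; [|lia].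
      rewrite Cmod_0. lra. }
(* [mu] is only known to be real, while polynomial growth is stated with a natural exponent. *)
destruct (INR_unbounded mu) as [d Hd].
exists (fun z => f z * Cexp (- Q z))%C, Q. split; [|split; trivial].
- apply (entire_poly_growth _ (exp B1) (exp (s + 1)) d).
  + apply (holo_mult f (fun z => Cexp (- Q z))%C); trivial.
    apply (holo_comp Cexp (fun z => - Q z)%C); [apply holo_Cexp|].
    intros z. destruct (HQh z) as [l Hl]. exists (RtoC 0 * Q z + - RtoC 1 * l)%C.
    apply cderiv_ext with (fun z => - RtoC 1 * Q z)%C; [intros w; ring|].
    apply (cderiv_mult (fun _ => - RtoC 1)%C); trivial. apply cderiv_const.
  + intros z Hzl. assert (Hz0 : z <> RtoC 0).
    { apply Cmod_gt_0. eapply Rlt_le_trans; [apply exp_pos|exact Hzl]. }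
    destruct (Cexp_surj_2PI z Hz0) as [x [t [E Ht]]].
    assert (Hx : s + 1 <= x).
    { rewrite <- E, Cmod_Cexp in Hzl. simpl in Hzl.
      destruct (Rle_lt_dec (s + 1) x) as [L|L]; trivial. apply exp_increasing in L. lra. }
    assert (Hm : Cmod z = exp x) by (rewrite <- E, Cmod_Cexp; reflexivity).
    assert (K := He x t ltac:(lra)). rewrite E in K.
    assert (EQ : (f z * Cexp (- Q z) * RtoC (exp (- mu * x)) * cis 1 (- mu * t) =
      Cexp (H (x, t) - Q z))%C).
    { unfold Cminus. rewrite Cexp_plus, K. ring. }
    apply (f_equal Cmod) in EQ. rewrite Cmod_Cexp, !Cmod_mult, Cmod_cis, Cmod_R, Rmult_1_r in EQ.
    rewrite Rabs_pos_eq in EQ by apply Rlt_le, exp_pos. rewrite Cmod_mult, Hm.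
    specialize (HE x t Hx Ht). rewrite E in HE.
    assert (L := re_le_Cmod (H (x, t) - Q z)). apply Rabs_le_between in L.
    assert (HexpB : exp (Re (H (x, t) - Q z)) <= exp B1).
    { apply exp_le. lra. }
    replace (Cmod (f z) * Cmod (Cexp (- Q z))) with
      (exp (Re (H (x, t) - Q z)) * exp (mu * x)).
    2: { rewrite <- EQ, Rmult_assoc, <- exp_plus.
      replace (- mu * x + mu * x) with 0 by ring. rewrite exp_0. ring. }
    rewrite <- exp_INR_mult.
    apply Rmult_le_compat; trivial; try (apply Rlt_le, exp_pos).
    assert (0 < x) by (unfold s in Hx; lra).
    apply Rlt_le, exp_increasing. apply Rmult_lt_compat_r; lra.
- intros z. rewrite Cexp_opp. field. apply Cexp_neq_0.
Qed.

(** * Order of growth and exponential sums *)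

Lemma Rbar_le_eps (b : Rbar) (l : R) :
  (forall e, 0 < e -> Rbar_le b (Finite (l + e))) -> Rbar_le b (Finite l).
Proof.
intros H. destruct b as [b| |]; simpl in *; trivial.
- apply le_epsilon. exact H.
- exact (H 1 Rlt_0_1).
Qed.

Lemma limsup_infty_lim (g : R -> R) (l : R) :
  (forall e, 0 < e -> exists A, forall r, A < r -> Rabs (g r - l) < e) ->
  limsup_infty g = Finite l.
Proof.
intros H. apply Rbar_is_glb_unique. split.
- intros y [A ->].
  destruct (Lub_Rbar_correct (fun x => exists r, A < r /\ x = g r)) as [Hub _].
  assert (K : forall e, 0 < e -> Rbar_le (Finite (l - e))
    (Lub_Rbar (fun x => exists r, A < r /\ x = g r))).
  { intros e He. destruct (H e He) as [B HB]. set (r := Rmax A B + 1).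
    assert (A1 := Rmax_l A B). assert (A2 := Rmax_r A B).
    apply Rbar_le_trans with (Finite (g r)).
    - specialize (HB r ltac:(unfold r; lra)). apply Rabs_lt_between in HB. simpl. lra.
    - apply Hub. exists r. split; trivial. unfold r. lra. }
  destruct (Lub_Rbar _) as [u| |]; simpl in *; trivial.
  + apply le_epsilon. intros e He. specialize (K e He). lra.
  + exact (K 1 Rlt_0_1).
- intros b Hb. apply Rbar_le_eps. intros e He. destruct (H e He) as [A HA].
  eapply Rbar_le_trans; [apply Hb; exists A; reflexivity|].
  apply (proj2 (Lub_Rbar_correct _)). intros x [r [Hr ->]].
  specialize (HA r Hr). apply Rabs_lt_between in HA. simpl. lra.
Qed.

(** If no tail were bounded by [rho + 1], every tail supremum would be at least [rho + 1], and so
    would their infimum [rho]. *)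
Lemma finite_order_bound f : finite_order f ->
  exists M, forall A, exists r, A < r /\ nevanlinna_T r f <= r ^ M.
Proof.
unfold finite_order, order. intros Hfin.
set (g := fun r => log_plus (nevanlinna_T r f) / ln r) in *.
set (E := fun y => exists A, y = Lub_Rbar (fun x => exists r, A < r /\ x = g r)).
destruct (proj2_sig (Rbar_ex_glb E)) as [_ Hglb]. fold (Rbar_glb E) in Hglb.
change (is_finite (Rbar_glb E)) in Hfin.
set (rho := real (Rbar_glb E)) in *. rewrite <- Hfin in Hglb. fold rho in Hglb.
assert (HA0 : exists A0, forall r, A0 < r -> g r <= rho + 1).
{ apply NNPP. intros Hno.
  assert (Hl : Rbar_le (Finite (rho + 1)) (Finite rho)).
  { apply Hglb. intros y [A ->].
    destruct (Rbar_le_lt_dec (Finite (rho + 1)) (Lub_Rbar (fun x => exists r, A < r /\ x = g r)))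
      as [L|L]; trivial.
    exfalso. apply Hno. exists A. intros r Hr.
    assert (K : Rbar_le (Finite (g r)) (Finite (rho + 1))).
    { apply Rbar_lt_le. eapply Rbar_le_lt_trans; [|exact L].
      apply (proj1 (Lub_Rbar_correct _)). now exists r. }
    exact K. }
  simpl in Hl. lra. }
destruct HA0 as [A0 HA0]. destruct (INR_unbounded (rho + 1)) as [M HM].
exists M. intros A. set (r := Rmax A (Rmax A0 1) + 1).
assert (A1 := Rmax_l A (Rmax A0 1)). assert (A2 := Rmax_r A (Rmax A0 1)).
assert (A3 := Rmax_l A0 1). assert (A4 := Rmax_r A0 1).
exists r. split; [unfold r; lra|].
assert (Hr1 : 1 < r) by (unfold r; lra).
assert (Hln : 0 < ln r) by (rewrite <- ln_1; apply ln_increasing; lra).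
assert (Hg := HA0 r ltac:(unfold r; lra)). unfold g in Hg.
assert (HL : log_plus (nevanlinna_T r f) <= INR M * ln r).
{ apply Rmult_le_reg_r with (/ ln r); [now apply Rinv_0_lt_compat|].
  rewrite Rmult_assoc, Rinv_r by lra. unfold Rdiv in Hg. lra. }
(* For a nonpositive value [log_plus] carries no information, and the bound holds by sign. *)
destruct (Rle_lt_dec (nevanlinna_T r f) 0) as [Hn|Hp].
- eapply Rle_trans; [exact Hn|]. apply pow_le. lra.
- replace (r ^ M) with (exp (INR M * ln r)) by (rewrite exp_INR_mult, exp_ln; lra).
  rewrite <- (exp_ln _ Hp). apply exp_le.
  assert (K := Rmax_l (ln (nevanlinna_T r f)) 0). fold (log_plus (nevanlinna_T r f)) in K. lra.
Qed.

(** * The characteristic of a single exponential *)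

Lemma is_RInt_sqr_linear_trig (a b A B D : R) :
  is_RInt (fun t => A + B * (a * cos t - b * sin t) + D * (a * cos t - b * sin t) ^ 2)
    0 (2 * PI) (2 * PI * A + D * PI * (a ^ 2 + b ^ 2)).
Proof.
set (F := fun t => A * t + B * (a * sin t + b * cos t) +
  D * (a ^ 2 * (t + sin t * cos t) / 2 - a * b * (sin t) ^ 2 +
       b ^ 2 * (t - sin t * cos t) / 2)).
replace (2 * PI * A + D * PI * (a ^ 2 + b ^ 2)) with (F (2 * PI) - F 0).
- apply (@is_RInt_derive R_CompleteNormedModule F).
  + intros t _. unfold F. auto_derive; trivial.
    assert (E := sin2_cos2 t). unfold Rsqr in E.
    assert (E1 : sin t * sin t = 1 - cos t * cos t) by lra.
    field_simplify. replace (sin t ^ 2) with (1 - cos t ^ 2) by (simpl; lra). field.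
  + intros t _. apply (@ex_derive_continuous R_AbsRing R_NormedModule). auto_derive. trivial.
- unfold F. rewrite sin_2PI, cos_2PI, sin_0, cos_0. field.
Qed.

(* Lower bound: [max (u, 0) >= u (1 + phi / |gam|) / 2], whose integral is explicit. *)
Lemma nevanlinna_exp_bounds (c gam : C) (r : R) : c <> RtoC 0 -> gam <> RtoC 0 -> 0 <= r ->
  ln (Cmod c) / 2 + r * Cmod gam / 4 <=
    nevanlinna_T r (fun z => (c * Cexp (gam * z))%C) <=
  Rabs (ln (Cmod c)) + r * Cmod gam.
Proof.
intros Hc Hg Hr. unfold nevanlinna_T. assert (P2 := two_PI_pos).
assert (Hcp := proj1 (Cmod_gt_0 _) Hc). assert (Hgp := proj1 (Cmod_gt_0 _) Hg).
set (A := ln (Cmod c)). set (G := Cmod gam) in *.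
set (phi := fun t => Re gam * cos t - Im gam * sin t).
set (w := fun t => log_plus (Cmod (c * Cexp (gam * (r * cos t, r * sin t))))).
assert (Hw : forall t, w t = Rmax (A + r * phi t) 0).
{ intros t. unfold w, log_plus. rewrite Cmod_mult, Cmod_Cexp, ln_mult, ln_exp;
    [|exact Hcp|apply exp_pos].
  f_equal. unfold A, phi. f_equal. unfold Cmult; simpl. unfold Re, Im. ring. }
assert (Hphi : forall t, Rabs (phi t) <= G).
{ intros t. replace (phi t) with (Re (gam * cis 1 t)).
  - eapply Rle_trans; [apply re_le_Cmod|]. rewrite Cmod_mult, Cmod_cis. unfold G. lra.
  - unfold cis, Cexp, phi; simpl. rewrite exp_0, !Rmult_1_l. unfold Re, Im. ring. }
assert (Hwc : forall t, continuous w t).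
{ intros t. apply (continuous_ext (fun t => Rmax (A + r * phi t) 0)).
  { intros s. symmetry. apply Hw. }
  apply continuous_Rmax; [|apply continuous_const].
  apply (@ex_derive_continuous R_AbsRing R_NormedModule). unfold phi. auto_derive. trivial. }
assert (Hex : ex_RInt w 0 (2 * PI)) by (apply ex_RInt_cont; [lra|intros; apply Hwc]).
assert (HI := @RInt_correct R_CompleteNormedModule _ _ _ Hex).
set (I := RInt w 0 (2 * PI)).
change (A / 2 + r * G / 4 <= / (2 * PI) * I <= Rabs A + r * G).
assert (Hup : I <= (2 * PI - 0) * (Rabs A + r * G)).
{ apply (is_RInt_le w (fun _ => Rabs A + r * G) 0 (2 * PI)); [lra|exact HI| |].
  - apply (@is_RInt_const R_NormedModule).
  - intros t _. rewrite Hw. assert (K := Hphi t). apply Rabs_le_between in K.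
    assert (A1 := Rle_abs A). assert (A2 := Rabs_pos A).
    apply Rmax_lub; nra. }
assert (E2 : Re gam ^ 2 + Im gam ^ 2 = G ^ 2) by (unfold G; now rewrite Cmod2_alt).
assert (Hlow : 2 * PI * (A / 2) + r / (2 * G) * PI * (Re gam ^ 2 + Im gam ^ 2) <= I).
{ apply (is_RInt_le (fun t => A / 2 + (A / (2 * G) + r / 2) * (Re gam * cos t - Im gam * sin t)
     + r / (2 * G) * (Re gam * cos t - Im gam * sin t) ^ 2) w 0 (2 * PI)); [lra| |exact HI|].
  - apply is_RInt_sqr_linear_trig.
  - intros t _. rewrite Hw. fold (phi t). assert (K := Hphi t). apply Rabs_le_between in K.
    replace (A / 2 + (A / (2 * G) + r / 2) * phi t + r / (2 * G) * phi t ^ 2) with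
      ((A + r * phi t) * ((1 + phi t / G) / 2)) by (field; lra).
    assert (B : 0 <= (1 + phi t / G) / 2 <= 1).
    { assert (- 1 <= phi t / G <= 1); [|lra]. split.
      - apply Rmult_le_reg_r with G; trivial. unfold Rdiv. rewrite Rmult_assoc, Rinv_l; lra.
      - apply Rmult_le_reg_r with G; trivial. unfold Rdiv. rewrite Rmult_assoc, Rinv_l; lra. }
    assert (M1 := Rmax_l (A + r * phi t) 0). assert (M2 := Rmax_r (A + r * phi t) 0). nra. }
rewrite E2 in Hlow.
replace (2 * PI * (A / 2) + r / (2 * G) * PI * G ^ 2) with (2 * PI * (A / 2 + r * G / 4)) in Hlow
  by (field; lra).
split; apply Rmult_le_reg_l with (2 * PI); trivial;
  rewrite <- Rmult_assoc, Rinv_r, Rmult_1_l by lra; lra.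
Qed.

(** Here [ln T] differs from [ln r] by a bounded amount, so their quotient tends to 1 and the upper
    limit is a genuine limit. *)
Lemma order_linear_growth f a b : 0 < a -> 0 < b ->
  (exists R0, forall r, R0 < r -> a * r <= nevanlinna_T r f <= b * r) -> order f = Finite 1.
Proof.
intros Ha Hb [R0 H]. apply limsup_infty_lim. intros e He.
set (K := Rabs (ln a) + Rabs (ln b) + 1).
assert (A1 := Rabs_pos (ln a)). assert (A2 := Rabs_pos (ln b)).
assert (HK : 0 < K) by (unfold K; lra).
(* Beyond [1 / a] the characteristic exceeds 1, so [log_plus] is [ln]; beyond [exp (K / e)] the
   bounded error divided by [ln r] is below [e]. *)
exists (Rmax R0 (Rmax (/ a) (exp (K / e)))). intros r Hr.
assert (B1 := Rmax_l R0 (Rmax (/ a) (exp (K / e)))).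
assert (B2 := Rmax_r R0 (Rmax (/ a) (exp (K / e)))).
assert (B3 := Rmax_l (/ a) (exp (K / e))). assert (B4 := Rmax_r (/ a) (exp (K / e))).
destruct (H r ltac:(lra)) as [H1 H2]. assert (B5 := exp_pos (K / e)).
assert (Hr0 : 0 < r) by lra.
assert (Hln : K / e < ln r).
{ rewrite <- (ln_exp (K / e)). apply ln_increasing; lra. }
assert (HKe : 0 < K / e) by now apply Rdiv_lt_0_compat.
assert (Har : 1 < a * r).
{ apply Rmult_lt_reg_l with (/ a); [now apply Rinv_0_lt_compat|].
  rewrite <- Rmult_assoc, Rinv_l by lra. lra. }
set (T := nevanlinna_T r f) in *.
assert (HT1 : ln a + ln r <= ln T).
{ rewrite <- ln_mult by lra. apply ln_le; lra. }
assert (HT2 : ln T <= ln b + ln r).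
{ rewrite <- ln_mult by lra. apply ln_le; lra. }
assert (HT0 : 0 < ln T) by (rewrite <- ln_1; apply ln_increasing; lra).
unfold log_plus. rewrite Rmax_left by lra.
assert (L1 : Rabs (ln T - ln r) < K).
{ assert (C1 := Rle_abs (- ln a)). rewrite Rabs_Ropp in C1.
  assert (C2 := Rle_abs (ln b)). apply Rabs_def1; unfold K; lra. }
replace (ln T / ln r - 1) with ((ln T - ln r) / ln r) by (field; lra).
unfold Rdiv. rewrite Rabs_mult, (Rabs_pos_eq (/ ln r)) by (apply Rlt_le, Rinv_0_lt_compat; lra).
apply Rmult_lt_reg_r with (ln r); [lra|]. rewrite Rmult_assoc, Rinv_l by lra.
assert (K = K / e * e) by (field; lra).
assert (K / e * e < ln r * e) by (apply Rmult_lt_compat_r; lra). lra.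
Qed.

Lemma order_exp c gam : c <> RtoC 0 -> gam <> RtoC 0 ->
  order (fun z => (c * Cexp (gam * z))%C) = Finite 1.
Proof.
intros Hc Hg. assert (Hgp := proj1 (Cmod_gt_0 _) Hg).
set (A := ln (Cmod c)). assert (A1 := Rabs_pos A).
(* Half of the slope [|gam| / 4] absorbs the constant [A / 2] for large [r]; for the upper bound
   [|A| <= |A| r] once [r >= 1]. *)
apply (order_linear_growth _ (Cmod gam / 8) (Rabs A + Cmod gam)); [lra|lra|].
exists (Rmax 1 (4 * Rabs A / Cmod gam)). intros r Hr.
assert (M1 := Rmax_l 1 (4 * Rabs A / Cmod gam)).
assert (M2 := Rmax_r 1 (4 * Rabs A / Cmod gam)).
assert (B := nevanlinna_exp_bounds c gam r Hc Hg ltac:(lra)). fold A in B.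
assert (K : 4 * Rabs A <= r * Cmod gam).
{ replace (4 * Rabs A) with (4 * Rabs A / Cmod gam * Cmod gam) by (field; lra).
  apply Rmult_le_compat_r; lra. }
assert (A2 := Rle_abs (- A)). rewrite Rabs_Ropp in A2.
split; [lra|]. nra.
Qed.

(** * Exponential sums with polynomial coefficients *)

Lemma pow_exp_bounded (m : nat) (d : R) : 0 < d ->
  exists K, forall r, 0 <= r -> r ^ m * exp (- (d * r)) <= K.
Proof.
intros Hd. destruct m as [|m].
- exists 1. intros r Hr. simpl. rewrite Rmult_1_l, exp_Ropp.
  rewrite <- Rinv_1. apply Rinv_le_contravar; [lra|].
  assert (K := exp_ineq1_le (d * r)). nra.
- assert (HS : 0 < INR (S m)) by (apply lt_0_INR; lia).
  (* Comes from [exp y >= 1 + y] at [y = d * r / (m + 1)], raised to the power [m + 1]. *)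
  exists ((INR (S m) / d) ^ S m). intros r Hr.
  assert (E : exp (d * r) = exp (d * r / INR (S m)) ^ S m).
  { rewrite <- exp_INR_mult. f_equal. field. lra. }
  assert (K := exp_ineq1_le (d * r / INR (S m))).
  rewrite exp_Ropp. apply Rmult_le_reg_r with (exp (d * r)); [apply exp_pos|].
  rewrite Rmult_assoc, Rinv_l, Rmult_1_r by apply Rgt_not_eq, exp_pos.
  rewrite E, <- Rpow_mult_distr. apply pow_incr. split; trivial.
  replace r with (INR (S m) / d * (d * r / INR (S m))) at 1 by (field; lra).
  apply Rmult_le_compat_l; [|lra]. apply Rlt_le, Rdiv_lt_0_compat; trivial.
Qed.

Lemma is_polynomial_exp_decay p v (K : R) (d : nat) (del R0 : R) :
  is_polynomial p -> v <> RtoC 0 -> 0 < del -> 0 <= K ->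
  (forall r, R0 < r -> Cmod (p (RtoC r * v)%C) <= K * r ^ d * exp (- (del * r))) ->
  forall z, p z = RtoC 0.
Proof.
intros Hp Hv Hdel HK H. destruct (pow_exp_bounded (S d) del Hdel) as [B HB].
apply (is_polynomial_ray_zero p v (K * B) Hp Hv). intros A.
exists (Rmax A (Rmax R0 0) + 1).
assert (A1 := Rmax_l A (Rmax R0 0)). assert (A2 := Rmax_r A (Rmax R0 0)).
assert (A3 := Rmax_l R0 0). assert (A4 := Rmax_r R0 0).
set (r := Rmax A (Rmax R0 0) + 1) in *. split; [unfold r; lra|].
assert (Hr : 0 < r) by (unfold r; lra).
specialize (H r ltac:(unfold r; lra)). specialize (HB r ltac:(lra)).
apply Rle_trans with (r * (K * r ^ d * exp (- (del * r)))).
- apply Rmult_le_compat_l; lra.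
- replace (r * (K * r ^ d * exp (- (del * r)))) with (K * (r ^ S d * exp (- (del * r))))
    by (simpl; ring).
  now apply Rmult_le_compat_l.
Qed.

Lemma is_polynomial_ray_growth p v : is_polynomial p ->
  exists K d, 0 <= K /\ forall r, 1 <= r -> Cmod (p (RtoC r * v)%C) <= K * r ^ d.
Proof.
revert p. apply is_polynomial_ind.
- intros p q He [K [d [HK H]]]. exists K, d. split; trivial. intros r. rewrite <- He. apply H.
- intros a. exists (Cmod a), 0%nat. split; [apply Cmod_ge_0|]. intros r _. simpl. lra.
- intros a p _ [K [d [HK H]]]. exists (Cmod a + Cmod v * K), (S d).
  assert (A1 := Cmod_ge_0 a). assert (A2 := Cmod_ge_0 v).
  split; [nra|]. intros r Hr.
  eapply Rle_trans; [apply Cmod_triangle|]. rewrite !Cmod_mult, Cmod_R, Rabs_pos_eq by lra.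
  assert (1 <= r ^ S d) by (apply pow_R1_Rle; trivial).
  specialize (H r Hr).
  assert (r * Cmod v * Cmod (p (RtoC r * v)%C) <= r * Cmod v * (K * r ^ d)).
  { apply Rmult_le_compat_l; trivial. nra. }
  assert (Cmod a * 1 <= Cmod a * r ^ S d) by now apply Rmult_le_compat_l.
  simpl in *. lra.
Qed.

Definition exp_sum (l : list (C * (C -> C))) (z : C) : C :=
  fold_right (fun p s => snd p z * Cexp (fst p * z) + s)%C (RtoC 0) l.

Lemma exp_sum_app l1 l2 z : exp_sum (l1 ++ l2) z = (exp_sum l1 z + exp_sum l2 z)%C.
Proof.
induction l1 as [|p l1 IH]; simpl; [ring|]. rewrite IH. ring.
Qed.

(** A finite list turns the strict inequalities into one gap [rho < Lam], and this gap is the rate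
    of exponential decay used in [exp_sum_indep]. *)
Lemma exp_sum_ray_growth l v (Lam : R) :
  (forall p, In p l -> is_polynomial (snd p) /\ Re (fst p * v) < Lam) ->
  exists K d rho, 0 <= K /\ rho < Lam /\ forall r, 1 <= r ->
    Cmod (exp_sum l (RtoC r * v)) <= K * r ^ d * exp (rho * r).
Proof.
induction l as [|p l IH]; intros H.
- exists 0, 0%nat, (Lam - 1). split; [lra|]. split; [lra|]. intros r _. simpl.
  rewrite Cmod_0. lra.
- destruct IH as [K [d [rho [HK [Hrho Hl]]]]]; [intros q Hq; apply H; now right|].
  destruct (H p ltac:(now left)) as [Hp Hre].
  destruct (is_polynomial_ray_growth (snd p) v Hp) as [K' [d' [HK' Hp']]].
  set (rho' := Rmax rho (Re (fst p * v))).
  assert (M1 := Rmax_l rho (Re (fst p * v))). assert (M2 := Rmax_r rho (Re (fst p * v))).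
  exists (K + K'), (Nat.max d d'), rho'. split; [lra|].
  split; [now apply Rmax_lub_lt|]. intros r Hr. specialize (Hl r Hr). specialize (Hp' r Hr).
  simpl. eapply Rle_trans; [apply Cmod_triangle|]. rewrite Cmod_mult, Cmod_Cexp.
  replace (Re (fst p * (RtoC r * v))) with (Re (fst p * v) * r).
  2: { replace (fst p * (RtoC r * v))%C with (RtoC r * (fst p * v))%C by ring.
    rewrite re_scal_l. ring. }
  assert (E1 : exp (Re (fst p * v) * r) <= exp (rho' * r)) by (apply exp_le; unfold rho'; nra).
  assert (E2 : exp (rho * r) <= exp (rho' * r)) by (apply exp_le; unfold rho'; nra).
  assert (D1 : r ^ d <= r ^ Nat.max d d') by (apply Rle_pow; trivial; lia).
  assert (D2 : r ^ d' <= r ^ Nat.max d d') by (apply Rle_pow; trivial; lia).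
  assert (X1 := exp_pos (Re (fst p * v) * r)). assert (X2 := exp_pos (rho * r)).
  assert (Y1 : 0 <= r ^ d) by (apply pow_le; lra).
  assert (Y2 : 0 <= r ^ d') by (apply pow_le; lra).
  rewrite (Rmult_plus_distr_r K K'), Rmult_plus_distr_r, Rplus_comm. apply Rplus_le_compat.
  + eapply Rle_trans; [exact Hl|]. apply Rmult_le_compat; try lra; [nra|].
    now apply Rmult_le_compat_l.
  + apply Rmult_le_compat; try lra; [apply Cmod_ge_0|].
    eapply Rle_trans; [exact Hp'|]. now apply Rmult_le_compat_l.
Qed.

Lemma exists_max_Cmod (l : list (C * (C -> C))) : l <> nil ->
  exists p, In p l /\ forall q, In q l -> Cmod (fst q) <= Cmod (fst p).
Proof.
induction l as [|p l IH]; [easy|]. intros _.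
destruct l as [|p' l'].
- exists p. split; [now left|]. intros q [->|[]]. lra.
- destruct IH as [m [Hm H]]; [easy|].
  destruct (Rle_lt_dec (Cmod (fst m)) (Cmod (fst p))) as [L|L].
  + exists p. split; [now left|]. intros q [->|Hq]; [lra|].
    eapply Rle_trans; [now apply H|exact L].
  + exists m. split; [now right|]. intros q [->|Hq]; [lra|]. now apply H.
Qed.

(* The exponent of largest modulus strictly dominates all others in the
   direction of its conjugate. *)
Lemma Re_mult_conj_lt (lam mu : C) : Cmod mu <= Cmod lam -> mu <> lam ->
  Re (mu * Cconj lam) < Cmod lam ^ 2.
Proof.
intros Hle Hne.
assert (H : 0 < Cmod (lam - mu) ^ 2).
{ apply pow_lt, Cmod_gt_0. intros E. apply Hne. symmetry. now apply Ceq_minus. }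
assert (K : Cmod mu ^ 2 <= Cmod lam ^ 2) by (apply pow_incr; split; trivial; apply Cmod_ge_0).
rewrite Cmod2_alt in H. rewrite !Cmod2_alt in K. rewrite Cmod2_alt.
destruct lam as [a b]. destruct mu as [c d]. unfold Re, Im in *. simpl in *. nra.
Qed.

(** In the direction conjugate to the exponent of largest modulus, that term outgrows all the others
    exponentially. Its polynomial coefficient must then decay exponentially along a ray, hence
    vanish; the term is removed and the list shortens. *)
Lemma exp_sum_indep l : NoDup (map fst l) -> (forall p, In p l -> is_polynomial (snd p)) ->
  (forall z, exp_sum l z = RtoC 0) -> forall p, In p l -> forall z, snd p z = RtoC 0.
Proof.
remember (length l) as n eqn:Hn. revert l Hn.
induction n as [|n IH]; intros l Hn Hnd Hpol Hz p Hp.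
- destruct l; [destruct Hp|discriminate].
- destruct (exists_max_Cmod l) as [m [Hm Hmax]]; [intros ->; discriminate|].
  destruct (in_split _ _ Hm) as [l1 [l2 El]].
  assert (Hsum : forall z, (snd m z * Cexp (fst m * z) + exp_sum (l1 ++ l2) z)%C = RtoC 0).
  { intros z. rewrite <- (Hz z), El, !exp_sum_app. simpl. ring. }
  assert (Hnd' : NoDup (map fst (l1 ++ l2)) /\ ~ In (fst m) (map fst (l1 ++ l2))).
  { rewrite El, map_app in Hnd. simpl in Hnd. rewrite map_app.
    split; [now apply NoDup_remove_1 in Hnd|now apply NoDup_remove_2 in Hnd]. }
  assert (Hin : forall q, In q (l1 ++ l2) -> In q l).
  { intros q Hq. rewrite El. apply in_app_iff in Hq. apply in_app_iff. simpl. tauto. }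
  assert (Hm0 : forall z, snd m z = RtoC 0).
  (* A zero exponent has no conjugate direction. Being of largest modulus it forces all exponents to
     be 0, so by distinctness it stands alone. *)
  { destruct (Ceq_dec (fst m) (RtoC 0)) as [E|E].
    - assert (Enil : l1 ++ l2 = nil).
      { destruct (l1 ++ l2) as [|q l'] eqn:El'; trivial. exfalso.
        apply (proj2 Hnd'). left. rewrite E. apply Cmod_eq_0.
        assert (K := Hmax q (Hin q ltac:(now left))). rewrite E, Cmod_0 in K.
        apply Rle_antisym; trivial. apply Cmod_ge_0. }
      intros z. specialize (Hsum z). rewrite Enil in Hsum. simpl in Hsum.
      rewrite Cplus_0_r in Hsum.
      replace (snd m z) with (snd m z * Cexp (fst m * z) / Cexp (fst m * z))%C
        by (field; apply Cexp_neq_0).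
      rewrite Hsum. field. apply Cexp_neq_0.
    - set (v := Cconj (fst m)).
      assert (Hv : v <> RtoC 0).
      { intros Ev. apply E. apply Cmod_eq_0. rewrite <- Cmod_conj. fold v. rewrite Ev. apply Cmod_0. }
      destruct (exp_sum_ray_growth (l1 ++ l2) v (Cmod (fst m) ^ 2)) as
        [K [d [rho [HK [Hrho Hgr]]]]].
      { intros q Hq. split; [now apply Hpol, Hin|]. apply Re_mult_conj_lt; [now apply Hmax, Hin|].
        intros Eq. apply (proj2 Hnd'). rewrite <- Eq. now apply in_map. }
      apply (is_polynomial_exp_decay (snd m) v K d (Cmod (fst m) ^ 2 - rho) 1); trivial.
      + now apply Hpol.
      + lra.
      + intros r Hr. specialize (Hgr r ltac:(lra)). specialize (Hsum (RtoC r * v)%C).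
        assert (Ee : Cmod (Cexp (fst m * (RtoC r * v))) = exp (Cmod (fst m) ^ 2 * r)).
        { rewrite Cmod_Cexp. f_equal.
          replace (fst m * (RtoC r * v))%C with (RtoC r * (fst m * Cconj (fst m)))%C
            by (unfold v; ring).
          rewrite <- Cmod2_conj, re_scal_l. simpl. ring. }
        assert (Eq : Cmod (snd m (RtoC r * v)%C) * exp (Cmod (fst m) ^ 2 * r) =
          Cmod (exp_sum (l1 ++ l2) (RtoC r * v))).
        { rewrite <- Ee, <- Cmod_mult, <- (Cmod_opp (exp_sum _ _)). f_equal.
          apply Ceq_minus. rewrite <- Hsum. ring. }
        apply Rmult_le_reg_r with (exp (Cmod (fst m) ^ 2 * r)); [apply exp_pos|].
        rewrite Eq. rewrite (Rmult_assoc (K * r ^ d)), <- exp_plus.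
        replace (- ((Cmod (fst m) ^ 2 - rho) * r) + Cmod (fst m) ^ 2 * r) with (rho * r) by ring.
        exact Hgr. }
  assert (Hcase : p = m \/ In p (l1 ++ l2)).
  { rewrite El in Hp. apply in_app_iff in Hp. rewrite in_app_iff. simpl in Hp.
    destruct Hp as [Hp|[Hp|Hp]]; auto. }
  destruct Hcase as [->|Hp']; [exact Hm0|].
  apply (IH (l1 ++ l2)); trivial.
  + rewrite El in Hn. rewrite length_app in *. simpl in Hn. lia.
  + apply Hnd'.
  + intros q Hq. now apply Hpol, Hin.
  + intros z. rewrite <- (Hsum z), Hm0. ring.
Qed.

(** * The differential-difference equation *)

(** Differentiation keeps the exponential factor and sends [Pk] to [Pk' + Pk * Q']. *)
Lemma C_derive_n_poly_exp P Q k : is_polynomial P -> is_polynomial Q ->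
  exists Pk, is_polynomial Pk /\
    forall f, (forall z, f z = (P z * Cexp (Q z))%C) ->
    forall z, C_derive_n f k z = (Pk z * Cexp (Q z))%C.
Proof.
intros HP HQ. destruct (is_polynomial_deriv Q HQ) as [Q' [HQ' DQ]].
induction k as [|k [Pk [HPk IH]]].
- exists P. split; trivial.
- destruct (is_polynomial_deriv Pk HPk) as [P' [HP' DP]].
  exists (fun z => P' z + Pk z * Q' z)%C. split.
  + apply is_polynomial_plus; trivial. now apply is_polynomial_mult.
  + intros f Hf z. change (C_derive_n f (S k) z) with (C_derive (C_derive_n f k) z).
    apply cderiv_unique. apply cderiv_ext with (fun z => Pk z * Cexp (Q z))%C.
    { intros w. symmetry. now apply IH. }
    replace ((P' z + Pk z * Q' z) * Cexp (Q z))%C with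
      (P' z * Cexp (Q z) + Pk z * (Cexp (Q z) * Q' z))%C by ring.
    apply (cderiv_mult Pk (fun w => Cexp (Q w))); trivial.
    apply (cderiv_comp Cexp Q); trivial. apply cderiv_Cexp.
Qed.

Lemma C_derive_n_exp (c gam : C) k f : (forall z, f z = (c * Cexp (gam * z))%C) ->
  forall z, C_derive_n f k z = (c * gam ^ k * Cexp (gam * z))%C.
Proof.
intros Hf. induction k as [|k IH]; intros z.
- rewrite Cmult_1_r. apply Hf.
- change (C_derive_n f (S k) z) with (C_derive (C_derive_n f k) z).
  apply cderiv_unique. apply cderiv_ext with (fun z => c * gam ^ k * Cexp (gam * z))%C.
  { intros w. symmetry. apply IH. }
  replace (c * gam ^ S k * Cexp (gam * z))%C with
    (RtoC 0 * Cexp (gam * z) + c * gam ^ k * (Cexp (gam * z) * gam))%C by (simpl; ring).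
  apply (cderiv_mult (fun _ => c * gam ^ k)%C (fun w => Cexp (gam * w))); [apply cderiv_const|].
  apply (cderiv_comp Cexp (fun w => gam * w)%C); [apply cderiv_Cexp|apply cderiv_scal].
Qed.

(** The leading powers cancel, so a shift costs one degree less than the power itself; the exponents
    [Q (z + beta)] and [Q z] thus differ by a lower order term. *)
Lemma pow_shift_diff (b v : C) (m : nat) : exists K, 0 <= K /\ forall r, 1 <= r ->
  Cmod ((RtoC r * v + b) ^ S m - (RtoC r * v) ^ S m) <= K * r ^ m.
Proof.
assert (Hv := Cmod_ge_0 v). assert (Hb := Cmod_ge_0 b).
induction m as [|m [K [HK H]]].
- exists (Cmod b). split; [apply Cmod_ge_0|]. intros r _. rewrite !Cpow_1_r.
  replace (RtoC r * v + b - RtoC r * v)%C with b by ring. simpl. lra.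
- exists ((Cmod v + Cmod b) * K + Cmod b * Cmod v ^ S m).
  assert (Hvm : 0 <= Cmod v ^ S m) by now apply pow_le.
  split; [nra|]. intros r Hr. specialize (H r Hr).
  replace ((RtoC r * v + b) ^ S (S m) - (RtoC r * v) ^ S (S m))%C with
    ((RtoC r * v + b) * ((RtoC r * v + b) ^ S m - (RtoC r * v) ^ S m) +
     b * (RtoC r * v) ^ S m)%C by (rewrite !(Cpow_S _ (S m)); ring).
  eapply Rle_trans; [apply Cmod_triangle|].
  rewrite !Cmod_mult, Cmod_pow, Cmod_mult, Cmod_R, Rabs_pos_eq, Rpow_mult_distr by lra.
  assert (Hr0 : 0 <= r ^ m) by (apply pow_le; lra).
  assert (E : Cmod (RtoC r * v + b) <= (Cmod v + Cmod b) * r).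
  { eapply Rle_trans; [apply Cmod_triangle|]. rewrite Cmod_mult, Cmod_R, Rabs_pos_eq by lra.
    nra. }
  assert (E2 : Cmod (RtoC r * v + b) * Cmod ((RtoC r * v + b) ^ S m - (RtoC r * v) ^ S m)
    <= (Cmod v + Cmod b) * r * (K * r ^ m)).
  { apply Rmult_le_compat; trivial; apply Cmod_ge_0. }
  simpl pow in *. lra.
Qed.

Lemma cpoly_shift_diff (c : nat -> C) (b v : C) (n : nat) : exists K, 0 <= K /\ forall r, 1 <= r ->
  Cmod (cpoly c (S n) (RtoC r * v + b) - cpoly c (S n) (RtoC r * v)) <= K * r ^ n.
Proof.
induction n as [|n [K [HK H]]].
- exists (Cmod (c 1%nat * b)). split; [apply Cmod_ge_0|]. intros r _.
  rewrite !cpoly_S, !cpoly_0, !Cpow_1_r.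
  replace (c 0%nat + c 1%nat * (RtoC r * v + b) - (c 0%nat + c 1%nat * (RtoC r * v)))%C
    with (c 1%nat * b)%C by ring. simpl. lra.
- destruct (pow_shift_diff b v (S n)) as [K' [HK' H']].
  exists (K + Cmod (c (S (S n))) * K'). assert (A := Cmod_ge_0 (c (S (S n)))).
  split; [nra|]. intros r Hr. specialize (H r Hr). specialize (H' r Hr).
  rewrite !(cpoly_S c (S n)).
  match goal with |- Cmod ?x <= _ => replace x with
   ((cpoly c (S n) (RtoC r * v + b) - cpoly c (S n) (RtoC r * v)) +
    c (S (S n)) * ((RtoC r * v + b) ^ S (S n) - (RtoC r * v) ^ S (S n)))%C by ring end.
  eapply Rle_trans; [apply Cmod_triangle|]. rewrite Cmod_mult.
  assert (K * r ^ n <= K * r ^ S n).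
  { apply Rmult_le_compat_l; trivial. apply Rle_pow; trivial. lia. }
  assert (Cmod (c (S (S n))) * Cmod ((RtoC r * v + b) ^ S (S n) - (RtoC r * v) ^ S (S n)) <=
    Cmod (c (S (S n))) * (K' * r ^ S n)) by now apply Rmult_le_compat_l.
  lra.
Qed.

Lemma cpoly_ray_growth (c : nat -> C) (v : C) (n : nat) : exists K, 0 <= K /\ forall r, 1 <= r ->
  Cmod (cpoly c n (RtoC r * v)) <= K * r ^ n.
Proof.
induction n as [|n [K [HK H]]].
- exists (Cmod (c 0%nat)). split; [apply Cmod_ge_0|]. intros r _. rewrite cpoly_0. simpl. lra.
- exists (K + Cmod (c (S n)) * Cmod v ^ S n).
  assert (0 <= Cmod (c (S n)) * Cmod v ^ S n).
  { apply Rmult_le_pos; [apply Cmod_ge_0|apply pow_le, Cmod_ge_0]. }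
  split; [lra|]. intros r Hr. specialize (H r Hr). rewrite cpoly_S.
  eapply Rle_trans; [apply Cmod_triangle|].
  rewrite Cmod_mult, Cmod_pow, Cmod_mult, Cmod_R, Rabs_pos_eq, Rpow_mult_distr by lra.
  assert (K * r ^ n <= K * r ^ S n).
  { apply Rmult_le_compat_l; trivial. apply Rle_pow; trivial. lia. }
  lra.
Qed.

Lemma is_polynomial_degree p : is_polynomial p ->
  (forall z, p z = p (RtoC 0)) \/
  exists n c, c (S n) <> RtoC 0 /\ forall z, p z = cpoly c (S n) z.
Proof.
intros [n [c Hp]]. revert Hp. induction n as [|n IH]; intros Hp.
- left. intros z. rewrite !Hp. change (cpoly c 0 z = cpoly c 0 (RtoC 0)). now rewrite !cpoly_0.
- destruct (Ceq_dec (c (S n)) (RtoC 0)) as [E|E].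
  + apply IH. intros z. rewrite Hp. change (cpoly c (S n) z = cpoly c n z).
    rewrite cpoly_S, E. ring.
  + right. now exists n, c.
Qed.

(** Supplies the ray along which the leading term [c (r v) ^ (n + 1)] is exactly [r ^ (n + 1)]. *)
Lemma exists_root_inverse (c : C) (n : nat) : c <> RtoC 0 ->
  exists v, v <> RtoC 0 /\ (c * v ^ S n)%C = RtoC 1.
Proof.
intros Hc. destruct (Cexp_surj c Hc) as [l Hl].
exists (Cexp (- (l / RtoC (INR (S n))))). split; [apply Cexp_neq_0|].
assert (Hn : RtoC (INR (S n)) <> RtoC 0).
{ intros E. apply RtoC_inj in E. apply not_0_INR in E; trivial. lia. }
rewrite Cexp_pow.
replace (RtoC (INR (S n)) * - (l / RtoC (INR (S n))))%C with (- l)%C by (field; exact Hn).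
rewrite Cexp_opp, Hl. field. exact Hc.
Qed.

(* In the direction where the leading term of [Q] is positive, [exp (2 Q)]
   outgrows both [exp (Q (z + beta))] and every [exp (alpha z)]. *)
Lemma exponent_degree_le_1 (P B : C -> C) (q : nat -> C) (n : nat) (p1 p2 al1 al2 be : C) :
  is_polynomial P -> is_polynomial B -> q (S (S n)) <> RtoC 0 ->
  (forall z, ((P z * Cexp (cpoly q (S (S n)) z)) ^ 2 + B z * Cexp (cpoly q (S (S n)) (z + be))
    = p1 * Cexp (al1 * z) + p2 * Cexp (al2 * z))%C) ->
  forall z, P z = RtoC 0.
Proof.
intros HP HB Hq Heq.
enough (Hsq : forall z, (P z * P z)%C = RtoC 0).
{ intros z. destruct (Ceq_dec (P z) (RtoC 0)) as [E|E]; trivial.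
  exfalso. exact (Cmult_neq_0 _ _ E E (Hsq z)). }
destruct (exists_root_inverse _ (S n) Hq) as [v [Hv Hv1]].
set (N := S (S n)) in *. set (Q := cpoly q N) in *.
destruct (cpoly_ray_growth q v (S n)) as [K1 [HK1 HQ1]].
destruct (cpoly_shift_diff q be v (S n)) as [K2 [HK2 HQ2]].
destruct (is_polynomial_ray_growth B v HB) as [K3 [d [HK3 HB3]]].
set (a := Rmax (Cmod (al1 * v)) (Cmod (al2 * v))).
assert (Ha1 := Rmax_l (Cmod (al1 * v)) (Cmod (al2 * v))).
assert (Ha2 := Rmax_r (Cmod (al1 * v)) (Cmod (al2 * v))). fold a in Ha1, Ha2.
assert (Ha0 : 0 <= a) by (eapply Rle_trans; [apply Cmod_ge_0|exact Ha1]).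
set (K := Cmod p1 + Cmod p2 + K3).
assert (B1 := Cmod_ge_0 p1). assert (B2 := Cmod_ge_0 p2).
(* The threshold on [r] collects every competitor of the leading term: [a] for the exponentials on
   the right, [2 * K1] for the lower part of [Q] counted twice, [K2] for the shift, and a margin of
   2 that yields the decay rate 1. *)
apply (is_polynomial_exp_decay (fun z => P z * P z)%C v K d 1 (a + 2 * K1 + K2 + 2)).
{ now apply is_polynomial_mult. }
{ exact Hv. } { lra. } { unfold K; lra. }
intros r Hr. assert (Hr1 : 1 <= r) by lra.
specialize (HQ1 r Hr1). specialize (HQ2 r Hr1). specialize (HB3 r Hr1).
set (z := (RtoC r * v)%C) in *. specialize (Heq z).
assert (HQz : (Q z = RtoC (r ^ N) + cpoly q (S n) z)%C).
{ unfold Q, N. rewrite cpoly_S. unfold z. rewrite Cpow_mult_l. fold N.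
  replace (q N * (RtoC r ^ N * v ^ N))%C with (RtoC r ^ N * (q N * v ^ N))%C by ring.
  rewrite Hv1, RtoC_pow. ring. }
(* The leading term of [Q] is [r * x]. Degree at least 2 is used in [r <= x]: the exponents
   [alpha z], of size [r], and the shift, of size [x], are both negligible against [r * x]. *)
set (x := r ^ S n) in *.
assert (Hx : 1 <= x) by now apply pow_R1_Rle.
assert (Hxr : r <= x).
{ unfold x. rewrite <- (pow_1 r) at 1. apply Rle_pow; trivial. lia. }
assert (HN : r ^ N = r * x) by reflexivity.
assert (HReQ : r * x - K1 * x <= Re (Q z)).
{ rewrite HQz, re_plus, HN. assert (L := re_le_Cmod (cpoly q (S n) z)).
  apply Rabs_le_between in L. simpl Re. simpl in *. lra. }
assert (HReS : Re (Q (z + be)%C) <= Re (Q z) + K2 * x).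
{ change (Cmod (Q (z + be)%C - Q z) <= K2 * x) in HQ2.
  assert (L := re_le_Cmod (Q (z + be)%C - Q z)). apply Rabs_le_between in L.
  replace (Re (Q (z + be)%C - Q z)) with (Re (Q (z + be)%C) - Re (Q z)) in L by reflexivity.
  lra. }
(* The equation solved for [P ^ 2], after division by [exp (2 Q)]. *)
assert (HE : (P z * P z = p1 * Cexp (al1 * z - 2 * Q z) + p2 * Cexp (al2 * z - 2 * Q z)
  - B z * Cexp (Q (z + be)%C - 2 * Q z))%C).
{ rewrite !Cexp_minus. replace (RtoC 2 * Q z)%C with (Q z + Q z)%C by ring.
  rewrite Cexp_plus.
  replace (p1 * (Cexp (al1 * z) / (Cexp (Q z) * Cexp (Q z))) +
     p2 * (Cexp (al2 * z) / (Cexp (Q z) * Cexp (Q z))) -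
     B z * (Cexp (Q (z + be)) / (Cexp (Q z) * Cexp (Q z))))%C with
   ((p1 * Cexp (al1 * z) + p2 * Cexp (al2 * z) - B z * Cexp (Q (z + be))) /
    (Cexp (Q z) * Cexp (Q z)))%C by (field; apply Cexp_neq_0).
  rewrite <- Heq. field. apply Cexp_neq_0. }
rewrite HE.
assert (Hal : forall al, Cmod (al * v) <= a -> exp (Re (al * z - 2 * Q z)) <= exp (- (1 * r))).
{ intros al Hal. apply exp_le.
  replace (Re (al * z - 2 * Q z)) with (Re (al * z) - 2 * Re (Q z))
    by (unfold Cminus; rewrite re_plus, re_opp, re_scal_l; ring).
  assert (Hz : Re (al * z) <= a * r).
  { replace (al * z)%C with (RtoC r * (al * v))%C by (unfold z; ring). rewrite re_scal_l.
    assert (L := re_le_Cmod (al * v)). apply Rabs_le_between in L. nra. }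
  assert (a * r <= a * x) by now apply Rmult_le_compat_l.
  assert ((a + 2 * K1 + K2 + 2) * x <= r * x) by (apply Rmult_le_compat_r; lra).
  assert (0 <= K1 * x) by (apply Rmult_le_pos; lra).
  assert (0 <= K2 * x) by (apply Rmult_le_pos; lra).
  assert (0 <= r * x) by (apply Rmult_le_pos; lra).
  lra. }
assert (HbQ : exp (Re (Q (z + be)%C - 2 * Q z)) <= exp (- (1 * r))).
{ apply exp_le.
  replace (Re (Q (z + be)%C - 2 * Q z)) with (Re (Q (z + be)%C) - 2 * Re (Q z))
    by (unfold Cminus; rewrite re_plus, re_opp, re_scal_l; ring).
  assert ((a + 2 * K1 + K2 + 2) * x <= r * x) by (apply Rmult_le_compat_r; lra).
  assert (0 <= a * x) by (apply Rmult_le_pos; lra).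
  assert (0 <= K1 * x) by (apply Rmult_le_pos; lra).
  lra. }
assert (Hrd : 1 <= r ^ d) by now apply pow_R1_Rle.
assert (X := exp_pos (- (1 * r))). set (ee := exp (- (1 * r))) in *.
eapply Rle_trans; [apply Cmod_triangle|]. rewrite Cmod_opp.
eapply Rle_trans; [apply Rplus_le_compat_r, Cmod_triangle|].
rewrite !Cmod_mult, !Cmod_Cexp.
assert (T1 : Cmod p1 * exp (Re (al1 * z - 2 * Q z)) <= Cmod p1 * (r ^ d * ee)).
{ apply Rmult_le_compat_l; trivial. apply Rle_trans with ee; [now apply Hal|]. nra. }
assert (T2 : Cmod p2 * exp (Re (al2 * z - 2 * Q z)) <= Cmod p2 * (r ^ d * ee)).
{ apply Rmult_le_compat_l; trivial. apply Rle_trans with ee; [now apply Hal|]. nra. }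
assert (T3 : Cmod (B z) * exp (Re (Q (z + be)%C - 2 * Q z)) <= K3 * r ^ d * ee).
{ apply Rmult_le_compat; trivial; [apply Cmod_ge_0|apply Rlt_le, exp_pos]. }
unfold K. lra.
Qed.

(** By independence, an exponent that meets no other has zero coefficient. Since [P], [p1] and [p2]
    are nonzero, each of [2 gam], [alpha1], [alpha2] must meet another one, and [2 gam <> gam]
    leaves two pairings. *)
Lemma exponents_match (P B : C -> C) (gam p1 p2 al1 al2 : C) :
  is_polynomial P -> is_polynomial B -> (exists z, P z <> RtoC 0) ->
  p1 <> RtoC 0 -> p2 <> RtoC 0 -> gam <> RtoC 0 -> al1 <> al2 ->
  (forall z, (P z * Cexp ((2 * gam) * z) + B z * Cexp (gam * z)
    = p1 * Cexp (al1 * z) + p2 * Cexp (al2 * z))%C) ->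
  (2 * gam = al1 /\ gam = al2 /\ forall z, P z = p1)%C \/
  (2 * gam = al2 /\ gam = al1 /\ forall z, P z = p2)%C.
Proof.
intros HP HB [z0 Hz0] Hp1 Hp2 Hg Hal Heq.
assert (H2g : (2 * gam)%C <> gam).
{ intros E. apply Hg. replace gam with (2 * gam - gam)%C by ring. rewrite E. ring. }
assert (Hc := is_polynomial_const).
destruct (Ceq_dec (2 * gam)%C al1) as [E1|E1]; [|destruct (Ceq_dec (2 * gam)%C al2) as [E2|E2]].
- left. split; [exact E1|].
  destruct (Ceq_dec gam al2) as [E3|E3].
  + split; trivial. intros z. apply Ceq_minus.
    apply (exp_sum_indep ((al1, fun z => P z - p1) :: (al2, fun z => B z - p2) :: nil)%C
      ) with (p := (al1, fun z => P z - p1)%C); [| | |now left].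
    * simpl. repeat constructor; simpl; intuition congruence.
    * simpl. intros p [<-|[<-|[]]]; apply is_polynomial_minus; auto.
    * intros w. cbn [exp_sum fold_right fst snd]. specialize (Heq w). rewrite E1, E3 in Heq.
      apply Ceq_minus in Heq. refine (eq_trans _ Heq). ring.
  + exfalso. apply Hp2.
    replace p2 with (- (- p2))%C by ring.
    replace (- p2)%C with (RtoC 0); [ring|symmetry].
    refine (exp_sum_indep ((al1, fun z => P z - p1) :: (gam, B) :: (al2, fun z => - p2) :: nil)%C
      _ _ _ (al2, fun _ => - p2)%C _ z0); [| | |simpl; auto].
    * simpl. repeat constructor; simpl; intuition congruence.
    * simpl. intros p [<-|[<-|[<-|[]]]]; try apply is_polynomial_minus; simpl; auto.
    * intros w. cbn [exp_sum fold_right fst snd]. specialize (Heq w). rewrite E1 in Heq.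
      apply Ceq_minus in Heq. refine (eq_trans _ Heq). ring.
- right. split; [exact E2|].
  destruct (Ceq_dec gam al1) as [E3|E3].
  + split; trivial. intros z. apply Ceq_minus.
    apply (exp_sum_indep ((al2, fun z => P z - p2) :: (al1, fun z => B z - p1) :: nil)%C
      ) with (p := (al2, fun z => P z - p2)%C); [| | |now left].
    * simpl. repeat constructor; simpl; intuition congruence.
    * simpl. intros p [<-|[<-|[]]]; apply is_polynomial_minus; auto.
    * intros w. cbn [exp_sum fold_right fst snd]. specialize (Heq w). rewrite E2, E3 in Heq.
      apply Ceq_minus in Heq. refine (eq_trans _ Heq). ring.
  + exfalso. apply Hp1.
    replace p1 with (- (- p1))%C by ring.
    replace (- p1)%C with (RtoC 0); [ring|symmetry].
    refine (exp_sum_indep ((al2, fun z => P z - p2) :: (gam, B) :: (al1, fun z => - p1) :: nil)%C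
      _ _ _ (al1, fun _ => - p1)%C _ z0); [| | |simpl; auto].
    * simpl. repeat constructor; simpl; intuition congruence.
    * simpl. intros p [<-|[<-|[<-|[]]]]; try apply is_polynomial_minus; simpl; auto.
    * intros w. cbn [exp_sum fold_right fst snd]. specialize (Heq w). rewrite E2 in Heq.
      apply Ceq_minus in Heq. refine (eq_trans _ Heq). ring.
(* Here [2 gam] meets neither exponent on the right, so [P] would vanish. The subcases only serve to
   list distinct exponents. *)
- exfalso. apply Hz0.
  destruct (Ceq_dec gam al1) as [E3|E3]; [|destruct (Ceq_dec gam al2) as [E4|E4]].
  + apply (exp_sum_indep (((2 * gam)%C, P) :: (al1, fun z => B z - p1)%C ::
      (al2, fun _ => - p2)%C :: nil)) with (p := ((2 * gam)%C, P)); [| | |now left].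
    * simpl. repeat constructor; simpl; intuition congruence.
    * simpl. intros p [<-|[<-|[<-|[]]]]; try apply is_polynomial_minus; simpl; auto.
    * intros w. cbn [exp_sum fold_right fst snd]. specialize (Heq w). rewrite E3 in Heq. rewrite E3.
      apply Ceq_minus in Heq. refine (eq_trans _ Heq). ring.
  + apply (exp_sum_indep (((2 * gam)%C, P) :: (al2, fun z => B z - p2)%C ::
      (al1, fun _ => - p1)%C :: nil)) with (p := ((2 * gam)%C, P)); [| | |now left].
    * simpl. repeat constructor; simpl; intuition congruence.
    * simpl. intros p [<-|[<-|[<-|[]]]]; try apply is_polynomial_minus; simpl; auto.
    * intros w. cbn [exp_sum fold_right fst snd]. specialize (Heq w). rewrite E4 in Heq. rewrite E4.
      apply Ceq_minus in Heq. refine (eq_trans _ Heq). ring.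
  + apply (exp_sum_indep (((2 * gam)%C, P) :: (gam, B) :: (al1, fun _ => - p1)%C ::
      (al2, fun _ => - p2)%C :: nil)) with (p := ((2 * gam)%C, P)); [| | |now left].
    * simpl. repeat constructor; simpl; intuition congruence.
    * simpl. intros p [<-|[<-|[<-|[<-|[]]]]]; simpl; auto.
    * intros w. cbn [exp_sum fold_right fst snd]. specialize (Heq w).
      apply Ceq_minus in Heq. refine (eq_trans _ Heq). ring.
Qed.

Lemma solution_form (p1 p2 alpha1 alpha2 beta : C) (a : C -> C) (k : nat) (f : C -> C) :
  p1 <> RtoC 0 -> p2 <> RtoC 0 -> alpha1 <> alpha2 ->
  is_polynomial a -> transcendental_entire f -> finite_order f -> finitely_many_zeros f ->
  (forall z : C, (f z ^ 2 + a z * C_derive_n f k (z + beta)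
       = p1 * Cexp (alpha1 * z) + p2 * Cexp (alpha2 * z))%C) ->
  exists c gam, gam <> RtoC 0 /\ (forall z, f z = (c * Cexp (gam * z))%C) /\
    ((2 * gam = alpha1 /\ gam = alpha2 /\ c ^ 2 = p1)%C \/
     (2 * gam = alpha2 /\ gam = alpha1 /\ c ^ 2 = p2)%C).
Proof.
intros Hp1 Hp2 Hal Ha [Hent Htr] Hfin Hz Heq.
assert (Hf : holo f).
{ intros z. destruct (Hent z) as [l Hl]. exists l. now apply cderiv_is_derive. }
destruct (finite_order_bound f Hfin) as [M HM].
destruct (finite_order_factorization f M Hf Hz HM) as [P [Q [HP [HQ HfPQ]]]].
assert (HP0 : exists z, P z <> RtoC 0).
{ apply NNPP. intros Hno. apply Htr. apply is_polynomial_ext with (fun _ => RtoC 0).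
  - intros z. rewrite HfPQ. destruct (Ceq_dec (P z) (RtoC 0)) as [E|E].
    + rewrite E. ring.
    + exfalso. apply Hno. now exists z.
  - apply is_polynomial_const. }
destruct (C_derive_n_poly_exp P Q k HP HQ) as [Pk [HPk HD]].
set (B := fun z => (a z * Pk (z + beta))%C).
assert (HB : is_polynomial B).
{ apply is_polynomial_mult; trivial. now apply is_polynomial_shift. }
assert (Heq' : forall z, ((P z * Cexp (Q z)) ^ 2 + B z * Cexp (Q (z + beta)%C) =
  p1 * Cexp (alpha1 * z) + p2 * Cexp (alpha2 * z))%C).
{ intros z. rewrite <- (Heq z), (HD f HfPQ), HfPQ. unfold B. ring. }
(* A constant [Q] would make [f] a polynomial, and degree at least 2 would force [P] to vanish, so
   degree 1 remains. *)
destruct (is_polynomial_degree Q HQ) as [Hconst|[n [q [Hq HQq]]]].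
{ exfalso. apply Htr. apply is_polynomial_ext with (fun z => Cexp (Q (RtoC 0)) * P z)%C.
  - intros z. rewrite HfPQ, (Hconst z). ring.
  - now apply is_polynomial_scal. }
destruct n as [|n].
2: { exfalso. destruct HP0 as [z0 Hz0]. apply Hz0.
  apply (exponent_degree_le_1 P B q n p1 p2 alpha1 alpha2 beta); trivial.
  intros z. rewrite <- !HQq. apply Heq'. }
set (gam := q 1%nat) in *. set (q0 := q 0%nat).
assert (HQ1 : forall z, Cexp (Q z) = (Cexp q0 * Cexp (gam * z))%C).
{ intros z. rewrite HQq, cpoly_S, cpoly_0, Cpow_1_r. apply Cexp_plus. }
set (P1 := fun z => (Cexp q0 * P z)%C).
assert (HP1 : is_polynomial P1) by now apply is_polynomial_scal.
assert (HfP1 : forall z, f z = (P1 z * Cexp (gam * z))%C).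
{ intros z. rewrite HfPQ, HQ1. unfold P1. ring. }
destruct HP0 as [z0 Hz0].
assert (Hz1 : P1 z0 <> RtoC 0) by (apply Cmult_neq_0; [apply Cexp_neq_0|exact Hz0]).
assert (Hcase := exponents_match (fun z => P1 z * P1 z)%C
  (fun z => (Cexp q0 * Cexp (gam * beta)) * B z)%C gam p1 p2 alpha1 alpha2).
assert (Hcase' := Hcase (is_polynomial_mult _ _ HP1 HP1) (is_polynomial_scal _ _ HB)
  (ex_intro _ z0 (Cmult_neq_0 _ _ Hz1 Hz1)) Hp1 Hp2 Hq Hal). clear Hcase.
(* A polynomial whose square is constant is bounded, hence constant; [|P1| ^ 2 = |p|] gives
   [|P1| <= |p| + 1]. *)
assert (Hconst : forall p, (forall z, P1 z * P1 z = p)%C -> forall z, P1 z = P1 (RtoC 0)).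
{ intros p Hp. apply (is_polynomial_bounded P1 (Cmod p + 1)); trivial.
  intros z. rewrite <- (Hp z), Cmod_mult. assert (K := Cmod_ge_0 (P1 z)). nra. }
exists (P1 (RtoC 0)), gam. split; [exact Hq|].
destruct Hcase' as [[E1 [E2 E3]]|[E1 [E2 E3]]].
- intros z. rewrite <- (Heq' z), !HQ1. unfold P1.
  replace (gam * (z + beta))%C with (gam * beta + gam * z)%C by ring.
  replace (2 * gam * z)%C with (gam * z + gam * z)%C by ring. rewrite !Cexp_plus. ring.
- split; [intros z; rewrite HfP1, (Hconst p1 E3); ring|].
  left. split; [|split]; trivial. rewrite <- (E3 (RtoC 0)). ring.
- split; [intros z; rewrite HfP1, (Hconst p2 E3); ring|].
  right. split; [|split]; trivial. rewrite <- (E3 (RtoC 0)). ring.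
Qed.

(** The square of [f] cancels [p exp (2 gam z)] exactly; what is left is [a z] times a nonzero
    constant times [exp (gam z)], equal to [q exp (gam z)]. Neutral names [p], [q] let both
    alternatives use it, with [p1] and [p2] exchanged. *)
Lemma coefficient_constant (c gam p q beta : C) (a : C -> C) (k : nat) (f : C -> C) :
  gam <> RtoC 0 -> c <> RtoC 0 -> (c ^ 2 = p)%C ->
  (forall z, f z = (c * Cexp (gam * z))%C) ->
  (forall z : C, (f z ^ 2 + a z * C_derive_n f k (z + beta)
       = p * Cexp (2 * gam * z) + q * Cexp (gam * z))%C) ->
  exists a0, (forall z, a z = a0) /\ (a0 * c * gam ^ k * Cexp (gam * beta) = q)%C.
Proof.
intros Hg Hc Hcp Hf Heq.
assert (Hd : (c * gam ^ k * Cexp (gam * beta))%C <> RtoC 0).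
{ repeat apply Cmult_neq_0; trivial; [now apply Cpow_nz|apply Cexp_neq_0]. }
exists (q / (c * gam ^ k * Cexp (gam * beta)))%C. split.
2: { field. repeat split; trivial; [apply Cexp_neq_0|now apply Cpow_nz]. }
intros z. specialize (Heq z). rewrite (C_derive_n_exp c gam k f Hf), Hf, <- Hcp in Heq.
replace (gam * (z + beta))%C with (gam * beta + gam * z)%C in Heq by ring.
replace (2 * gam * z)%C with (gam * z + gam * z)%C in Heq by ring.
rewrite !Cexp_plus in Heq.
assert (E : (a z * (c * gam ^ k * Cexp (gam * beta)) * Cexp (gam * z) = q * Cexp (gam * z))%C).
{ apply Ceq_minus in Heq. apply Ceq_minus. rewrite <- Heq. ring. }
assert (Hez := Cexp_neq_0 (gam * z)).
replace q with (q * Cexp (gam * z) / Cexp (gam * z))%C by (field; exact Hez).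
rewrite <- E. field. repeat split; trivial; [apply Cexp_neq_0|now apply Cpow_nz].
Qed.

Theorem corollary2 (p1 p2 alpha1 alpha2 beta : C) (a : C -> C) (k : nat)
    (f : C -> C)
    (hp1 : p1 <> RtoC 0) (hp2 : p2 <> RtoC 0)
    (halpha1 : alpha1 <> RtoC 0) (halpha2 : alpha2 <> RtoC 0)
    (halpha : alpha1 <> alpha2)
    (ha : is_polynomial a) (ha0 : exists z : C, a z <> RtoC 0)
    (hf : transcendental_entire f)
    (hfin : finite_order f)
    (hreg : regular_growth f)
    (hpic : finitely_many_zeros f)
    (heq : forall z : C,
      (f z ^ 2 + a z * C_derive_n f k (z + beta)
       = p1 * Cexp (alpha1 * z) + p2 * Cexp (alpha2 * z))%C) :
  order f = Finite 1 /\
  exists a0 : C, (forall z : C, a z = a0) /\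
    ((exists c1 : C,
        (c1 ^ 2 = p1)%C /\
        (forall z : C, (f z = c1 * Cexp (alpha1 * z / 2))%C) /\
        (a0 * c1 * (alpha1 / 2) ^ k * Cexp (alpha1 * beta / 2) = p2)%C /\
        (alpha1 = 2 * alpha2)%C)
     \/
     (exists c2 : C,
        (c2 ^ 2 = p2)%C /\
        (forall z : C, (f z = c2 * Cexp (alpha2 * z / 2))%C) /\
        (a0 * c2 * (alpha2 / 2) ^ k * Cexp (alpha2 * beta / 2) = p1)%C /\
        (alpha2 = 2 * alpha1)%C)).
Proof.
destruct (solution_form p1 p2 alpha1 alpha2 beta a k f) as [c [gam [Hg [Hfc Hcase]]]]; trivial.
assert (H2 : RtoC 2 <> RtoC 0) by (intros E; apply RtoC_inj in E; lra).
assert (Hc : c <> RtoC 0).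
{ intros E. destruct Hcase as [[_ [_ Hp]]|[_ [_ Hp]]].
  - apply hp1. rewrite <- Hp, E. simpl. ring.
  - apply hp2. rewrite <- Hp, E. simpl. ring. }
split.
(* [order] takes a function as argument, so the pointwise formula has to become an equality of
   functions. *)
{ replace f with (fun z => (c * Cexp (gam * z))%C); [now apply order_exp|].
  apply FunctionalExtensionality.functional_extensionality. intros z. symmetry. apply Hfc. }
assert (Eh : forall w : C, (2 * gam * w / 2 = gam * w)%C) by (intros w; field; exact H2).
assert (Eg : (2 * gam / 2 = gam)%C) by (field; exact H2).
(* After substitution both exponents are expressed by [gam]: the relation between them becomes
   trivial, the halved exponent is [gam], and [c] itself is the required square root. *)
destruct Hcase as [[E1 [E2 Hp]]|[E1 [E2 Hp]]]; subst alpha1 alpha2.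
- destruct (coefficient_constant c gam p1 p2 beta a k f Hg Hc Hp Hfc heq) as [a0 [Ha0 Hq]].
  exists a0. split; trivial. left. exists c. rewrite Eh, Eg.
  split; [|split; [|split]]; trivial. intros z. now rewrite Eh.
- destruct (coefficient_constant c gam p2 p1 beta a k f Hg Hc Hp Hfc) as [a0 [Ha0 Hq]].
  { intros z. rewrite heq. ring. }
  exists a0. split; trivial. right. exists c. rewrite Eh, Eg.
  split; [|split; [|split]]; trivial. intros z. now rewrite Eh.
Qed.
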